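(* Let $\mathcal M=Q[-1]\oplus B^*[-2]$ be a split $[2]$-manifold endowed with a homological vector field $\mathcal Q$ and a Poisson bracket $\{\cdot,\cdot\}$ of degree $-2$. Let $(\partial_B:Q^*\to B,\Delta,\nabla,R_Q)$ be the Dorfman $2$-representation of $(Q,\rho_Q)$ that encodes $\mathcal Q$ in coordinates, and let $(\partial_Q:Q^*\to Q,\nabla^Q,\nabla^{Q^*},R_B)$ be the self-dual $2$-representation of the Lie algebroid $B$ that is equivalent to the Poisson bracket. Then $(\mathcal M,\mathcal Q,\{\cdot,\cdot\})$ is a Poisson Lie $2$-algebroid if and only if the self-dual $2$-representation and the Dorfman $2$-representation form a matched pair.
   Context: **Split $[2]$-manifold.** For vector bundles $Q,B\to M$, $Q[-1]\oplus B^*[-2]$ has as functions the graded commutative algebra generated over $C^\infty(M)$ by $\Gamma(Q^* )$ (degree $1$) and $\Gamma(B)$ (degree $2$). A homological vector field is a degree $1$ graded derivation $\mathcal Q$ with $\mathcal Q^2=0$. A Poisson bracket of degree $-2$ is an $\mathbb R$-bilinear bracket with $|\{\xi,\eta\}|=|\xi|+|\eta|-2$, $\{\xi,\eta\}=-(-1)^{|\xi||\eta|}\{\eta,\xi\}$, $\{\xi_1,\xi_2\xi_3\}=\{\xi_1,\xi_2\}\xi_3+(-1)^{|\xi_1||\xi_2|}\xi_2\{\xi_1,\xi_3\}$, $\{\xi_1,\{\xi_2,\xi_3\}\}=\{\{\xi_1,\xi_2\},\xi_3\}+(-1)^{|\xi_1||\xi_2|}\{\xi_2,\{\xi_1,\xi_3\}\}$.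 It is a Poisson Lie $2$-algebroid if $\mathcal Q\{\xi_1,\xi_2\}=\{\mathcal Q\xi_1,\xi_2\}+(-1)^{|\xi_1|}\{\xi_1,\mathcal Q\xi_2\}$ for all homogeneous $\xi_1,\xi_2$. **Dorfman $2$-representations.** Let $(Q,\rho_Q:Q\to TM)$ be anchored. A Dorfman connection is an $\mathbb R$-bilinear $\Delta:\Gamma(Q)\times\Gamma(Q^* )\to\Gamma(Q^* )$ with $\Delta_q(f\tau)=f\Delta_q\tau+\rho_Q(q)(f)\tau$, $\Delta_{fq}\tau=f\Delta_q\tau+\langle q,\tau\rangle\rho_Q^*\mathbf df$, $\Delta_q(\rho_Q^*\mathbf df)=\rho_Q^*\mathbf d(\rho_Q(q)f)$; dual dull bracket $\langle[\![q_1,q_2]\!]_\Delta,\tau\rangle=\rho_Q(q_1)\langle q_2,\tau\rangle-\langle q_2,\Delta_{q_1}\tau\rangle$. A Dorfman $2$-representation $(\partial_B,\Delta,\nabla,R_Q)$ consists of a vector bundle map $\partial_B:Q^*\to B$, a Dorfman connection $\Delta$, a linear connection $\nabla:\Gamma(Q)\times\Gamma(B)\to\Gamma(B)$ and $R_Q\in\Omega^2(Q,\mathrm{Hom}(B,Q^* ))$ with: $\partial_B\circ\Delta_q=\nabla_q\circ\partial_B$; $[\![\cdot,\cdot]\!]_\Delta$ skew-symmetric; $\nabla^*_{\partial_B^*\xi_1}\xi_2+\nabla^*_{\partial_B^*\xi_2}\xi_1=0$ for $\xi_i\in\Gamma(B^* )$; $\partial_B\circ R_Q(q_1,q_2)=R_\nabla(q_1,q_2)$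 and $R_Q(q_1,q_2)\circ\partial_B=R_\Delta(q_1,q_2)$; $R_Q(q_1,q_2)^*q_3=-R_Q(q_1,q_3)^*q_2$, so that $\omega_R(q_1,q_2,q_3):=R_Q(q_1,q_2)^*q_3$ defines $\omega_R\in\Omega^3(Q,B^* )$; and $\mathbf d_{\nabla^*}\omega_R=0$ (curvatures and Koszul differential computed with $[\![\cdot,\cdot]\!]_\Delta$). **Encoding $\mathcal Q$.** Every homological vector field on $Q[-1]\oplus B^*[-2]$ is given by a unique anchor $\rho_Q$ and Dorfman $2$-representation via the local formula $$\mathcal Q=\sum_{i,j}\rho_Q(q_i)(x_j)\tau_i\partial_{x_j}-\sum_{i<j}\sum_k\langle[\![q_i,q_j]\!]_\Delta,\tau_k\rangle\tau_i\tau_j\partial_{\tau_k}+\sum_{r,k}\langle\partial_B^*\beta_r,\tau_k\rangle b_r\partial_{\tau_k}-\sum_{i<j<k}\sum_l\omega_R(q_i,q_j,q_k)(b_l)\tau_i\tau_j\tau_k\partial_{b_l}-\sum_{i,j,l}\langle\nabla^*_{q_i}\beta_j,b_l\rangle\tau_ib_j\partial_{b_l},$$ with $(x_j)$ coordinates on $M$, dual local frames $(q_i),(\tau_i)$ of $Q,Q^*$ and $(\beta_j),(b_j)$ of $B^*,B$. **Self-dual $2$-representations and Poisson brackets.** A $2$-representation of a Lie algebroid $B$ on $\partial_Q:Q^*\to Q$ consists of $B$-connections $\nabla^{Q^*},\nabla^Q$ with $\partial_Q\nabla^{Q^*}=\nabla^Q\partial_Q$ and $R_B\in\Omega^2(B,\mathrm{Hom}(Q,Q^*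 ))$ with $R_{\nabla^{Q^*}}=R_B\circ\partial_Q$, $R_{\nabla^Q}=\partial_Q\circ R_B$, $\mathbf d_{\nabla^{\mathrm{Hom}}}R_B=0$; it is self-dual if $\partial_Q=\partial_Q^*$, $\nabla^Q,\nabla^{Q^*}$ are dual, and $R_B^*=-R_B$. Poisson brackets of degree $-2$ on $Q[-1]\oplus B^*[-2]$ correspond bijectively to Lie algebroid structures on $B$ with a self-dual $2$-representation by $\{f_1,f_2\}=\{f,\tau\}=0$, $\{\tau_1,\tau_2\}=\langle\tau_2,\partial_Q\tau_1\rangle$, $\{b,f\}=\rho_B(b)f$, $\{b,\tau\}=\nabla^{Q^*}_b\tau$, $\{b_1,b_2\}=[b_1,b_2]-R_B(b_1,b_2)$, with $R_B(b_1,b_2)\in\Gamma(\wedge^2Q^* )$ ($\tau_1\wedge\tau_2$ is identified with $q\mapsto\langle\tau_1,q\rangle\tau_2-\langle\tau_2,q\rangle\tau_1$). **Matched pair.** (All connections are written $\nabla$.) The two structures form a matched pair if for all $q,q_1,q_2\in\Gamma(Q)$, $b,b_1,b_2\in\Gamma(B)$, $\tau\in\Gamma(Q^* )$: (M1) $\partial_Q(\Delta_q\tau)=\nabla_{\partial_B\tau}q+[\![q,\partial_Q\tau]\!]_\Delta+\partial_B^*\langle\tau,\nabla_\cdot q\rangle$; (M2) $\partial_B(\nabla_b\tau)=[b,\partial_B\tau]+\nabla_{\partial_Q\tau}b$; (M3) $\partial_BR_B(b_1,b_2)q=-\nabla_q[b_1,b_2]+[\nabla_qb_1,b_2]+[b_1,\nabla_qb_2]+\nabla_{\nabla_{b_2}q}b_1-\nabla_{\nabla_{b_1}q}b_2$;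 (M4) $\partial_QR_Q(q_1,q_2)b=-\nabla_b[\![q_1,q_2]\!]_\Delta+[\![q_1,\nabla_bq_2]\!]_\Delta+[\![\nabla_bq_1,q_2]\!]_\Delta+\nabla_{\nabla_{q_2}b}q_1-\nabla_{\nabla_{q_1}b}q_2+\partial_B^*\langle R_B(\cdot,b)q_1,q_2\rangle$; (M5) $\mathbf d_{\nabla^B}\omega_R=\mathbf d_{\nabla^Q}\omega_B$ in $\Omega^2(B,\wedge^3Q^* )=\Omega^3(Q,\wedge^2B^* )$, where $\omega_R$ is seen in $\Omega^1(B,\wedge^3Q^* )$ with the $B$-connection on $\wedge^3Q^*$ induced by $\nabla^{Q^*}$, $\omega_B\in\Omega^2(Q,\wedge^2B^* )$ is $\omega_B(q_1,q_2)(b_1,b_2)=\langle R_B(b_1,b_2)q_1,q_2\rangle$, and $\mathbf d_{\nabla^Q}$ is the Koszul operator of $[\![\cdot,\cdot]\!]_\Delta$ and the $Q$-connection on $\wedge^2B^*$ induced by $\nabla^*$. *)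

(* Defs.v *)
From HB Require Import structures.
From mathcomp Require Import all_boot all_order all_algebra.
From mathcomp Require Import all_classical all_reals all_analysis.
Set Implicit Arguments.
Unset Strict Implicit.
Unset Printing Implicit Defensive.
Import Order.TTheory GRing.Theory Num.Theory.
Import numFieldNormedType.Exports.
Local Open Scope classical_set_scope.
Local Open Scope ring_scope.

(* [Ck k U g]: all iterated partial derivatives of [g] of order at most [k]
   exist and are continuous at every point of the open set [U]. *)
Fixpoint Ck (R : realType) (n k : nat) (U : set 'rV[R]_n) (g : 'rV[R]_n -> R)
    : Prop :=
  (forall x, U x -> {for x, continuous g}) /\
  (if k is k'.+1 then
     forall j : 'I_n,
       (forall x, U x -> derivable g x (delta_mx 0 j)) /\
       Ck k' U (fun x => 'D_(delta_mx 0 j) g x)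
   else True).

Definition Csmooth (R : realType) (n : nat) (U : set 'rV[R]_n)
    (g : 'rV[R]_n -> R) : Prop := forall k, Ck k U g.

(* [chart c] is only meaningful on [dom c], and [unchart c] (its inverse) on
   the image [chart c @` dom c]. *)
Record manifold (R : realType) (n : nat) := Manifold {
  carrier :> topologicalType;
  atlas : Type;
  dom : atlas -> set carrier;
  chart : atlas -> carrier -> 'rV[R]_n;
  unchart : atlas -> 'rV[R]_n -> carrier;
  carrier_hausdorff : hausdorff_space carrier;
  carrier_second_countable : @second_countable carrier;
  dom_open : forall c, open (dom c);
  dom_cover : forall m, exists c, dom c m;
  chartK : forall c m, dom c m -> unchart c (chart c m) = m;
  chart_open : forall c, open (chart c @` dom c);
  chart_continuous : forall c m, dom c m -> {for m, continuous (chart c)};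
  unchart_continuous : forall c x, (chart c @` dom c) x ->
    {for x, continuous (unchart c)};
  chart_trans : forall c c' (j : 'I_n),
    Csmooth (chart c @` (dom c `&` dom c'))
            (fun x => chart c' (unchart c x) 0 j) }.

Arguments dom {R n _}.
Arguments chart {R n _}.
Arguments unchart {R n _}.

Section Bundles.
Context {R : realType} {n : nat} {M : manifold R n}.

Definition smooth_on (U : set M) (f : M -> R) : Prop :=
  forall c : atlas M, Csmooth (chart c @` (dom c `&` U)) (f \o unchart c).

Definition smooth (f : M -> R) : Prop := smooth_on setT f.

Definition smooth_near (m : M) (f : M -> R) : Prop :=
  exists U, [/\ open U, U m & smooth_on U f].

(* Tangent vectors at [m] are represented by the operators
   f |-> \sum_j a_j (df / dx_j)(m) on functions that are smooth near [m]. *)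
Definition tangent (m : M) (v : (M -> R) -> R) : Prop :=
  exists c (a : 'rV[R]_n), dom c m /\
    forall f, smooth_near m f ->
      v f = \sum_j a 0 j * 'D_(delta_mx 0 j) (f \o unchart c) (chart c m).

Definition sec (V : M -> vectType R) : Type := forall m, V m.

Implicit Types V : M -> vectType R.

Definition secD V (s t : sec V) : sec V := fun m => s m + t m.
Definition secZ V (f : M -> R) (s : sec V) : sec V := fun m => f m *: s m.
Definition secN V (s : sec V) : sec V := fun m => - s m.
Definition sec0 V : sec V := fun m => 0.

(* A smooth vector bundle of rank [r], given by its fibres and a cover by local
   frames whose change-of-frame matrices are smooth. *)
Record vbundle (r : nat) := VBundle {
  fib :> M -> vectType R;
  triv : Type;
  tdom : triv -> set M;
  frame : triv -> 'I_r -> sec fib;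
  tdom_open : forall a, open (tdom a);
  tdom_cover : forall m, exists a, tdom a m;
  frame_basis : forall a m, tdom a m ->
    basis_of fullv [tuple frame a i m | i < r];
  frame_smooth : forall a a' (i j : 'I_r),
    smooth_on (tdom a `&` tdom a')
      (fun m => coord [tuple frame a k m | k < r] i (frame a' j m)) }.

Definition bdual r (E : vbundle r) (m : M) : vectType R := 'Hom(E m, R^o).

Definition pairing r (E : vbundle r) (t : sec (bdual E)) (s : sec E) : M -> R :=
  fun m => t m (s m).

(* [Gam E] is the space of smooth sections of E, [Gamd E] that of E^*. *)
Definition Gam r (E : vbundle r) (s : sec E) : Prop :=
  forall (a : triv E) i,
    smooth_on (tdom a) (fun m => coord [tuple frame a k m | k < r] i (s m)).

Definition Gamd r (E : vbundle r) (t : sec (bdual E)) : Prop :=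
  forall (a : triv E) i, smooth_on (tdom a) (fun m => t m (frame a i m)).

Definition the T (x0 : T) (P : T -> Prop) : T :=
  if pselect (exists x, P x) is left e then sval (cid e) else x0.

(* A C^oo(M)-linear map Gamma(E) -> C^oo(M) is pairing with a unique section of
   E^*, and a C^oo(M)-linear map Gamma(E^* ) -> C^oo(M) is pairing with a unique
   section of E; these are the sections in question. *)
Definition as_covector r (E : vbundle r) (phi : sec E -> M -> R)
    : sec (bdual E) :=
  the (@sec0 (bdual E)) (fun t => Gamd t /\
    forall s, Gam s -> forall m, pairing t s m = phi s m).

Definition as_vector r (E : vbundle r) (phi : sec (bdual E) -> M -> R)
    : sec E :=
  the (@sec0 E) (fun s => Gam s /\
    forall t, Gamd t -> forall m, pairing t s m = phi t m).

(* A map of vector bundles E -> TM; [rho m v f] is the derivative of [f] along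
   the tangent vector rho(v). *)
Definition anchor_map r (E : vbundle r) : Type :=
  forall m, E m -> (M -> R) -> R.

Definition along r (E : vbundle r) (rho : anchor_map E) (q : sec E)
    (f : M -> R) : M -> R := fun m => rho m (q m) f.

Record is_anchor r (E : vbundle r) (rho : anchor_map E) : Prop := {
  anchor_tangent : forall m v, tangent m (rho m v);
  anchor_linear : forall m (a : R) u v f, smooth_near m f ->
    rho m (a *: u + v) f = a * rho m u f + rho m v f;
  anchor_smooth : forall U q f, open U -> Gam q -> smooth_on U f ->
    smooth_on U (along rho q f) }.

(* rho^* df *)
Definition codiff r (E : vbundle r) (rho : anchor_map E) (f : M -> R)
    : sec (bdual E) := as_covector (fun q => along rho q f).

(* A linear E-connection on the vector bundle V whose space of smooth sections
   is [G]. *)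
Record is_connection r (E : vbundle r) (rho : anchor_map E) V
    (G : sec V -> Prop) (nab : sec E -> sec V -> sec V) : Prop := {
  conn_sec : forall q s, Gam q -> G s -> G (nab q s);
  conn_addl : forall q1 q2 s, Gam q1 -> Gam q2 -> G s ->
    nab (secD q1 q2) s = secD (nab q1 s) (nab q2 s);
  conn_addr : forall q s1 s2, Gam q -> G s1 -> G s2 ->
    nab q (secD s1 s2) = secD (nab q s1) (nab q s2);
  conn_scalel : forall f q s, smooth f -> Gam q -> G s ->
    nab (secZ f q) s = secZ f (nab q s);
  conn_scaler : forall f q s, smooth f -> Gam q -> G s ->
    nab q (secZ f s) = secD (secZ f (nab q s)) (secZ (along rho q f) s) }.

(* <nab^*_q t, s> = rho(q)<t, s> - <t, nab_q s> *)
Definition dual_conn r r' (E : vbundle r) (F : vbundle r')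
    (rho : anchor_map E) (nab : sec E -> sec F -> sec F)
    (q : sec E) (t : sec (bdual F)) : sec (bdual F) :=
  as_covector (fun s m => along rho q (pairing t s) m - pairing t (nab q s) m).

Definition curvature r (E : vbundle r) V (br : sec E -> sec E -> sec E)
    (nab : sec E -> sec V -> sec V) (q1 q2 : sec E) (s : sec V) : sec V :=
  fun m => nab q1 (nab q2 s) m - nab q2 (nab q1 s) m - nab (br q1 q2) s m.

(* Koszul operator. A form is a function of a list of sections of E; its
   coefficients are functions of a further argument in X, with values in
   sections of V. [D] is the covariant derivative of the coefficients. *)
Definition rem_at T (i : nat) (s : seq T) : seq T := take i s ++ drop i.+1 s.

Definition koszul r (E : vbundle r) X V (br : sec E -> sec E -> sec E)
    (D : sec E -> (X -> sec V) -> X -> sec V)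
    (w : seq (sec E) -> X -> sec V) (s : seq (sec E)) (x : X) : sec V :=
  fun m =>
  \sum_(i < size s)
     (-1) ^+ i *: D (nth (@sec0 E) s i) (w (rem_at i s)) x m +
  \sum_(j < size s) \sum_(i < j)
     (-1) ^+ (i + j) *:
       w (br (nth (@sec0 E) s i) (nth (@sec0 E) s j)
            :: rem_at i (rem_at j s)) x m.

Definition scalars (m : M) : vectType R := R^o.

(* The connection induced on multilinear forms on F by a connection on F
   (equivalently, by the dual connection on F^* ). *)
Definition form_conn r r' (E : vbundle r) (F : vbundle r')
    (rho : anchor_map E) (nab : sec E -> sec F -> sec F) (q : sec E)
    (phi : seq (sec F) -> sec scalars) (s : seq (sec F)) : sec scalars :=
  fun m => along rho q (phi s) m -
    \sum_(i < size s)
      phi (set_nth (@sec0 F) s i (nab q (nth (@sec0 F) s i))) m.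

End Bundles.

Arguments vbundle {R n} M r.
Arguments sec {R n M} V.
Arguments sec0 {R n M} V.
Arguments is_connection {R n M r E} rho {V} G nab.
Arguments scalars {R n M} m.

(* Shuffle products on functions of a list of vectors (in degree 1, odd) and a
   list of covectors (in degree 2, even). They are the unique products for
   which evaluating the first argument at w (resp. v) is a derivation
   (resp. a graded derivation). On multilinear alternating (resp. symmetric)
   functions these are the products of /\ Q_m^* and S B_m: tau1 tau2 is
   (q1, q2) |-> tau1(q1) tau2(q2) - tau1(q2) tau2(q1). *)
Fixpoint sym_mul (R : pzRingType) (W : Type) (f g : seq W -> R) (ws : seq W)
    : R :=
  if ws is w :: ws' then
    sym_mul (fun us => f (w :: us)) g ws' +
    sym_mul f (fun us => g (w :: us)) ws'
  else f [::] * g [::].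

Fixpoint gr_mul (R : pzRingType) (V W : Type) (f g : seq V -> seq W -> R)
    (vs : seq V) (ws : seq W) : R :=
  if vs is v :: vs' then
    gr_mul (fun us => f (v :: us)) g vs' ws +
    gr_mul (fun us xs => (-1) ^+ size us * f us xs)
           (fun us => g (v :: us)) vs' ws
  else sym_mul (f [::]) (g [::]) ws.

Section Functions.
Context {R : realType} {n rQ rB : nat} {M : manifold R n}.
Variables (Q : vbundle M rQ) (B : vbundle M rB).

(* The fibre at m of \bigoplus_(k, l) /\^k Q^* (x) S^l B, as functions on
   lists of elements of Q_m and of B^*_m. *)
Definition gfib (m : M) : Type := seq (Q m) -> seq (bdual B m) -> R.

Definition gfun : Type := forall m, gfib m.

(* [homog d xi]: [xi] is a function of degree [d], that is, a smooth section of
   the sum of the bundles /\^k Q^* (x) S^l B over k + 2 l = d. *)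
Record homog (d : nat) (xi : gfun) : Prop := {
  homog_deg : forall m vs ws, (size vs + 2 * size ws != d)%N -> xi m vs ws = 0;
  homog_lin1 : forall m vs1 vs2 ws (a : R) (u v : Q m),
    xi m (vs1 ++ (a *: u + v) :: vs2) ws =
    a * xi m (vs1 ++ u :: vs2) ws + xi m (vs1 ++ v :: vs2) ws;
  homog_lin2 : forall m vs ws1 ws2 (a : R) (u w : bdual B m),
    xi m vs (ws1 ++ (a *: u + w) :: ws2) =
    a * xi m vs (ws1 ++ u :: ws2) + xi m vs (ws1 ++ w :: ws2);
  homog_alt : forall m vs1 vs2 ws (v : Q m),
    xi m (vs1 ++ v :: v :: vs2) ws = 0;
  homog_sym : forall m vs ws1 ws2 (u w : bdual B m),
    xi m vs (ws1 ++ u :: w :: ws2) = xi m vs (ws1 ++ w :: u :: ws2);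
  homog_smooth : forall k l (q : 'I_k -> sec Q) (beta : 'I_l -> sec (bdual B)),
    (forall i, Gam (q i)) -> (forall j, Gamd (beta j)) ->
    smooth (fun m => xi m [seq q i m | i <- enum 'I_k]
                          [seq beta j m | j <- enum 'I_l]) }.

Definition gadd (xi eta : gfun) : gfun :=
  fun m vs ws => xi m vs ws + eta m vs ws.
Definition gscale (a : R) (xi : gfun) : gfun := fun m vs ws => a * xi m vs ws.
Definition gzero : gfun := fun m vs ws => 0.
Definition gmul (xi eta : gfun) : gfun := fun m => gr_mul (xi m) (eta m).
Definition gsign (k : nat) (xi : gfun) : gfun := gscale ((-1) ^+ k) xi.

Definition of_covec (m : M) (t : bdual Q m) : gfib m :=
  fun vs ws => if (vs, ws) is ([:: v], [::]) then t v else 0.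
Definition of_vec (m : M) (b : B m) : gfib m :=
  fun vs ws => if (vs, ws) is ([::], [:: w]) then w b else 0.

Definition of_fun (f : M -> R) : gfun :=
  fun m vs ws => if (vs, ws) is ([::], [::]) then f m else 0.
Definition of_Qd (t : sec (bdual Q)) : gfun := fun m => of_covec (t m).
Definition of_B (b : sec B) : gfun := fun m => of_vec (b m).
Definition of_2form (w : forall m, Q m -> Q m -> R) : gfun :=
  fun m vs ws => if (vs, ws) is ([:: v1; v2], [::]) then w m v1 v2 else 0.

Record homological (D : gfun -> gfun) : Prop := {
  hvf_deg : forall k xi, homog k xi -> homog k.+1 (D xi);
  hvf_lin : forall k xi eta (a : R), homog k xi -> homog k eta ->
    D (gadd (gscale a xi) eta) = gadd (gscale a (D xi)) (D eta);
  hvf_der : forall k l xi eta, homog k xi -> homog l eta ->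
    D (gmul xi eta) = gadd (gmul (D xi) eta) (gsign k (gmul xi (D eta)));
  hvf_sq : forall k xi, homog k xi -> D (D xi) = gzero }.

Record poisson (br : gfun -> gfun -> gfun) : Prop := {
  br_deg : forall k l xi eta, homog k xi -> homog l eta ->
    if (k + l < 2)%N then br xi eta = gzero
    else homog (k + l - 2) (br xi eta);
  br_linl : forall k l xi1 xi2 eta (a : R),
    homog k xi1 -> homog k xi2 -> homog l eta ->
    br (gadd (gscale a xi1) xi2) eta =
    gadd (gscale a (br xi1 eta)) (br xi2 eta);
  br_linr : forall k l xi eta1 eta2 (a : R),
    homog k xi -> homog l eta1 -> homog l eta2 ->
    br xi (gadd (gscale a eta1) eta2) =
    gadd (gscale a (br xi eta1)) (br xi eta2);
  br_skew : forall k l xi eta, homog k xi -> homog l eta ->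
    br xi eta = gscale (- (-1) ^+ (k * l)) (br eta xi);
  br_leibniz : forall k l p xi1 xi2 xi3,
    homog k xi1 -> homog l xi2 -> homog p xi3 ->
    br xi1 (gmul xi2 xi3) =
    gadd (gmul (br xi1 xi2) xi3) (gsign (k * l) (gmul xi2 (br xi1 xi3)));
  br_jacobi : forall k l p xi1 xi2 xi3,
    homog k xi1 -> homog l xi2 -> homog p xi3 ->
    br xi1 (br xi2 xi3) =
    gadd (br (br xi1 xi2) xi3) (gsign (k * l) (br xi2 (br xi1 xi3))) }.

Definition poisson_lie2 (D : gfun -> gfun) (br : gfun -> gfun -> gfun) : Prop :=
  [/\ homological D, poisson br &
   forall k l xi1 xi2, homog k xi1 -> homog l xi2 ->
     D (br xi1 xi2) = gadd (br (D xi1) xi2) (gsign k (br xi1 (D xi2)))].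

Record dorfman2 := Dorfman2 {
  rhoQ : anchor_map Q;
  dB : forall m, 'Hom(bdual Q m, B m);
  Delta : sec Q -> sec (bdual Q) -> sec (bdual Q);
  nabQB : sec Q -> sec B -> sec B;
  RQ : forall m, Q m -> Q m -> 'Hom(B m, bdual Q m) }.

Definition dBs (D : dorfman2) (t : sec (bdual Q)) : sec B :=
  fun m => dB D m (t m).

(* the transpose B^* -> Q of dB *)
Definition dBt (D : dorfman2) (beta : sec (bdual B)) : sec Q :=
  as_vector (fun t => pairing beta (dBs D t)).

Definition RQs (D : dorfman2) (q1 q2 : sec Q) (b : sec B) : sec (bdual Q) :=
  fun m => RQ D (q1 m) (q2 m) (b m).

Definition dull (D : dorfman2) (q1 q2 : sec Q) : sec Q :=
  as_vector (fun t m =>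
    along (rhoQ D) q1 (pairing t q2) m - pairing (Delta D q1 t) q2 m).

(* omega_R(q1, q2, q3)(b) = <R_Q(q1, q2)^* q3, b> *)
Definition omegaR (D : dorfman2) (q1 q2 q3 : sec Q) (b : sec B) : M -> R :=
  pairing (RQs D q1 q2 b) q3.

Record is_dorfman_conn (D : dorfman2) : Prop := {
  Delta_sec : forall q t, Gam q -> Gamd t -> Gamd (Delta D q t);
  Delta_addl : forall q1 q2 t, Gam q1 -> Gam q2 -> Gamd t ->
    Delta D (secD q1 q2) t = secD (Delta D q1 t) (Delta D q2 t);
  Delta_addr : forall q t1 t2, Gam q -> Gamd t1 -> Gamd t2 ->
    Delta D q (secD t1 t2) = secD (Delta D q t1) (Delta D q t2);
  Delta_scalel : forall f q t, smooth f -> Gam q -> Gamd t ->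
    Delta D (secZ f q) t =
    secD (secZ f (Delta D q t)) (secZ (pairing t q) (codiff (rhoQ D) f));
  Delta_scaler : forall f q t, smooth f -> Gam q -> Gamd t ->
    Delta D q (secZ f t) =
    secD (secZ f (Delta D q t)) (secZ (along (rhoQ D) q f) t);
  Delta_exact : forall f q, smooth f -> Gam q ->
    Delta D q (codiff (rhoQ D) f) = codiff (rhoQ D) (along (rhoQ D) q f) }.

Record is_dorfman2 (D : dorfman2) : Prop := {
  d2_anchor : is_anchor (rhoQ D);
  d2_dB : forall t, Gamd t -> Gam (dBs D t);
  d2_Delta : is_dorfman_conn D;
  d2_nab : is_connection (rhoQ D) (@Gam R n M rB B) (nabQB D);
  d2_RQ_lin : forall m (a : R) (u v q : Q m),
    RQ D (a *: u + v) q = a *: RQ D u q + RQ D v q;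
  d2_RQ_skew : forall m (u v : Q m), RQ D u v = - RQ D v u;
  d2_RQ_smooth : forall q1 q2 b, Gam q1 -> Gam q2 -> Gam b ->
    Gamd (RQs D q1 q2 b);
  d2_intertwine : forall q t, Gam q -> Gamd t ->
    dBs D (Delta D q t) = nabQB D q (dBs D t);
  d2_skew : forall q1 q2, Gam q1 -> Gam q2 ->
    dull D q1 q2 = secN (dull D q2 q1);
  d2_nab_skew : forall x1 x2, Gamd x1 -> Gamd x2 ->
    secD (dual_conn (rhoQ D) (nabQB D) (dBt D x1) x2)
         (dual_conn (rhoQ D) (nabQB D) (dBt D x2) x1) = sec0 (bdual B);
  d2_curv_nab : forall q1 q2 b, Gam q1 -> Gam q2 -> Gam b ->
    dBs D (RQs D q1 q2 b) = curvature (dull D) (nabQB D) q1 q2 b;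
  d2_curv_Delta : forall q1 q2 t, Gam q1 -> Gam q2 -> Gamd t ->
    RQs D q1 q2 (dBs D t) = curvature (dull D) (Delta D) q1 q2 t;
  d2_RQ_alt : forall q1 q2 q3 b, Gam q1 -> Gam q2 -> Gam q3 -> Gam b ->
    forall m, omegaR D q1 q2 q3 b m = - omegaR D q1 q3 q2 b m;
  d2_closed : forall q1 q2 q3 q4 b,
    Gam q1 -> Gam q2 -> Gam q3 -> Gam q4 -> Gam b ->
    koszul (dull D) (form_conn (rhoQ D) (nabQB D))
      (fun q b => if (q, b) is ([:: q1; q2; q3], [:: b])
                  then omegaR D q1 q2 q3 b else sec0 scalars)
      [:: q1; q2; q3; q4] [:: b] = sec0 scalars }.

(* Dual local frames over U; every local frame is near each point the
   restriction of global sections. *)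
Record local_frames (U : set M) (q : 'I_rQ -> sec Q)
    (tau : 'I_rQ -> sec (bdual Q)) (beta : 'I_rB -> sec (bdual B))
    (b : 'I_rB -> sec B) : Prop := {
  lf_q : forall i, Gam (q i);
  lf_tau : forall i, Gamd (tau i);
  lf_beta : forall i, Gamd (beta i);
  lf_b : forall i, Gam (b i);
  lf_dualQ : forall m i j, U m -> tau i m (q j m) = (i == j)%:R;
  lf_dualB : forall m i j, U m -> beta i m (b j m) = (i == j)%:R }.

(* The coordinate vector fields on degree 0, 1 and 2 generators. [d_x] treats
   frame elements as constants: it differentiates the coefficients of [xi]. *)
Definition d_tau (m : M) (v : Q m) (x : gfib m) : gfib m :=
  fun vs ws => x (v :: vs) ws.
Definition d_b (m : M) (w : bdual B m) (x : gfib m) : gfib m :=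
  fun vs ws => x vs (w :: ws).
Definition d_x (c : atlas M) (q : 'I_rQ -> sec Q)
    (tau : 'I_rQ -> sec (bdual Q)) (beta : 'I_rB -> sec (bdual B))
    (b : 'I_rB -> sec B) (j : 'I_n) (xi : gfun) (m : M) : gfib m :=
  fun vs ws =>
    'D_(delta_mx 0 j)
       (fun y => let m' := unchart c y in
          xi m' [seq \sum_i tau i m v *: q i m' | v <- vs]
                [seq \sum_i (w : bdual B m) (b i m) *: beta i m' | w <- ws])
       (chart c m).
Arguments d_x : clear implicits.

Definition encodes_vf (QQ : gfun -> gfun) (D : dorfman2) : Prop :=
  forall (c : atlas M) (U : set M) q tau beta b,
    open U -> U `<=` dom c -> local_frames U q tau beta b ->
  forall k xi, homog k xi -> forall m vs ws, U m ->
  let T i := of_covec (tau i m) in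
  QQ xi m vs ws =
    \sum_i \sum_j rhoQ D (q i m) (fun m' => chart c m' 0 j) *
       gr_mul (T i) (d_x c q tau beta b j xi m) vs ws
  - \sum_(j < rQ) \sum_(i < rQ | (i < j)%N) \sum_k
       pairing (tau k) (dull D (q i) (q j)) m *
       gr_mul (gr_mul (T i) (T j)) (d_tau (q k m) (xi m)) vs ws
  + \sum_r \sum_k
       pairing (tau k) (dBt D (beta r)) m *
       gr_mul (of_vec (b r m)) (d_tau (q k m) (xi m)) vs ws
  - \sum_(k < rQ) \sum_(j < rQ | (j < k)%N) \sum_(i < rQ | (i < j)%N) \sum_l
       omegaR D (q i) (q j) (q k) (b l) m *
       gr_mul (gr_mul (gr_mul (T i) (T j)) (T k)) (d_b (beta l m) (xi m)) vs ws
  - \sum_i \sum_j \sum_l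
       pairing (dual_conn (rhoQ D) (nabQB D) (q i) (beta j)) (b l) m *
       gr_mul (gr_mul (T i) (of_vec (b j m))) (d_b (beta l m) (xi m)) vs ws.

Record lie_algebroid := LieAlgebroid {
  rhoB : anchor_map B;
  lie : sec B -> sec B -> sec B }.

Record is_lie_algebroid (A : lie_algebroid) : Prop := {
  la_anchor : is_anchor (rhoB A);
  la_sec : forall b1 b2, Gam b1 -> Gam b2 -> Gam (lie A b1 b2);
  la_lin : forall (a : R) b1 b2 b3, Gam b1 -> Gam b2 -> Gam b3 ->
    lie A (secD (secZ (fun=> a) b1) b2) b3 =
    secD (secZ (fun=> a) (lie A b1 b3)) (lie A b2 b3);
  la_skew : forall b1 b2, Gam b1 -> Gam b2 -> lie A b1 b2 = secN (lie A b2 b1);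
  la_jacobi : forall b1 b2 b3, Gam b1 -> Gam b2 -> Gam b3 ->
    lie A b1 (lie A b2 b3) =
    secD (lie A (lie A b1 b2) b3) (lie A b2 (lie A b1 b3));
  la_leibniz : forall f b1 b2, smooth f -> Gam b1 -> Gam b2 ->
    lie A b1 (secZ f b2) =
    secD (secZ f (lie A b1 b2)) (secZ (along (rhoB A) b1 f) b2);
  la_morph : forall f b1 b2, smooth f -> Gam b1 -> Gam b2 -> forall m,
    along (rhoB A) (lie A b1 b2) f m =
    along (rhoB A) b1 (along (rhoB A) b2 f) m -
    along (rhoB A) b2 (along (rhoB A) b1 f) m }.

Record two_rep := TwoRep {
  dQ : forall m, 'Hom(bdual Q m, Q m);
  nabBQ : sec B -> sec Q -> sec Q;
  nabBQd : sec B -> sec (bdual Q) -> sec (bdual Q);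
  RB : forall m, B m -> B m -> 'Hom(Q m, bdual Q m) }.

Definition dQs (P : two_rep) (t : sec (bdual Q)) : sec Q :=
  fun m => dQ P m (t m).

Definition RBs (P : two_rep) (b1 b2 : sec B) (q : sec Q) : sec (bdual Q) :=
  fun m => RB P (b1 m) (b2 m) (q m).

Record is_two_rep (A : lie_algebroid) (P : two_rep) : Prop := {
  tr_dQ : forall t, Gamd t -> Gam (dQs P t);
  tr_nabQ : is_connection (rhoB A) (@Gam R n M rQ Q) (nabBQ P);
  tr_nabQd : is_connection (rhoB A) (@Gamd R n M rQ Q) (nabBQd P);
  tr_RB_lin : forall m (a : R) (u v b : B m),
    RB P (a *: u + v) b = a *: RB P u b + RB P v b;
  tr_RB_skew : forall m (u v : B m), RB P u v = - RB P v u;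
  tr_RB_smooth : forall b1 b2 q, Gam b1 -> Gam b2 -> Gam q ->
    Gamd (RBs P b1 b2 q);
  tr_intertwine : forall b t, Gam b -> Gamd t ->
    dQs P (nabBQd P b t) = nabBQ P b (dQs P t);
  tr_curv_Qd : forall b1 b2 t, Gam b1 -> Gam b2 -> Gamd t ->
    curvature (lie A) (nabBQd P) b1 b2 t = RBs P b1 b2 (dQs P t);
  tr_curv_Q : forall b1 b2 q, Gam b1 -> Gam b2 -> Gam q ->
    curvature (lie A) (nabBQ P) b1 b2 q = dQs P (RBs P b1 b2 q);
  tr_closed : forall b1 b2 b3 q, Gam b1 -> Gam b2 -> Gam b3 -> Gam q ->
    koszul (lie A)
      (fun b (phi : sec Q -> sec (bdual Q)) q m =>
         nabBQd P b (phi q) m - phi (nabBQ P b q) m)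
      (fun b => if b is [:: b1; b2] then RBs P b1 b2 else fun=> sec0 (bdual Q))
      [:: b1; b2; b3] q = sec0 (bdual Q) }.

Record is_self_dual (A : lie_algebroid) (P : two_rep) : Prop := {
  sd_two_rep : is_two_rep A P;
  sd_dQ : forall m (t1 t2 : bdual Q m), t2 (dQ P m t1) = t1 (dQ P m t2);
  sd_nab : forall b q t, Gam b -> Gam q -> Gamd t -> forall m,
    along (rhoB A) b (pairing t q) m =
    pairing (nabBQd P b t) q m + pairing t (nabBQ P b q) m;
  sd_RB : forall m (b1 b2 : B m) (q1 q2 : Q m),
    RB P b1 b2 q1 q2 = - RB P b1 b2 q2 q1 }.

(* R_B(b1, b2) : Q -> Q^* is identified with the 2-form
   (q1, q2) |-> <R_B(b1, b2) q1, q2>. *)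
Record encodes_poisson (br : gfun -> gfun -> gfun) (A : lie_algebroid)
    (P : two_rep) : Prop := {
  ep_ff : forall f g, smooth f -> smooth g ->
    br (of_fun f) (of_fun g) = gzero;
  ep_ft : forall f t, smooth f -> Gamd t ->
    br (of_fun f) (of_Qd t) = gzero;
  ep_tt : forall t1 t2, Gamd t1 -> Gamd t2 ->
    br (of_Qd t1) (of_Qd t2) = of_fun (pairing t2 (dQs P t1));
  ep_bf : forall b f, Gam b -> smooth f ->
    br (of_B b) (of_fun f) = of_fun (along (rhoB A) b f);
  ep_bt : forall b t, Gam b -> Gamd t ->
    br (of_B b) (of_Qd t) = of_Qd (nabBQd P b t);
  ep_bb : forall b1 b2, Gam b1 -> Gam b2 ->
    br (of_B b1) (of_B b2) =
    gadd (of_B (lie A b1 b2))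
         (gscale (-1) (of_2form (fun m v1 v2 => RB P (b1 m) (b2 m) v1 v2))) }.

Record matched_pair (D : dorfman2) (A : lie_algebroid) (P : two_rep) : Prop := {
  M1 : forall q t, Gam q -> Gamd t ->
    dQs P (Delta D q t) =
    secD (secD (nabBQ P (dBs D t) q) (dull D q (dQs P t)))
         (dBt D (as_covector (fun b => pairing t (nabBQ P b q))));
  M2 : forall b t, Gam b -> Gamd t ->
    dBs D (nabBQd P b t) = secD (lie A b (dBs D t)) (nabQB D (dQs P t) b);
  M3 : forall b1 b2 q, Gam b1 -> Gam b2 -> Gam q -> forall m,
    dBs D (RBs P b1 b2 q) m =
    - nabQB D q (lie A b1 b2) m
    + lie A (nabQB D q b1) b2 m + lie A b1 (nabQB D q b2) m
    + nabQB D (nabBQ P b2 q) b1 m - nabQB D (nabBQ P b1 q) b2 m;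
  M4 : forall q1 q2 b, Gam q1 -> Gam q2 -> Gam b -> forall m,
    dQs P (RQs D q1 q2 b) m =
    - nabBQ P b (dull D q1 q2) m
    + dull D q1 (nabBQ P b q2) m + dull D (nabBQ P b q1) q2 m
    + nabBQ P (nabQB D q2 b) q1 m - nabBQ P (nabQB D q1 b) q2 m
    + dBt D (as_covector (fun b' => pairing (RBs P b' b q1) q2)) m;
  M5 : forall q1 q2 q3 b1 b2,
    Gam q1 -> Gam q2 -> Gam q3 -> Gam b1 -> Gam b2 ->
    koszul (lie A) (form_conn (rhoB A) (nabBQ P))
      (fun b q => if (b, q) is ([:: b1], [:: q1; q2; q3])
                  then omegaR D q1 q2 q3 b1 else sec0 scalars)
      [:: b1; b2] [:: q1; q2; q3] =
    koszul (dull D) (form_conn (rhoQ D) (nabQB D))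
      (fun q b => if (q, b) is ([:: q1; q2], [:: b1; b2])
                  then pairing (RBs P b1 b2 q1) q2 else sec0 scalars)
      [:: q1; q2; q3] [:: b1; b2] }.

End Functions.

(* Main.v *)
(* The defect C(x, y) = QQ{x, y} - {QQ x, y} - (-1)^|x| {x, QQ y} is graded
   skew-symmetric and, since QQ and each {x, -} are graded derivations, a graded
   derivation in each argument. Graded derivations are local (bump functions) and
   near each point every function is a polynomial in the functions f, the sections
   tau of Q^* and the sections b of B, so C vanishes as soon as it vanishes on pairs
   of those. With X = rho_B o dB - rho_Q o dQ on Q^*, and
   Y(b, q) = [rho_Q q, rho_B b] - rho_B(nabla_q b) + rho_Q(nabla_b q), one finds
     C(f, g) = 0, C(f, tau) = X(tau) f, C(b, f)(q) = Y(b, q) f;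
     C(tau, tau')(q) is (M1) for (q, tau) paired with tau', up to X;
     C(b, tau) is (M2) in B, and (M4) paired with tau, up to Y, in /\^2 Q^*;
     C(b, b') is (M3) in Q^* (x) B, and (M5) in /\^3 Q^*.
   Moreover the failure of (M1), resp. (M3), to be C^oo-linear in q, resp. b', is
   governed by X, resp. Y, so X = 0 and Y = 0 follow from (M1) and (M3). *)
From HB Require Import structures.
Require Import Defs.
From mathcomp Require Import all_boot all_order all_algebra.
From mathcomp Require Import all_classical all_reals all_analysis.
From mathcomp Require Import zify ring lra.
Set Implicit Arguments.
Unset Strict Implicit.
Unset Printing Implicit Defensive.
Import Order.TTheory GRing.Theory Num.Theory.
Import numFieldNormedType.Exports.
Local Open Scope classical_set_scope.
Local Open Scope ring_scope.

(** * C^k functions on R^n *)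

(** The induction behind the vanishing of a derivation rests on Euler's identity k x = sum tau_i
    i_(q_i) x + 2 sum b_l i_(beta_l) x, valid for x of degree k over a local frame, so that no
    polynomial expansion is written down. Sections are global while frames are local; bump functions
    mediate throughout, and with C^k defined by partial derivatives even the chain rule for
    transition maps has to be proved. The encoding of QQ speaks of frames with constant
    coefficients, the matched pair equations of arbitrary sections. Hence the intrinsic expressions
    are shown to be C^oo-linear, and their arguments are then exchanged for constant combinations of
    the frame. For brackets with QQ tau and QQ b the forms are split off: on them {tau, -} is
    contraction with dQ tau and {b, -} a Lie derivative, and the rest is a sum of products of
    generators, for b over a frame only. (M1) and (M3) give X(tau) f and Y(b, q) f only multiplied
    by <tau, q> and <w, b>. Where tau or b vanishes at the point this says nothing, and the
    C^oo-linearity of X in tau and of Y in b fills the gap. *)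

Section Calculus.
Context {R : realType}.

Lemma derive_line (V W : normedModType R) (g : V -> W) (y v : V) (s : R) :
  derivable g (s *: v + y) v ->
  is_derive s (1 : R) (fun s : R => g (s *: v + y)) ('D_v g (s *: v + y)).
Proof.
have E : (fun h : R => h^-1 *: (((fun s => g (s *: v + y)) \o shift s) (h *: 1)
           - g (s *: v + y))) =
    (fun h => h^-1 *: ((g \o shift (s *: v + y)) (h *: v) - g (s *: v + y))).
  apply/funext => h /=; congr (_ *: (g _ - _)).
  by rewrite [h *: 1]mulr1 scalerDl addrA.
by move=> dg; apply: DeriveDef; rewrite /derivable /derive E.
Qed.

(** Absolute values cover coordinate increments of either sign; a negative t is the usual theorem on
    [t, 0]. *)
Lemma MVT_abs (F dF : R -> R) (t : R) :
  (forall s : R, `|s| <= `|t| -> is_derive s (1 : R) F (dF s)) ->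
  exists2 s, `|s| <= `|t| & F t - F 0 = dF s * t.
Proof.
move=> dFP.
have cF a b : (forall s, s \in `[a, b] -> `|s| <= `|t|) ->
    {within `[a, b], continuous F}.
  move=> H; apply: derivable_within_continuous => s sab.
  by have [] := dFP s (H _ sab).
have [t0|t0] := leP 0 t.
  have H s : s \in `[0, t] -> `|s| <= `|t|.
    by rewrite in_itv/= => /andP[s0 st]; rewrite !ger0_norm.
  have [|s /H st ->] := @MVT_segment _ F dF _ _ t0 _ (cF _ _ H).
    move=> s; rewrite in_itv/= => /andP[? ?]; apply/dFP/H; rewrite in_itv/= !ltW//.
  by exists s; rewrite ?subr0.
have H s : s \in `[t, 0] -> `|s| <= `|t|.
  by rewrite in_itv/= => /andP[s0 st]; rewrite !ler0_norm ?lerN2 // ltW.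
have [|s /H st E] := @MVT_segment _ F dF _ _ (ltW t0) _ (cF _ _ H).
  move=> s; rewrite in_itv/= => /andP[? ?]; apply/dFP/H; rewrite in_itv/= !ltW//.
by exists s => //; rewrite -opprB E sub0r mulrN opprK.
Qed.

Lemma entry_le_norm n (h : 'rV[R]_n) j : `|h 0 j| <= `|h|.
Proof.
rewrite [leRHS]/Num.Def.normr /= mx_normrE.
by apply: le_trans (le_bigmax _ _ (0, j)).
Qed.

Lemma norm_le_entries n (h : 'rV[R]_n) (e : R) : 0 <= e ->
  (forall j, `|h 0 j| <= e) -> `|h| <= e.
Proof.
move=> e0 H; rewrite [leLHS]/Num.Def.normr /= mx_normrE.
by apply/bigmax_leP; split=> // -[i j] _; rewrite ord1.
Qed.

(** The increment from x to x + h is broken into n moves along the coordinate axes; on each move the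
    mean value theorem replaces the difference quotient by a nearby partial derivative, which
    continuity compares with the one at x. *)
Lemma continuous_partials_differentiable n (U : set 'rV[R]_n) (g : 'rV[R]_n -> R) x :
  open U -> U x ->
  (forall j y, U y -> derivable g y (delta_mx 0 j)) ->
  (forall j, {for x, continuous (fun y => 'D_(delta_mx 0 j) g y)}) ->
  differentiable g x.
Proof.
move=> oU Ux dg cg.
pose L (h : 'rV[R]_n) : R := \sum_j h 0 j * 'D_(delta_mx 0 j) g x.
have Llin : linear L.
  move=> a u v; rewrite /L scaler_sumr -big_split/=; apply: eq_bigr => j _.
  by rewrite !mxE mulrDl [_ *: (_ * _)]mulrA.
pose LM := GRing.isLinear.Build _ _ _ _ _ Llin.
pose LL : {linear 'rV[R]_n -> R} := HB.pack L LM.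
have Lc : continuous LL.
  move=> h.
  have -> : LL = \sum_j (fun h : 'rV[R]_n => h 0 j *: 'D_(delta_mx 0 j) g x) :> (_ -> _).
    by apply/funext => k; rewrite fct_sumE.
  apply: differentiable_continuous.
  apply: (@differentiable_sum R 'rV[R]_n R n) => j.
  by apply: differentiableZl; apply: differentiable_coord.
suff dE : (g : _ -> R^o) \o shift x = cst (g x : R^o) + (LL : _ -> R^o) +o_ (0 : 'rV[R]_n) id.
  by apply/diff_locallyP; rewrite (diff_unique Lc dE).
apply/eqaddoP => _/posnumP[e].
(* The n coordinate moves share the error e; n + 1 keeps the quotient meaningful for n = 0. *)
pose e' := e%:num / n.+1%:R.
have e'0 : 0 < e' by rewrite divr_gt0.
have [r r0 Hr] : exists2 r : R, 0 < r & forall y, `|y - x| <= r ->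
    U y /\ forall j, `|'D_(delta_mx 0 j) g y - 'D_(delta_mx 0 j) g x| <= e'.
  have : \forall y \near x, U y /\ forall j,
      `|'D_(delta_mx 0 j) g y - 'D_(delta_mx 0 j) g x| <= e'.
    near=> y; split; first by near: y; apply: open_nbhs_nbhs.
    near: y; apply: filter_forall => j.
    have /cvgrPdist_le /(_ _ e'0) := cg j.
    by apply: filterS => y; rewrite distrC.
  move=> /nbhs_ballP[r /= r0 Hr]; exists (r / 2); first by rewrite divr_gt0.
  move=> y yr; apply: Hr; rewrite -ball_normE /= distrC.
  by rewrite (le_lt_trans yr) // ltr_pdivrMr // ltr_pMr // ltr1n.
near=> h.
have hr : `|h| <= r.
  near: h; apply/nbhs_ballP; exists r => //= h.
  by rewrite -ball_normE /= sub0r normrN => /ltW.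
(* [hp p] keeps the first p coordinates of h, so that [hp p.+1] and [hp p] differ in coordinate p
   only and the increments telescope. *)
pose hp p : 'rV[R]_n := \row_j (if (j < p)%N then h 0 j else 0).
have step (p : 'I_n) : `|g (hp p.+1 + x) - g (hp p + x) -
    h 0 p * 'D_(delta_mx 0 p) g x| <= e' * `|h|.
  have near_x s : `|s| <= `|h 0 p| -> `|(s *: delta_mx 0 p + (hp p + x)) - x| <= r.
    move=> sh; rewrite addrA addrK (le_trans _ hr)//.
    apply: norm_le_entries => // j; rewrite !mxE /=.
    case: ifP => jp; last first.
      rewrite addr0; have [_|_] := eqVneq j p; rewrite ?mulr1 ?mulr0 ?normr0//.
      by apply: le_trans sh _; apply: entry_le_norm.
    have -> : (j == p) = false by apply: ltn_eqF.
    by rewrite mulr0 add0r entry_le_norm.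
  have [s sh] := @MVT_abs (fun s => g (s *: delta_mx 0 p + (hp p + x)))
    (fun s => 'D_(delta_mx 0 p) g (s *: delta_mx 0 p + (hp p + x))) (h 0 p)
    (fun s sh => derive_line (dg p _ (Hr _ (near_x s sh)).1)).
  have -> : h 0 p *: delta_mx 0 p + (hp p + x) = hp p.+1 + x.
    rewrite addrA; congr (_ + _); apply/rowP => j; rewrite !mxE /= ltnS.
    have [->|jp] := eqVneq j p; first by rewrite ltnn leqnn mulr1 addr0.
    by rewrite mulr0 add0r [(j <= p)%N]leq_eqVlt (_ : (nat_of_ord j == p) = false) //; exact: negbTE jp.
  rewrite scale0r add0r => ->.
  rewrite [X in _ - X]mulrC -mulrBl normrM.
  apply: ler_pM => //; last exact: entry_le_norm.
  by have [_] := Hr _ (near_x s sh); apply.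
have tel : g (h + x) - g x = \sum_(p < n) (g (hp p.+1 + x) - g (hp p + x)).
  rewrite -(big_mkord xpredT (fun p => g (hp p.+1 + x) - g (hp p + x))).
  rewrite telescope_sumr // ; congr (g _ - g _).
    by congr (_ + _); apply/rowP => j; rewrite mxE ltn_ord.
  by rewrite -[LHS]add0r; congr (_ + _); apply/rowP => j; rewrite !mxE.
rewrite [X in `|X| <= _](_ : _ = g (h + x) - (g x + L h)) // opprD addrA tel /L -sumrB.
apply: (le_trans (ler_norm_sum _ _ _)).
apply: (@le_trans _ _ (\sum_(p < n) e' * `|h|)).
  by apply: ler_sum => p _; apply: step.
rewrite sumr_const card_ord -mulrnAl ler_wpM2r // -mulr_natr /e' -mulrA.
by rewrite ler_piMr // mulrC ler_pdivrMr // mul1r ler_nat.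
Unshelve. all: by end_near. Qed.

End Calculus.

(** * C^k functions: locality and algebraic operations *)

Section CkTheory.
Context {R : realType} {n : nat}.
Implicit Types (U V : set 'rV[R]_n) (f g : 'rV[R]_n -> R) (k : nat).

Lemma Ck_sub k U V g : V `<=` U -> Ck k U g -> Ck k V g.
Proof.
move=> VU; elim: k g => [|k IH] g [cg dg]; (split; first by move=> x /VU /cg) => //.
move=> j; have [dgj ck] := dg j; split; last exact: IH.
by move=> x /VU /dgj.
Qed.

Lemma Ck_local k U g :
  (forall x, U x -> exists V, V x /\ Ck k V g) -> Ck k U g.
Proof.
elim: k g => [|k IH] g H; (split; first by move=> x /H[V [Vx [cg _]]]; exact: cg) => //.
move=> j; split=> [x /H[V [Vx [_ /(_ j)[dg _]]]]|]; first exact: dg.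
apply: IH => x /H[V [Vx [_ /(_ j)[_ ?]]]]; by exists V.
Qed.

Lemma near_eq_on U f g x : open U -> U x -> (forall y, U y -> f y = g y) ->
  \near x, f x = g x.
Proof. by move=> oU Ux fg; apply: filterS fg _; apply: open_nbhs_nbhs. Qed.

Lemma Ck_eq k U f g : open U -> (forall x, U x -> f x = g x) ->
  Ck k U f -> Ck k U g.
Proof.
move=> oU; elim: k f g => [|k IH] f g fg [cf df]; split=> //.
- move=> x Ux; have fgn := near_eq_on oU Ux fg.
  change (g @ x --> g x); rewrite -(fg _ Ux).
  by exact (cvg_trans (near_eq_cvg fgn) (cf x Ux)).
- move=> x Ux; have fgn := near_eq_on oU Ux fg.
  change (g @ x --> g x); rewrite -(fg _ Ux).
  by exact (cvg_trans (near_eq_cvg fgn) (cf x Ux)).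
move=> j; have [dfj ck] := df j; split=> [x Ux|].
  by apply: near_eq_derivable (dfj x Ux); apply: near_eq_on oU Ux fg.
apply: IH ck => x Ux; apply: near_eq_derive; exact: near_eq_on oU Ux fg.
Qed.

Lemma Ck_continuous k U g x : Ck k U g -> U x -> {for x, continuous g}.
Proof. by case: k => [|k] [cg _] /cg. Qed.

Lemma Ck_lower k U g : Ck k.+1 U g -> Ck k U g.
Proof.
elim: k g => [|k IH] g [cg dg]; split=> //.
by move=> j; have [dgj ck] := dg j; split=> //; apply: IH.
Qed.

Lemma Ck_cst k U (a : R) : Ck k U (fun=> a).
Proof.
elim: k a => [|k IH] a; (split; first by move=> x _; exact: cst_continuous) => //.
move=> j; split=> [x _|]; first exact: derivable_cst.
have -> // : (fun x => 'D_(delta_mx 0 j) (fun=> a) x) = (fun=> 0) :> ('rV[R]_n -> R).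
by apply/funext => x; apply: derive_cst.
Qed.

Lemma CkD k U f g : open U -> Ck k U f -> Ck k U g ->
  Ck k U (fun x => f x + g x).
Proof.
move=> oU; elim: k f g => [|k IH] f g [cf df] [cg dg];
  (split; first by move=> x Ux; exact: continuousD (cf _ Ux) (cg _ Ux)) => //.
move=> j; have [dfj ckf] := df j; have [dgj ckg] := dg j; split=> [x Ux|].
  exact: derivableD (dfj _ Ux) (dgj _ Ux).
apply: Ck_eq oU _ (IH _ _ ckf ckg) => x Ux.
exact: (esym (deriveD (dfj _ Ux) (dgj _ Ux))).
Qed.

Lemma CkM k U f g : open U -> Ck k U f -> Ck k U g ->
  Ck k U (fun x => f x * g x).
Proof.
move=> oU; elim: k f g => [|k IH] f g kf kg;
  have [cf df] := kf; have [cg dg] := kg;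
  (split; first by move=> x Ux; exact: continuousM (cf _ Ux) (cg _ Ux)) => //.
move=> j; have [dfj ckf] := df j; have [dgj ckg] := dg j; split=> [x Ux|].
  exact: derivableM (dfj _ Ux) (dgj _ Ux).
apply: Ck_eq oU _ (CkD oU (IH _ _ (Ck_lower kf) ckg) (IH _ _ (Ck_lower kg) ckf)).
by move=> x Ux; exact: (esym (deriveM (dfj _ Ux) (dgj _ Ux))).
Qed.

Lemma Ck_sum k U (I : Type) (r : seq I) (P : pred I) (f : I -> 'rV[R]_n -> R) :
  open U -> (forall i, P i -> Ck k U (f i)) -> Ck k U (fun x => \sum_(i <- r | P i) f i x).
Proof.
move=> oU fP; elim: r => [|i r IH].
  by rewrite (_ : (fun _ => _) = fun=> 0); [apply: Ck_cst|apply/funext=> x; rewrite big_nil].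
have [Pi|Pi] := boolP (P i); last first.
  rewrite (_ : (fun _ => _) = fun x => \sum_(i <- r | P i) f i x) //.
  by apply/funext=> x; rewrite big_cons (negbTE Pi).
rewrite (_ : (fun _ => _) = fun x => f i x + \sum_(i <- r | P i) f i x).
  by apply: CkD => //; apply: fP.
by apply/funext=> x; rewrite big_cons Pi.
Qed.

Lemma CkV k U f : open U -> (forall x, U x -> f x != 0) -> Ck k U f ->
  Ck k U (fun x => (f x)^-1).
Proof.
move=> oU f0; elim: k => [|k IH] kf; have [cf df] := kf;
  (split; first by move=> x Ux; apply: continuousV; [exact: f0|exact: cf]) => //.
move=> j; have [dfj ckf] := df j; split=> [x Ux|].
  by apply: derivableV; [exact: f0|exact: dfj].
have kV := IH (Ck_lower kf).
apply: Ck_eq oU _ (CkM oU (CkM oU (Ck_cst k U (-1)) (CkM oU kV kV)) ckf).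
move=> x Ux /=; have /= -> := deriveV (f0 x Ux) (dfj x Ux).
by rewrite mulN1r -expr2 exprVn.
Qed.

Lemma Ck_coord k U (j : 'I_n) : open U -> Ck k U (fun x => x 0 j).
Proof.
move=> oU.
have dE i x : is_derive x (delta_mx 0 i) (fun x : 'rV[R]_n => x 0 j) ((i == j)%:R : R).
  have -> : (i == j)%:R = (delta_mx 0 i : 'rV[R]_n) 0 j :> R by rewrite mxE eqxx eq_sym.
  have @f : {linear 'rV[R]_n -> R}.
    by exists (fun N : 'rV[R]_n => N 0 j); do 2![eexists]; do ?[constructor];
     rewrite ?mxE// => ? *; rewrite ?mxE//; move=> ?; rewrite !mxE.
  have cf : continuous f by exact/coord_continuous.
  have df : differentiable f x by apply: linear_differentiable.
  apply: DeriveDef; first exact: diff_derivable.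
  by rewrite (deriveE _ df) diff_lin.
case: k => [|k]; (split; first by move=> x Ux; exact/coord_continuous) => //.
move=> i; split=> [x Ux|]; first by have [] := dE i x.
have -> : (fun x => 'D_(delta_mx 0 i) (fun x : 'rV[R]_n => x 0 j) x) = fun=> (i == j)%:R.
  by apply/funext=> x; have [] := dE i x.
exact: Ck_cst.
Qed.

Lemma Ck_differentiable U g x : open U -> U x -> Ck 1 U g -> differentiable g x.
Proof.
move=> oU Ux [_ dg]; apply: (continuous_partials_differentiable oU Ux).
  by move=> j y Uy; have [+ _] := dg j; apply.
by move=> j; have [_ [cj _]] := dg j; exact: (cj x Ux).
Qed.

End CkTheory.

(** * The chain rule for C^k functions *)

Section CkComp.
Context {R : realType} {n p : nat}.

Lemma differentiable_row (phi : 'rV[R]_n -> 'rV[R]_p) x :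
  (forall j, differentiable (fun y => phi y 0 j : R) x) -> differentiable phi x.
Proof.
move=> dphi.
have -> : phi = \sum_j (fun y => phi y 0 j *: (delta_mx 0 j : 'rV[R]_p)) :> (_ -> _).
  by apply/funext => y; rewrite fct_sumE {1}(row_sum_delta (phi y)).
by apply: (@differentiable_sum R 'rV[R]_n 'rV[R]_p p) => j; apply: differentiableZl.
Qed.

Lemma derive_comp_row (U : set 'rV[R]_n) (V : set 'rV[R]_p)
    (phi : 'rV[R]_n -> 'rV[R]_p) (g : 'rV[R]_p -> R) x i :
  open U -> open V -> U x -> V (phi x) ->
  (forall j, Ck 1 U (fun y => phi y 0 j)) -> Ck 1 V g ->
  is_derive x (delta_mx 0 i) (g \o phi)
   (\sum_j 'D_(delta_mx 0 j) g (phi x) * 'D_(delta_mx 0 i) (fun y => phi y 0 j) x).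
Proof.
move=> oU oV Ux Vx kphi kg.
have dg := Ck_differentiable oV Vx kg.
have dphi : differentiable phi x.
  by apply: differentiable_row => j; apply: Ck_differentiable oU Ux (kphi j).
have dc := differentiable_comp dphi dg.
apply: DeriveDef; first exact: diff_derivable.
rewrite (deriveE _ dc) diff_comp //= -(deriveE _ dphi).
rewrite derive_mx; last exact: diff_derivable.
rewrite [X in 'd _ _ X]row_sum_delta linear_sum.
by apply: eq_bigr => j _; rewrite linearZ/= -deriveE // mxE mulrC.
Qed.

(** Induction on k: by the chain rule a partial derivative of the composite is a sum of products of
    partials of phi with composites of partials of g, and the latter fall under the induction
    hypothesis. *)
Lemma Ck_comp k (U : set 'rV[R]_n) (V : set 'rV[R]_p)
    (phi : 'rV[R]_n -> 'rV[R]_p) (g : 'rV[R]_p -> R) :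
  open U -> open V -> (forall x, U x -> V (phi x)) ->
  (forall j, Ck k U (fun y => phi y 0 j)) -> Ck k V g -> Ck k U (g \o phi).
Proof.
move=> oU oV UV.
have cphi l : (forall j, Ck l U (fun y => phi y 0 j)) -> forall x, U x ->
    {for x, continuous phi}.
  move=> kphi x Ux; suff H : phi y @[y --> x] --> phi x by exact: H.
  apply: (@cvgrPdist_le R 'rV[R]_p 'rV[R]_n (nbhs x) _ phi (phi x)).2 => e e0.
  have H : \forall y \near x, forall j, `|phi x 0 j - phi y 0 j| <= e.
    have FF : Filter (nbhs x) by exact: nbhs_filter.
    apply: (@filter_forall _ _ (fun j y => `|phi x 0 j - phi y 0 j| <= e) _ FF) => j.
    have cj : phi y 0 j @[y --> x] --> phi x 0 j := Ck_continuous (kphi j) Ux.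
    by move/cvgrPdist_le : cj => /(_ _ e0).
  apply: filterS H => y Hy; apply: norm_le_entries; first exact: ltW.
  by move=> j; rewrite !mxE.
elim: k g => [|k IH] g kphi kg; have [cg dg] := kg; 
  (split; first by move=> x Ux; apply: continuous_comp;
     [exact: cphi kphi _ Ux|exact/cg/UV]) => //.
move=> i.
have low l : Ck k.+1 U l -> Ck 1 U l.
  by clear; elim: k => // k IH /Ck_lower.
have low' l : Ck k.+1 V l -> Ck 1 V l.
  by clear; elim: k => // k IH /Ck_lower.
have dE x (Ux : U x) := derive_comp_row i oU oV Ux (UV _ Ux) (fun j => low _ (kphi j)) (low' _ kg).
split=> [x Ux|]; first by have [] := dE x Ux.
apply: (@Ck_eq _ _ k U (fun x => \sum_j 'D_(delta_mx 0 j) g (phi x) *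
    'D_(delta_mx 0 i) (fun y => phi y 0 j) x)) => // [x Ux|].
  by have [_ ->] := dE x Ux.
apply: (@Ck_sum _ _ k U _ _ xpredT (fun j x => 'D_(delta_mx 0 j) g (phi x) *
    'D_(delta_mx 0 i) (fun y => phi y 0 j) x)) => // j _; apply: CkM => //.
  by apply: (IH (fun y => 'D_(delta_mx 0 j) g y)) => [j'|]; [exact: Ck_lower|have [] := dg j].
by have [_ /(_ i)[]] := kphi j.
Qed.

End CkComp.

(** * Smooth cut-off functions on R^n *)

Section Bump.
Context {R : realType}.

(** The functions s^(-p) e^(-1/s), extended by 0. All powers p are taken together because
    differentiation leads from one to the next two, which makes smoothness at 0 an induction. *)
Definition expinv (p : nat) (s : R) : R :=
  if 0 < s then s^-1 ^+ p * expR (- s^-1) else 0.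

Lemma is_derive_expinv p s :
  is_derive s (1 : R) (expinv p) (- p%:R * expinv p.+1 s + expinv p.+2 s).
Proof.
have [s0|s0|<-] := ltgtP 0 s.
- have sn0 : s != 0 by rewrite gt_eqF.
  apply: (@near_eq_is_derive R R R (fun s => s^-1 ^+ p * expR (- s^-1))).
    near=> y; rewrite /expinv (_ : 0 < y) //; near: y.
    exact: lt_nbhsr.
  have dV : is_derive s (1 : R) (fun s => s^-1) (- s ^- 2).
    apply: is_derive_eq (is_deriveV sn0 (is_derive_id s (1 : R))) _.
    by rewrite [_ *: _]mulr1.
  have dE := @is_derive1_comp R expR (fun s => - s^-1) s _ _ (is_derive_expR (- s^-1)) (is_deriveN dV).
  have := is_deriveX p dV; rewrite exprfctE => dX.
  have dM : is_derive s (1 : R) (fun s => s^-1 ^+ p * expR (- s^-1)) _ := is_deriveM dX dE.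
  apply: is_derive_eq dM _.
  rewrite /expinv s0 /= opprK.
  rewrite -[_ *: (_ * _)]/(_ * (_ * _)) -[_ *: (_ *: _)]/(_ * (_ * _)) /=.
  clear dX; case: p => [|p] /=.
    by rewrite oppr0 !mul0r mulr0 addr0 add0r expr0 exprVn; ring.
  by rewrite -exprVn !exprS -natr1; ring.
- apply: (@near_eq_is_derive R R R (fun=> 0)).
    near=> y; rewrite /expinv (_ : (0 < y) = false) //; apply/negbTE.
    by rewrite -leNgt ltW//; near: y; exact: lt_nbhsl.
  apply: is_derive_eq (is_derive_cst _ _ _) _.
  by rewrite /expinv ltNge (ltW s0) /= mulr0 addr0.
have E0 q : expinv q 0 = 0 by rewrite /expinv ltxx.
rewrite !E0 mulr0 addr0.
(* The bound e^y >= y^(p+2) / (p+2)! at y = 1/h shows that the difference quotient at 0 is at most C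
   h. *)
pose C : R := (p.+2)`!%:R.
have C0 : 0 < C by rewrite ltr0n fact_gt0.
have bound h : 0 < h -> h^-1 * expinv p h <= C * h.
  move=> h0; rewrite /expinv h0 expRN.
  rewrite mulrA -exprS ler_pdivrMr ?expR_gt0 //.
  rewrite -(ler_pM2r (_ : 0 < h^-1)) ?invr_gt0 // -exprSr.
  rewrite mulrAC [C * h / h]mulfK ?gt_eqF // mulrC -ler_pdivrMr //.
  have hV : 0 <= h^-1 by rewrite invr_ge0 ltW.
  by apply: le_trans (expR_ge1Dxn p.+1 hV); rewrite lerDr.
suff L : h^-1 *: ((expinv p \o shift 0) (h *: 1) - expinv p 0) @[h --> 0^'] --> (0 : R).
  by apply: DeriveDef; [apply/cvg_ex; exists 0|apply: cvg_lim].
apply/cvgrPdist_le => e e0; near=> h.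
rewrite E0 subr0 /= addr0 [h *: 1]mulr1 sub0r normrN.
have [h0|h0] := leP h 0.
  by rewrite /expinv ltNge h0 /= scaler0 normr0 ltW.
rewrite ger0_norm; last first.
  by rewrite mulr_ge0 ?invr_ge0 ?ltW // /expinv h0 mulr_gt0 ?expR_gt0 // exprn_gt0 ?invr_gt0.
apply: le_trans (bound _ h0) _.
rewrite mulrC -ler_pdivlMr // -[leLHS]gtr0_norm //.
near: h; apply: dnbhs0_le; exact: divr_gt0.
Unshelve. all: by end_near. Qed.

Lemma expinv_ge0 p s : 0 <= expinv p s.
Proof.
by rewrite /expinv; case: ifP => // s0; rewrite mulr_ge0 ?expR_ge0 // exprn_ge0 // invr_ge0 ltW.
Qed.

(** Rows of length one make this function a possible outer function of [Ck_comp]. *)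
Lemma Ck_expinv k p : Ck k setT (fun y : 'rV[R]_1 => expinv p (y 0 0)).
Proof.
have dE q (y : 'rV[R]_1) j : is_derive y (delta_mx 0 j) (fun y : 'rV[R]_1 => expinv q (y 0 0))
    (- q%:R * expinv q.+1 (y 0 0) + expinv q.+2 (y 0 0)).
  have [] := is_derive_expinv q (y 0 0); rewrite /derivable /derive.
  have -> : (fun h : R => h^-1 *: ((expinv q \o shift (y 0 0)) (h *: (1:R)) - expinv q (y 0 0))) =
     (fun h => h^-1 *: (((fun y : 'rV[R]_1 => expinv q (y 0 0)) \o shift y) (h *: delta_mx 0 j)
          - expinv q (y 0 0))).
    by apply/funext => h /=; rewrite !mxE (ord1 j) eqxx.
  exact: DeriveDef.
have cE q (y : 'rV[R]_1) : {for y, continuous (fun y : 'rV[R]_1 => expinv q (y 0 0))}.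
  apply: (@continuous_comp _ _ _ (fun y : 'rV[R]_1 => y 0 0) (expinv q)).
    exact/coord_continuous.
  apply: differentiable_continuous; apply/derivable1_diffP.
  by have [] := is_derive_expinv q (y 0 0).
elim: k p => [|k IH] p; (split; first by move=> y _; apply: cE) => //.
move=> j; split=> [y _|]; first by have [] := dE p y j.
apply: (@Ck_eq _ _ k setT (fun y => - p%:R * expinv p.+1 (y 0 0) + expinv p.+2 (y 0 0))).
- exact: openT.
- by move=> y _; have [_ ->] := dE p y j.
- by apply: CkD; [exact: openT|apply: CkM; [exact: openT|exact: Ck_cst|exact: IH]|exact: IH].
Qed.

Definition smooth_step (s : R) : R := expinv 0 s / (expinv 0 s + expinv 0 (1 - s)).

Lemma expinv0_gt0 s : 0 < s -> 0 < expinv 0 s.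
Proof. by move=> s0; rewrite /expinv s0 expr0 mul1r expR_gt0. Qed.

Lemma expinv0_le0 p s : s <= 0 -> expinv p s = 0.
Proof. by move=> s0; rewrite /expinv ltNge s0. Qed.

Lemma smooth_step_den s : expinv 0 s + expinv 0 (1 - s) != 0.
Proof.
have [s0|s0] := leP s 0.
  by rewrite gt_eqF // ltr_wpDl ?expinv_ge0 // expinv0_gt0 //; lra.
by rewrite gt_eqF // ltr_wpDr ?expinv_ge0 // expinv0_gt0.
Qed.

Lemma smooth_step0 s : s <= 0 -> smooth_step s = 0.
Proof. by move=> s0; rewrite /smooth_step expinv0_le0 // mul0r. Qed.

Lemma smooth_step1 s : 1 <= s -> smooth_step s = 1.
Proof.
move=> s1; have := smooth_step_den s; rewrite /smooth_step.
by rewrite (@expinv0_le0 _ (1 - s)) ?subr_le0 // addr0 => /divff.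
Qed.

Lemma Ck_smooth_step n k (l : 'rV[R]_n -> R) :
  Ck k setT l -> Ck k setT (fun x => smooth_step (l x)).
Proof.
have oT m : open [set: 'rV[R]_m] by exact: openT.
have kE (h : 'rV[R]_n -> R) : Ck k setT h -> Ck k setT (fun x => expinv 0 (h x)).
  move=> kh.
  have := @Ck_comp R n 1 k setT setT (fun x => \row_(j < 1) h x) (fun y => expinv 0 (y 0 0)).
  move=> /(_ (oT _) (oT _) (fun _ _ => I)) H.
  apply: (Ck_eq (oT _) _ (H _ (Ck_expinv k 0))) => [x _ /=|j]; first by rewrite mxE.
  by apply: (Ck_eq (oT _) _ kh) => x _; rewrite mxE.
move=> kl; have k1l : Ck k setT (fun x => 1 - l x).
  apply: (Ck_eq (oT _) _ (CkD (oT _) (Ck_cst k _ 1) (CkM (oT _) (Ck_cst k _ (-1)) kl))).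
  by move=> x _; rewrite mulN1r.
apply: CkM; [exact: oT|exact: kE|]; apply: CkV; [exact: oT| |].
  by move=> x _; apply: smooth_step_den.
by apply: CkD; [exact: oT|exact: kE|exact: kE].
Qed.

Lemma Ck_prod n k (U : set 'rV[R]_n) (I : Type) (r : seq I) (f : I -> 'rV[R]_n -> R) :
  open U -> (forall i, Ck k U (f i)) -> Ck k U (fun x => \prod_(i <- r) f i x).
Proof.
move=> oU fP; elim: r => [|i r IH].
  by apply: (Ck_eq oU _ (Ck_cst k U 1)) => x _; rewrite big_nil.
by apply: (Ck_eq oU _ (CkM oU (fP i) IH)) => x _; rewrite big_cons.
Qed.

Lemma box_bump n (x0 : 'rV[R]_n) (r : R) : 0 < r ->
  exists psi : 'rV[R]_n -> R, [/\ Csmooth setT psi,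
    forall x, `|x - x0| <= r -> psi x = 1 &
    forall x, 2 * r <= `|x - x0| -> psi x = 0].
Proof.
move=> r0; have oT : open [set: 'rV[R]_n] by exact: openT.
pose t j (x : 'rV[R]_n) : R := (x 0 j - x0 0 j) / r.
(* With t_j = (x_j - x0_j) / r both steps of factor j equal 1 for |t_j| <= 1, and one of them is 0
   for |t_j| >= 2. The norm is the maximum norm, so the product behaves as required on boxes. *)
exists (fun x => \prod_j (smooth_step (2 - t j x) * smooth_step (2 + t j x))); split.
- move=> k.
  have kt j : Ck k setT (t j).
    apply: CkM => //; last exact: Ck_cst.
    by apply: CkD => //; [exact: Ck_coord|exact: Ck_cst].
  apply: Ck_prod => // j; apply: CkM => //; apply: Ck_smooth_step.
    apply: (Ck_eq oT _ (CkD oT (Ck_cst k _ 2) (CkM oT (Ck_cst k _ (-1)) (kt j)))).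
    by move=> x _; rewrite mulN1r.
  by apply: CkD => //; exact: Ck_cst.
- move=> x xr; apply: big1 => j _.
  have : `|t j x| <= 1.
    rewrite normrM normfV (gtr0_norm r0) ler_pdivrMr // mul1r.
    by apply: le_trans xr; apply: le_trans (entry_le_norm _ j); rewrite !mxE.
  rewrite ler_norml => /andP[t1 t2].
  by rewrite !smooth_step1 ?mulr1 //; lra.
- move=> x xr.
  have [j tj] : exists j, 2 <= `|t j x|.
    apply: contrapT => /forallNP H.
    suff : `|x - x0| < 2 * r by rewrite ltNge xr.
    rewrite /Num.Def.normr/= mx_normrE; apply/bigmax_ltP; split.
      by rewrite mulr_gt0.
    move=> -[i j] _; rewrite ord1 !mxE /=.
    have /negP := H j; rewrite -ltNge normrM normfV (gtr0_norm r0).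
    by rewrite ltr_pdivrMr.
  rewrite (bigD1 j) //=.
  have [t0|t0] := leP 0 (t j x).
    by rewrite (@smooth_step0 (2 - t j x)) ?mul0r // subr_le0 -[leRHS]ger0_norm.
  rewrite (@smooth_step0 (2 + t j x)) ?mulr0 ?mul0r //.
  by move: tj; rewrite ltr0_norm //; lra.
Qed.

End Bump.

(** * Smooth functions and bump functions *)

Section ManifoldTheory.
Context {R : realType} {n : nat} {M : manifold R n}.
Implicit Types (U V W : set M) (f g : M -> R) (c : atlas M).

Lemma open_nbhs_sub (T : topologicalType) (A : set T) :
  (forall x, A x -> nbhs x A) -> open A.
Proof. by move=> H; rewrite openE => x /H. Qed.

Lemma chart_image_open c U : open U -> open (chart c @` (dom c `&` U)).
Proof.
move=> oU; apply: open_nbhs_sub => _ [m [cm Um] <-].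
have Im : (chart c @` dom c) (chart c m) by exists m.
have cu := @unchart_continuous _ _ M c _ Im.
have nU : nbhs (unchart c (chart c m)) U.
  by rewrite chartK //; apply: open_nbhs_nbhs.
have : nbhs (chart c m) (chart c @` dom c `&` unchart c @^-1` U).
  apply: filterI; last exact: cu _ nU.
  by apply: open_nbhs_nbhs; split => //; apply: chart_open.
by apply: filterS => _ [[x cx <-] /=]; rewrite chartK // => Ux; exists x.
Qed.

Arguments chart_image_open c [U] _.

Lemma smooth_on_sub U V f : V `<=` U -> smooth_on U f -> smooth_on V f.
Proof.
by move=> VU sf c k; apply: Ck_sub (sf c k) => _ [x [cx /VU Ux] <-]; exists x.
Qed.

Lemma smooth_on_local U f :
  (forall m, U m -> exists V, V m /\ smooth_on V f) -> smooth_on U f.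
Proof.
move=> H c k; apply: Ck_local => _ [m [cm /H[V [Vm sV]]] <-].
by exists (chart c @` (dom c `&` V)); split; [exists m|exact: sV].
Qed.

Lemma smooth_on_eq U f g : open U -> (forall x, U x -> f x = g x) ->
  smooth_on U f -> smooth_on U g.
Proof.
move=> oU fg sf c k; apply: (Ck_eq (chart_image_open c oU) _ (sf c k)).
by move=> _ [m [cm Um] <-] /=; rewrite chartK // fg.
Qed.

Lemma smooth_on_cst U (a : R) : smooth_on U (fun=> a).
Proof. by move=> c k; apply: Ck_cst. Qed.

Lemma smooth_onD U f g : open U -> smooth_on U f -> smooth_on U g ->
  smooth_on U (fun x => f x + g x).
Proof. by move=> oU sf sg c k; apply: CkD (chart_image_open c oU) (sf c k) (sg c k). Qed.

Lemma smooth_onM U f g : open U -> smooth_on U f -> smooth_on U g ->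
  smooth_on U (fun x => f x * g x).
Proof. by move=> oU sf sg c k; apply: CkM (chart_image_open c oU) (sf c k) (sg c k). Qed.

Lemma smooth_on_sum U (I : Type) (r : seq I) (f : I -> M -> R) : open U ->
  (forall i, smooth_on U (f i)) -> smooth_on U (fun x => \sum_(i <- r) f i x).
Proof.
move=> oU sf; elim: r => [|i r IH].
  by apply: smooth_on_eq oU _ (smooth_on_cst U 0) => x _; rewrite big_nil.
by apply: smooth_on_eq oU _ (smooth_onD oU (sf i) IH) => x _; rewrite big_cons.
Qed.

Lemma smooth_onB U f g : open U -> smooth_on U f -> smooth_on U g ->
  smooth_on U (fun x => f x - g x).
Proof.
move=> oU sf sg.
apply: smooth_on_eq oU _ (smooth_onD oU sf (smooth_onM oU (smooth_on_cst U (-1)) sg)).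
by move=> x _; rewrite mulN1r.
Qed.

Lemma smooth_smooth_on U f : smooth f -> smooth_on U f.
Proof. exact: smooth_on_sub. Qed.

Arguments smooth_smooth_on [U f] _.

Lemma smooth_cst (a : R) : @smooth R n M (fun=> a).
Proof. exact: smooth_on_cst. Qed.

Lemma smoothD f g : smooth f -> smooth g -> smooth (fun x => f x + g x).
Proof. exact: smooth_onD openT. Qed.

Lemma smoothB f g : smooth f -> smooth g -> smooth (fun x => f x - g x).
Proof. exact: smooth_onB openT. Qed.

Lemma smoothM f g : smooth f -> smooth g -> smooth (fun x => f x * g x).
Proof. exact: smooth_onM openT. Qed.

Lemma smooth_sum (I : Type) (r : seq I) (f : I -> M -> R) :
  (forall i, smooth (f i)) -> smooth (fun x => \sum_(i <- r) f i x).
Proof. exact: smooth_on_sum openT. Qed.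

Lemma chart_transition_Ck c c' U k j : U `<=` dom c' ->
  Ck k (chart c @` (dom c `&` U)) (fun x => chart c' (unchart c x) 0 j).
Proof.
move=> Uc; apply: Ck_sub (chart_trans c c' j k).
by move=> _ [m [cm /Uc Um] <-]; exists m.
Qed.

(** Another chart sees f through the transition map followed by the expression of f in [c]. *)
Lemma smooth_on_chart c U f : open U -> U `<=` dom c ->
  Csmooth (chart c @` (dom c `&` U)) (f \o unchart c) -> smooth_on U f.
Proof.
move=> oU Uc sf c' k.
apply: (Ck_eq (chart_image_open c' oU) _
  (Ck_comp (phi := fun x => chart c (unchart c' x)) (chart_image_open c' oU)
     (chart_image_open c oU) _ _ (sf k))).
- by move=> _ [m [cm Um] <-] /=; rewrite chartK // chartK //; apply: Uc.
- by move=> _ [m [cm Um] <-] /=; rewrite chartK //; exists m => //; split => //; apply: Uc.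
- by move=> j; apply: chart_transition_Ck.
Qed.

Lemma smooth_on_coord c j : smooth_on (dom c) (fun m => chart c m 0 j).
Proof.
apply: (smooth_on_chart (c := c)) => //; first exact: dom_open.
move=> k; have o := chart_image_open c (dom_open c).
apply: Ck_eq o _ (Ck_coord k j o) => _ [m [cm _] <-] /=.
by rewrite chartK.
Qed.

(** The open set Z on which chi vanishes, with U and Z covering M, is what extension by zero
    requires: near each point a product with chi is either smooth already or zero. *)
Lemma bump_exists m U : open U -> U m ->
  exists (chi : M -> R) (W Z : set M), [/\ smooth chi,
    [/\ open W, W m & W `<=` U], forall x, W x -> chi x = 1,
    open Z & (forall x, Z x -> chi x = 0) /\ forall x, U x \/ Z x].
Proof.
move=> oU Um; have [c cm] := dom_cover m.
have oO := chart_image_open c oU.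
have : nbhs (chart c m) (chart c @` (dom c `&` U)).
  by apply: open_nbhs_nbhs; split => //; exists m.
move=> /nbhs_ballP[e /= e0 He].
(* Any r with 2 r < e would do: the closed box of radius 2 r, outside which psi vanishes, must stay
   in the image of U. *)
pose r := e / 3; have r0 : 0 < r by rewrite divr_gt0.
have Hr y : `|y - chart c m| <= 2 * r -> (chart c @` (dom c `&` U)) y.
  move=> yr; apply: He; rewrite -ball_normE /= distrC.
  by apply: le_lt_trans yr _; rewrite /r; lra.
have [psi [spsi psi1 psi0]] := box_bump (chart c m) r0.
pose chi x := if `[< dom c x >] then psi (chart c x) else 0.
pose K := [set y : 'rV[R]_n | `|y - chart c m| <= 2 * r].
have cK : compact K.
  apply: bounded_closed_compact.
    exists (2 * r + `|chart c m|); split; first exact: num_real.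
    move=> t rt y Ky; apply: le_trans (ltW rt).
    rewrite -[y in leLHS](subrK (chart c m)); apply: le_trans (ler_normD _ _) _.
    by rewrite lerD2r.
  have -> : K = (fun y => `|y - chart c m|) @^-1` [set x : R | x <= 2 * r] by [].
  apply: closed_comp; last exact: closed_le.
  move=> y _; apply: continuous_comp; last exact: norm_continuous.
  by apply: continuousB; [exact: cvg_id|exact: cst_continuous].
have cUK : compact (unchart c @` K).
  apply: continuous_compact cK; apply: continuous_in_subspaceT => y /[1!inE] Ky.
  apply: unchart_continuous; have [x [cx _] <-] := Hr _ Ky; by exists x.
(* The image of K is compact, hence closed as M is Hausdorff. Without this chi could fail to be
   smooth at the boundary of the chart domain. *)
pose Z := ~` (unchart c @` K).
have oZ : open Z by apply: closed_openC; apply: compact_closed cUK; exact: carrier_hausdorff.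
have Z0 x : Z x -> chi x = 0.
  rewrite /chi; case: asboolP => // cx Zx; apply: psi0; rewrite leNgt; apply/negP => xK.
  by apply: Zx; exists (chart c x); [exact: ltW|exact: chartK].
have UZ x : dom c x /\ U x \/ Z x.
  have [Kx|?] := pselect ((unchart c @` K) x); last by right.
  left; case: Kx => y /Hr[x' [cx' Ux'] <-] <-; by rewrite chartK.
exists chi, (dom c `&` U `&` chart c @^-1` [set y | `|y - chart c m| < r]), Z; split => //.
- apply: smooth_on_local => x _; case: (UZ x) => [[cx Ux]|Zx]; last first.
    by exists Z; split=> //; apply: smooth_on_eq oZ _ (smooth_on_cst Z 0) => y /Z0.
  exists (dom c); split=> //; apply: (smooth_on_chart (c := c)) => //; first exact: dom_open.
  have o := chart_image_open c (dom_open c).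
  move=> k; apply: Ck_eq o _ (Ck_sub _ (spsi k)) => // _ [y [cy _] <-] /=.
  by rewrite /chi chartK //; case: asboolP.
- split; last by move=> x [[]].
    apply: open_nbhs_sub => x [[cx Ux] /= xr]; apply: filterI.
      by apply: open_nbhs_nbhs; split => //; apply: openI => //; exact: dom_open.
    have := chart_continuous cx; apply.
    have : open [set y : 'rV[R]_n | `|y - chart c m| < r].
      have -> : [set y : 'rV[R]_n | `|y - chart c m| < r] =
        (fun y => `|y - chart c m|) @^-1` [set x : R | x < r] by [].
      apply: open_comp; last exact: open_lt.
      move=> y _; apply: continuous_comp; last exact: norm_continuous.
      by apply: continuousB; [exact: cvg_id|exact: cst_continuous].
    by move=> o; apply: open_nbhs_nbhs.
  by split=> //=; rewrite subrr normr0.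
- move=> x [[cx Ux] /= xr]; rewrite /chi; case: asboolP => // _.
  by apply: psi1; apply: ltW.
by split=> // x; case: (UZ x) => [[]|]; [left|right].
Qed.

End ManifoldTheory.

Arguments chart_image_open {R n M} c [U] _.
Arguments smooth_smooth_on {R n M} [U f] _.

(** * Modules of sections *)

Section SmoothModules.
Context {R : realType} {n : nat} {M : manifold R n}.

(* The last field says that near each point the sections [s i] generate, with
   coefficients [c i] that are smooth on smooth sections. *)
Record smooth_module (V : M -> vectType R) (G : sec V -> Prop) : Prop := {
  sm_D : forall s t, G s -> G t -> G (secD s t);
  sm_Z : forall f s, smooth f -> G s -> G (secZ f s);
  sm_0 : G (sec0 V);
  sm_local : forall s, (forall m, exists U t,
    [/\ open U, U m, G t & forall x, U x -> s x = t x]) -> G s;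
  sm_frames : forall m, exists (r : nat) (s : 'I_r -> sec V)
      (c : 'I_r -> forall x, V x -> R) (U : set M),
    [/\ open U, U m, forall i, G (s i),
      forall i t, G t -> smooth (fun x => c i x (t x)) &
      (forall i x, c i x 0 = 0) /\
      forall x, U x -> forall v, v = \sum_i c i x v *: s i x] }.

(** C^oo-linearity with values in a vector space where a function f acts by f(m). By [tensor_eq]
    such an L depends only on the value of the section at m; this is the tool for replacing a
    section by another one with the same value. *)
Definition tensor_at V (G : sec V -> Prop) (m : M) (W : lmodType R) (L : sec V -> W) :=
  (forall s t, G s -> G t -> L (secD s t) = L s + L t) /\
  (forall f s, smooth f -> G s -> L (secZ f s) = f m *: L s).

(** * C^oo-linear maps at a point *)

Section Tensor.
Variables (V : M -> vectType R) (G : sec V -> Prop) (hG : smooth_module G).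

Lemma sm_N s : G s -> G (secN s).
Proof.
move=> Gs; rewrite (_ : secN s = secZ (fun=> -1) s).
  by apply: (sm_Z hG) => //; exact: smooth_cst.
by apply: functional_extensionality_dep => m; rewrite /secZ /secN scaleN1r.
Qed.

Lemma sm_sum (I : Type) (r : seq I) (f : I -> sec V) :
  (forall i, G (f i)) -> G (fun m => \sum_(i <- r) f i m).
Proof.
move=> Gf; elim: r => [|i r IH].
  rewrite (_ : (fun m => _) = sec0 V); first exact: sm_0 hG.
  by apply: functional_extensionality_dep => m; rewrite big_nil.
rewrite (_ : (fun m => _) = secD (f i) (fun m => \sum_(i <- r) f i m)).
  exact: (sm_D hG).
by apply: functional_extensionality_dep => m; rewrite big_cons.
Qed.

Variables (m : M) (W : lmodType R) (L : sec V -> W).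
Hypothesis hL : tensor_at G m L.

Lemma tensor0 : L (sec0 V) = 0.
Proof.
have [_ LZ] := hL.
have := LZ (fun=> 0) (sec0 V) (smooth_cst 0) (sm_0 hG); rewrite scale0r => <-.
by congr L; apply: functional_extensionality_dep => x; rewrite /secZ scale0r.
Qed.

Lemma tensorD s t : G s -> G t -> L (secD s t) = L s + L t.
Proof. by case: hL => + _; apply. Qed.

Lemma tensorZ f s : smooth f -> G s -> L (secZ f s) = f m *: L s.
Proof. by case: hL => _; apply. Qed.

Lemma tensorN s : G s -> L (secN s) = - L s.
Proof.
move=> Gs; rewrite (_ : secN s = secZ (fun=> -1) s) ?tensorZ ?scaleN1r //.
  exact: smooth_cst.
by apply: functional_extensionality_dep => x; rewrite /secZ /secN scaleN1r.
Qed.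

Lemma tensor_sum (I : Type) (r : seq I) (f : I -> sec V) :
  (forall i, G (f i)) -> L (fun x => \sum_(i <- r) f i x) = \sum_(i <- r) L (f i).
Proof.
move=> Gf; elim: r => [|i r IH].
  rewrite big_nil -[RHS]tensor0; congr L.
  by apply: functional_extensionality_dep => x; rewrite big_nil.
rewrite big_cons -IH -tensorD //; last exact: sm_sum.
by congr L; apply: functional_extensionality_dep => x; rewrite big_cons.
Qed.

(** With chi = 1 at m and chi = 0 off U one has s = (1 - chi) s, and 1 - chi vanishes at m. *)
Lemma tensor_local0 U s : open U -> U m -> G s -> (forall x, U x -> s x = 0) -> L s = 0.
Proof.
move=> oU Um Gs s0; have [chi [W' [Z [schi [_ W'm _] chi1 _ [chi0 cov]]]]] := bump_exists oU Um.
have -> : s = secZ (fun x => 1 - chi x) s.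
  apply: functional_extensionality_dep => x; rewrite /secZ.
  case: (cov x) => [/s0 ->|/chi0 ->]; first by rewrite scaler0.
  by rewrite subr0 scale1r.
rewrite tensorZ //; first by rewrite chi1 // subrr scale0r.
by apply: smoothB => //; exact: smooth_cst.
Qed.

(** The difference u of the sections vanishes at m. Near m it equals [u'], a combination of the
    generators whose coefficients vanish at m, so that L kills it; and L kills u - u' by
    [tensor_local0]. *)
Lemma tensor_eq s t : G s -> G t -> s m = t m -> L s = L t.
Proof.
move=> Gs Gt st; apply/eqP; rewrite -subr_eq0 -tensorN // -tensorD //; last exact: sm_N.
set u := secD s (secN t).
have Gu : G u by apply: (sm_D hG) => //; exact: sm_N.
have um : u m = 0 by rewrite /u /secD /secN st subrr.
have [r [e [c [U [oU Um Ge sc [c0 exp]]]]]] := sm_frames hG m.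
pose u' : sec V := fun x => \sum_(i < r) secZ (fun x => c i x (u x)) (e i) x.
have Gu' : G u' by apply: sm_sum => i; apply: (sm_Z hG) => //; exact: sc.
have Lu' : L u' = 0.
  rewrite tensor_sum; last by move=> i; apply: (sm_Z hG) => //; exact: sc.
  rewrite big1 // => i _; rewrite tensorZ //; last exact: sc.
  by rewrite um c0 scale0r.
rewrite -[L u]addr0 -[X in _ + X]oppr0 -[X in _ - X]Lu' -tensorN // -tensorD //; last exact: sm_N.
apply/eqP; apply: (tensor_local0 oU Um); first by apply: (sm_D hG) => //; exact: sm_N.
by move=> x Ux; rewrite /secD /secN {1}(exp x Ux (u x)) subrr.
Qed.

End Tensor.

(** * Smoothness of a section tested by fibrewise linear functionals *)

Section Coordinates.
Variables (V : M -> vectType R) (T J : Type) (D : T -> set M).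
Variable (ell : T -> J -> forall m, V m -> R).
Arguments ell : clear implicits.
Hypothesis oD : forall a, open (D a).
Hypothesis ell_lin : forall a j m (k : R) u v, ell a j m (k *: u + v) = k * ell a j m u + ell a j m v.

(** The functionals [ell] stand both for the coordinates in a frame, as in [Gam], and for the values
    on a frame, as in [Gamd], so that the module axioms are proved once. *)
Definition smooth_coords (s : sec V) :=
  forall a j, smooth_on (D a) (fun m => ell a j m (s m)).

Let ell0 a j m : ell a j m 0 = 0.
Proof. by have := ell_lin a j (m := m) (-1) 0 0; rewrite scaler0 addr0 mulN1r addNr. Qed.

Let ellD a j m u v : ell a j m (u + v) = ell a j m u + ell a j m v.
Proof. by rewrite -[u]scale1r ell_lin scale1r mul1r. Qed.

Let ellZ a j m (k : R) u : ell a j m (k *: u) = k * ell a j m u.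
Proof. by rewrite -[k *: u]addr0 ell_lin ell0 addr0. Qed.

Lemma smooth_coordsD s t : smooth_coords s -> smooth_coords t -> smooth_coords (secD s t).
Proof.
move=> cs ct a j; apply: (smooth_on_eq (oD a) _ (smooth_onD (oD a) (cs a j) (ct a j))).
by move=> x _; rewrite /secD ellD.
Qed.

Lemma smooth_coordsZ f s : smooth f -> smooth_coords s -> smooth_coords (secZ f s).
Proof.
move=> sf cs a j.
apply: (smooth_on_eq (oD a) _ (smooth_onM (oD a) (smooth_smooth_on sf) (cs a j))).
by move=> x _; rewrite /secZ ellZ.
Qed.

Lemma smooth_coords0 : smooth_coords (sec0 V).
Proof.
by move=> a j; apply: (smooth_on_eq (oD a) _ (smooth_on_cst _ 0)) => x _; rewrite /sec0 ell0.
Qed.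

Lemma smooth_coords_local s : (forall m, exists U t,
    [/\ open U, U m, smooth_coords t & forall x, U x -> s x = t x]) -> smooth_coords s.
Proof.
move=> H a j; apply: smooth_on_local => m Dm; have [U [t [oU Um ct st]]] := H m.
exists (D a `&` U); split=> //.
apply: (smooth_on_eq (openI (oD a) oU) _ (smooth_on_sub _ (ct a j))); last by move=> x [].
by move=> x [_ /st ->].
Qed.

(** Extension by zero: over U the product with chi is smooth because s is, and over Z it is 0. *)
Lemma smooth_coords_ext (U Z : set M) chi s : open U -> open Z -> smooth chi ->
  (forall x, Z x -> chi x = 0) -> (forall x, U x \/ Z x) ->
  (forall a j, smooth_on (D a `&` U) (fun m => ell a j m (s m))) ->
  smooth_coords (secZ chi s).
Proof.
move=> oU oZ schi chi0 cov cs a j; apply: smooth_on_local => m Dm.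
case: (cov m) => [Um|Zm].
  exists (D a `&` U); split=> //; have o := openI (oD a) oU.
  apply: (smooth_on_eq o _ (smooth_onM o (smooth_smooth_on schi) (cs a j))).
  by move=> x _; rewrite /secZ ellZ.
exists (D a `&` Z); split=> //; have o := openI (oD a) oZ.
apply: (smooth_on_eq o _ (smooth_on_cst _ 0)).
by move=> x [_ /chi0 x0]; rewrite /secZ x0 scale0r ell0.
Qed.

End Coordinates.

(** * Sections of a vector bundle and of its dual *)

Section Bundle.
Context {r : nat}.
Variable (E : vbundle M r).

Let ellE (a : triv E) (i : 'I_r) m (v : E m) : R := coord [tuple frame a k m | k < r] i v.
Let ellE' (a : triv E) (i : 'I_r) m (t : bdual E m) : R := t (frame a i m).

Let ellE_lin a j m (k : R) u v : @ellE a j m (k *: u + v) = k * ellE a j u + ellE a j v.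
Proof. by rewrite /ellE linearP. Qed.

Let ellE'_lin a j m (k : R) u v : @ellE' a j m (k *: u + v) = k * ellE' a j u + ellE' a j v.
Proof. by rewrite /ellE' add_lfunE scale_lfunE. Qed.

Lemma covector_of m (f : E m -> R) :
  (forall k u v, f (k *: u + v) = k * f u + f v) -> {t : bdual E m | forall v, t v = f v}.
Proof.
move=> flin; have glin : linear (f : E m -> R^o) by move=> k u v; rewrite flin.
pose g : {linear E m -> R^o} := HB.pack (f : E m -> R^o) (GRing.isLinear.Build _ _ _ _ _ glin).
by exists (linfun g) => v; rewrite lfunE.
Qed.

Lemma frame_expand (a : triv E) m (v : E m) : tdom a m ->
  v = \sum_i coord [tuple frame a k m | k < r] i v *: frame a i m.
Proof.
move=> am; have /andP[/eqP sE fE] := frame_basis am.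
have ve : v \in <<[tuple frame a k m | k < r]>>%VS by rewrite sE memvf.
rewrite {1}(coord_span ve).
by apply: eq_bigr => i _; congr (_ *: _); rewrite -tnth_nth tnth_mktuple.
Qed.

Lemma frame_coord (a : triv E) m i j : tdom a m ->
  coord [tuple frame a k m | k < r] i (frame a j m) = (i == j)%:R.
Proof.
move=> am; have /andP[_ fE] := frame_basis am.
rewrite -[frame a j m](_ : [tuple frame a k m | k < r]`_j = _).
  by rewrite coord_free // eq_sym.
by rewrite -tnth_nth tnth_mktuple.
Qed.

Lemma dim_fib (m : M) : \dim {: E m} = r.
Proof.
by have [a am] := tdom_cover E m; exact: size_basis (frame_basis am).
Qed.

(** Pairing a linear relation with [tau i] shows that the [q i] are independent, and r independent
    vectors in a fibre of dimension r form a basis; the coordinates are then read off by the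
    [tau i]. *)
Lemma dual_expand m (q : 'I_r -> E m) (tau : 'I_r -> bdual E m) :
  (forall i j, tau i (q j) = (i == j)%:R) ->
  (forall v, v = \sum_i tau i v *: q i) /\ (forall t : bdual E m, t = \sum_i t (q i) *: tau i).
Proof.
move=> dual.
have hq (i : 'I_r) : [tuple q i | i < r]`_i = q i by rewrite -tnth_nth tnth_mktuple.
have ext (k : 'I_r -> R) i : tau i (\sum_j k j *: q j) = k i.
  rewrite linear_sum (bigD1 i) //= big1.
    by rewrite linearZ /= dual eqxx addr0 [_ *: _]mulr1.
  by move=> j ji; rewrite linearZ /= dual eq_sym (negbTE ji) scaler0.
have E1 v : v = \sum_i tau i v *: q i.
  have fr : free [tuple q i | i < r].
    apply/freeP => k k0 i; have := ext k i.
    rewrite (eq_bigr (fun j : 'I_r => k j *: [tuple q i | i < r]`_j)); last first.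
      by move=> j _; rewrite hq.
    by rewrite k0 linear0.
  have bq : basis_of fullv [tuple q i | i < r].
    by rewrite basisEfree fr subvf size_tuple dim_fib leqnn.
  have [/eqP sq _] := andP bq.
  have vq : v \in <<[tuple q i | i < r]>>%VS by rewrite sq memvf.
  have : v = \sum_i coord [tuple q i | i < r] i v *: q i.
    by rewrite {1}(coord_span vq); apply: eq_bigr => i _; rewrite hq.
  by move=> ve; rewrite {1}ve; apply: eq_bigr => i _; rewrite {2}ve ext.
split=> // t; apply/lfunP => v; rewrite {1}(E1 v) linear_sum sum_lfunE.
by apply: eq_bigr => i _; rewrite linearZ scale_lfunE /= [RHS]mulrC.
Qed.

Lemma pairing_smooth_on U (t : sec (bdual E)) (s : sec E) : open U ->
  (forall a i, smooth_on (tdom a `&` U) (fun m => coord [tuple frame a k m | k < r] i (s m))) ->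
  (forall a i, smooth_on (tdom a `&` U) (fun m => t m (frame a i m))) ->
  smooth_on U (pairing t s).
Proof.
move=> oU cs ct; apply: smooth_on_local => m Um; have [a am] := tdom_cover E m.
exists (tdom a `&` U); split=> //; have o := openI (tdom_open a) oU.
apply: (smooth_on_eq o _ (smooth_on_sum _ o (fun i => smooth_onM o (cs a i) (ct a i)))).
move=> x [ax _]; rewrite /pairing [s x in RHS](frame_expand (s x) ax) linear_sum.
by apply: eq_bigr => i _; rewrite linearZ.
Qed.

Lemma pairing_smooth (t : sec (bdual E)) (s : sec E) : Gamd t -> Gam s -> smooth (pairing t s).
Proof.
move=> ct cs; apply: pairing_smooth_on openT _ _ => a i.
  by rewrite setIT.
by rewrite setIT.
Qed.

Lemma Gam_ext (U Z : set M) chi (s : sec E) : open U -> open Z -> smooth chi ->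
  (forall x, Z x -> chi x = 0) -> (forall x, U x \/ Z x) ->
  (forall a i, smooth_on (tdom a `&` U) (fun m => coord [tuple frame a k m | k < r] i (s m))) ->
  Gam (secZ chi s).
Proof. exact: (smooth_coords_ext (@tdom_open _ _ _ _ E) ellE_lin). Qed.

Lemma Gamd_ext (U Z : set M) chi (t : sec (bdual E)) : open U -> open Z -> smooth chi ->
  (forall x, Z x -> chi x = 0) -> (forall x, U x \/ Z x) ->
  (forall a i, smooth_on (tdom a `&` U) (fun m => t m (frame a i m))) ->
  Gamd (secZ chi t).
Proof. exact: (smooth_coords_ext (@tdom_open _ _ _ _ E) ellE'_lin). Qed.

(** A frame and its coordinate functionals are made global by a cut-off chi; on W, where chi = 1,
    they are still dual to each other. *)
Lemma frames_at (m : M) : exists U (q : 'I_r -> sec E) (tau : 'I_r -> sec (bdual E)),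
  [/\ open U, U m, forall i, Gam (q i), forall i, Gamd (tau i) &
     forall x i j, U x -> tau i x (q j x) = (i == j)%:R].
Proof.
have [a am] := tdom_cover E m.
have [chi [W [Z [schi [oW Wm WU] chi1 oZ [chi0 cov]]]]] := bump_exists (tdom_open a) am.
have tau0 (i : 'I_r) x : {t : bdual E x | forall v, t v = coord [tuple frame a k x | k < r] i v}.
  by apply: covector_of => k u v; exact: ellE_lin.
have tau0E i x v : sval (tau0 i x) v = coord [tuple frame a k x | k < r] i v := svalP (tau0 i x) v.
exists W, (fun i => secZ chi (frame a i)), (fun i => secZ chi (fun x => sval (tau0 i x))); split=> //.
- by move=> i; apply: (Gam_ext (tdom_open a) oZ) => // b j; exact: frame_smooth.
- move=> i; apply: (Gamd_ext (tdom_open a) oZ) => // b j.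
  rewrite setIC; apply: (smooth_on_eq (openI (tdom_open _) (tdom_open _)) _ (frame_smooth a b i j)).
  by move=> x _; exact: (esym (tau0E i x (frame b j x))).
- move=> x i j Wx; rewrite /secZ scale_lfunE linearZ /= chi1 // !scale1r.
  apply: etrans (tau0E i x _) (frame_coord i j (WU _ Wx)).
Qed.

Lemma Gam_module : smooth_module (@Gam R n M r E).
Proof.
split.
- by move=> s t; exact: (smooth_coordsD (@tdom_open _ _ _ _ E) ellE_lin).
- by move=> f s; exact: (smooth_coordsZ (@tdom_open _ _ _ _ E) ellE_lin).
- exact: (smooth_coords0 (@tdom_open _ _ _ _ E) ellE_lin).
- by move=> s; exact: (smooth_coords_local (ell := ellE) (@tdom_open _ _ _ _ E)).
move=> m; have [U [q [tau [oU Um Gq Gt dual]]]] := frames_at m.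
exists r, q, (fun i x v => tau i x v), U; split=> //.
- by move=> i t Ht; apply: pairing_smooth.
split=> [i x|x Ux v]; first exact: linear0.
have [e _] := dual_expand (fun i j => dual x i j Ux); exact: e.
Qed.

Lemma Gamd_module : smooth_module (@Gamd R n M r E).
Proof.
split.
- by move=> s t; exact: (smooth_coordsD (@tdom_open _ _ _ _ E) ellE'_lin).
- by move=> f s; exact: (smooth_coordsZ (@tdom_open _ _ _ _ E) ellE'_lin).
- exact: (smooth_coords0 (@tdom_open _ _ _ _ E) ellE'_lin).
- by move=> s; exact: (smooth_coords_local (ell := ellE') (@tdom_open _ _ _ _ E)).
move=> m; have [U [q [tau [oU Um Gq Gt dual]]]] := frames_at m.
exists r, tau, (fun i x (v : bdual E x) => v (q i x)), U; split=> //.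
- by move=> i t Ht; apply: pairing_smooth.
split=> [i x|x Ux v]; first by rewrite zero_lfunE.
have [_ e] := dual_expand (fun i j => dual x i j Ux); exact: e.
Qed.

End Bundle.
End SmoothModules.

(** * Representability of C^oo-linear maps; anchors *)

Section Representation.
Context {R : realType} {n : nat} {M : manifold R n}.

Lemma sec_through V (G : sec V -> Prop) : smooth_module G ->
  forall (m : M) (v : V m), exists2 s, G s & s m = v.
Proof.
move=> hG m v; have [r [s [c [U [oU Um Gs _ [_ exp]]]]]] := sm_frames hG m.
exists (fun x => \sum_(i < r) secZ (fun=> c i m v) (s i) x); last exact/esym/exp.
apply: sm_sum => // i; apply: (sm_Z hG) => //; exact: smooth_cst.
Qed.

Context {r : nat}.
Variable (E : vbundle M r).

Lemma vec_eq m (v w : E m) : (forall t : bdual E m, t v = t w) -> v = w.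
Proof.
move=> H; have [U [q [tau [oU Um Gq Gt dual]]]] := frames_at E m.
have [ev _] := dual_expand (fun i j => dual m i j Um).
by rewrite (ev v) (ev w); apply: eq_bigr => i _; rewrite H.
Qed.

Lemma Gam_eq (s s' : sec E) :
  (forall t, Gamd t -> forall m, pairing t s m = pairing t s' m) -> s = s'.
Proof.
move=> H; apply: functional_extensionality_dep => m; apply: vec_eq => t.
have [t' Gt <-] := sec_through (Gamd_module E) t; exact: H.
Qed.

Definition cinf_linear V (G : sec V -> Prop) (phi : sec V -> M -> R) :=
  (forall s, G s -> smooth (phi s)) /\
  forall m, tensor_at G m (fun s => phi s m : R^o).

Lemma the_spec T (x0 : T) (P : T -> Prop) : (exists x, P x) -> P (the x0 P).
Proof. by move=> e; rewrite /the; case: pselect => // e'; exact: svalP. Qed.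

(** On a fibre the covector is v |-> phi(s)(m) for any section s through v, which is independent of
    s by [tensor_eq]. Its components in a frame are locally values of phi on cut-off frame sections,
    hence smooth. *)
Lemma as_covectorP (phi : sec E -> M -> R) : cinf_linear (@Gam R n M r E) phi ->
  Gamd (as_covector phi) /\
  forall s, Gam s -> forall m, pairing (as_covector phi) s m = phi s m.
Proof.
move=> [sphi tphi]; suff /(the_spec (sec0 (bdual E))) : exists t : sec (bdual E), Gamd t /\
  forall s, Gam s -> forall m, pairing t s m = phi s m by [].
have hG := Gam_module E.
have ext m (v : E m) : {s | Gam s /\ s m = v}.
  by apply: cid; have [s] := sec_through hG v; exists s.
have T (m : M) : {t : bdual E m | forall v, t v = phi (sval (ext m v)) m}.
  apply: covector_of => k u v.
  have [Gu eu] := svalP (ext m u); have [Gv ev] := svalP (ext m v).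
  have [Gw ew] := svalP (ext m (k *: u + v)).
  have Gku := sm_Z hG (smooth_cst k) Gu.
  rewrite (tensor_eq hG (tphi m) Gw (sm_D hG Gku Gv)); last first.
    by rewrite ew /secD /secZ eu ev.
  by rewrite (tensorD (tphi m) Gku Gv) (tensorZ (tphi m) (smooth_cst k) Gu).
have TE s (Gs : Gam s) m : sval (T m) (s m) = phi s m.
  rewrite (svalP (T m) (s m)); have [Gv ev] := svalP (ext m (s m)).
  exact: (tensor_eq hG (tphi m) Gv Gs ev).
exists (fun m => sval (T m)); split; last exact: TE.
move=> a i; apply: smooth_on_local => m am.
have [chi [W [Z [schi [oW Wm Wa] chi1 oZ [chi0 cov]]]]] := bump_exists (tdom_open a) am.
have Gf : Gam (secZ chi (frame a i)).
  by apply: (Gam_ext (tdom_open a) oZ) => // b j; exact: frame_smooth.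
exists W; split=> //; apply: (smooth_on_eq oW _ (smooth_smooth_on (sphi _ Gf))).
by move=> x Wx; rewrite -TE // /secZ chi1 // scale1r.
Qed.

(** Over a point the vector is sum phi(tau_i)(m) q_i(m) for dual frames; smoothness is tested on the
    cut-off coordinate covectors. *)
Lemma as_vectorP (phi : sec (bdual E) -> M -> R) : cinf_linear (@Gamd R n M r E) phi ->
  Gam (as_vector phi) /\
  forall t, Gamd t -> forall m, pairing t (as_vector phi) m = phi t m.
Proof.
move=> [sphi tphi]; suff /(the_spec (sec0 E)) : exists s : sec E, Gam s /\
  forall t, Gamd t -> forall m, pairing t s m = phi t m by [].
have hG := Gamd_module E.
have S (m : M) : {v : E m | forall t, Gamd t -> t m v = phi t m}.
  apply: cid; have [U [q [tau [oU Um Gq Gt dual]]]] := frames_at E m.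
  have [_ et] := dual_expand (fun i j => dual m i j Um).
  exists (\sum_i phi (tau i) m *: q i m) => t Ht.
  pose t' : sec (bdual E) := fun x => \sum_i secZ (fun=> t m (q i m)) (tau i) x.
  have Gt' i : Gamd (secZ (fun=> t m (q i m)) (tau i)).
    by apply: (sm_Z hG) => //; exact: smooth_cst.
  have Gs : Gamd t' by exact: sm_sum.
  have tE : t m = t' m by exact: et.
  rewrite (tensor_eq hG (tphi m) Ht Gs tE) (tensor_sum hG (tphi m)) //.
  rewrite linear_sum; apply: eq_bigr => i _.
  rewrite linearZ (tensorZ (tphi m)) //; last exact: smooth_cst.
  by rewrite /= [LHS]mulrC.
exists (fun m => sval (S m)); split; last by move=> t Ht m; apply: (svalP (S m)).
move=> a i; apply: smooth_on_local => m am.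
have [chi [W [Z [schi [oW Wm Wa] chi1 oZ [chi0 cov]]]]] := bump_exists (tdom_open a) am.
have T x : {t : bdual E x | forall v, t v = coord [tuple frame a k x | k < r] i v}.
  by apply: covector_of => k u v; rewrite linearP.
have Gf : Gamd (secZ chi (fun x => sval (T x))).
  apply: (Gamd_ext (tdom_open a) oZ) => // b j.
  rewrite setIC; apply: (smooth_on_eq (openI (tdom_open _) (tdom_open _)) _ (frame_smooth a b i j)).
  by move=> x _; exact: (esym (svalP (T x) (frame b j x))).
exists W; split=> //; apply: (smooth_on_eq oW _ (smooth_smooth_on (sphi _ Gf))).
move=> x Wx; rewrite -(svalP (S x) _ Gf) /secZ scale_lfunE chi1 // scale1r.
exact: (svalP (T x)).
Qed.

End Representation.

(** * Anchors as derivations, and their expression in a chart *)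

Section Anchors.
Context {R : realType} {n : nat} {M : manifold R n}.

Lemma smooth_near_smooth m (f : M -> R) : smooth f -> smooth_near m f.
Proof. by move=> sf; exists setT; split=> //; exact: openT. Qed.

Lemma smooth_near_Ck1 m (f : M -> R) (c : atlas M) : dom c m -> smooth_near m f ->
  exists U, [/\ open U, U m, U `<=` dom c, Ck 1 (chart c @` (dom c `&` U)) (f \o unchart c) &
    open (chart c @` (dom c `&` U))].
Proof.
move=> cm [U [oU Um sf]]; have oV := openI (dom_open c) oU.
exists (dom c `&` U); split; [by []|by []|by move=> x []| |exact: chart_image_open].
by have sf' : smooth_on (dom c `&` U) f; [apply: smooth_on_sub sf => x []|exact: (sf' c 1)].
Qed.

Lemma smooth_near_derivable m (f : M -> R) (c : atlas M) v : dom c m -> smooth_near m f ->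
  derivable (f \o unchart c) (chart c m) v.
Proof.
move=> cm /(smooth_near_Ck1 cm)[U [oU Um Uc k1 o]].
by apply: diff_derivable; apply: (Ck_differentiable o _ k1); exists m.
Qed.

Lemma smooth_near_coord m (c : atlas M) j : dom c m -> smooth_near m (fun x => chart c x 0 j).
Proof.
by move=> cm; exists (dom c); split=> //; [exact: dom_open|exact: smooth_on_coord].
Qed.

Context {r : nat} {E : vbundle M r}.
Variable (rho : anchor_map E) (hrho : is_anchor rho).
Arguments rho : clear implicits.

Lemma anchorD m v (f g : M -> R) : smooth_near m f -> smooth_near m g ->
  rho m v (fun x => f x + g x) = rho m v f + rho m v g.
Proof.
move=> sf sg; have [c [a [cm H]]] := anchor_tangent hrho v.
have sfg : smooth_near m (fun x => f x + g x).
  move: sf sg => [U [oU Um sf]] [V [oV Vm sg]]; exists (U `&` V); split=> //; first exact: openI.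
  by apply: smooth_onD; [exact: openI|apply: smooth_on_sub sf => x []|apply: smooth_on_sub sg => x []].
rewrite !H // -big_split; apply: eq_bigr => j _ /=; rewrite -mulrDr; congr (_ * _).
exact: (deriveD (smooth_near_derivable (v := delta_mx 0 j) cm sf) (smooth_near_derivable (v := delta_mx 0 j) cm sg)).
Qed.

Lemma anchorM m v (f g : M -> R) : smooth_near m f -> smooth_near m g ->
  rho m v (fun x => f x * g x) = f m * rho m v g + g m * rho m v f.
Proof.
move=> sf sg; have [c [a [cm H]]] := anchor_tangent hrho v.
have sfg : smooth_near m (fun x => f x * g x).
  move: sf sg => [U [oU Um sf]] [V [oV Vm sg]]; exists (U `&` V); split=> //; first exact: openI.
  by apply: smooth_onM; [exact: openI|apply: smooth_on_sub sf => x []|apply: smooth_on_sub sg => x []].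
rewrite !H // !mulr_sumr -big_split; apply: eq_bigr => j _ /=.
have -> := deriveM (smooth_near_derivable (v := delta_mx 0 j) cm sf) (smooth_near_derivable (v := delta_mx 0 j) cm sg) :
  'D_(delta_mx 0 j) ((fun x => f x * g x) \o unchart c) (chart c m) = _.
rewrite /= chartK // -[_ *: _ in X in X + _]/(_ * _) -[_ *: _ in X in _ + X]/(_ * _); ring.
Qed.

Lemma anchor_cst m v (a : R) : rho m v (fun=> a) = 0.
Proof.
have [c [b [cm H]]] := anchor_tangent hrho v.
rewrite H; last by apply: smooth_near_smooth; exact: smooth_cst.
by rewrite big1 // => j _; rewrite [X in _ * X]derive_cst mulr0.
Qed.

(** A tangent vector comes with some chart c' of its own. Applied to the coordinates of c it yields
    its components there, and the chain rule for the transition from c' to c gives the formula. *)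
Lemma anchor_chart (c : atlas M) m v (f : M -> R) : dom c m -> smooth_near m f ->
  rho m v f = \sum_j rho m v (fun x => chart c x 0 j) *
     'D_(delta_mx 0 j) (f \o unchart c) (chart c m).
Proof.
move=> cm sf; have [c' [a [c'm H]]] := anchor_tangent hrho v.
rewrite (H f) //.
have H' j := H _ (smooth_near_coord j cm).
under [RHS]eq_bigr do rewrite H' mulr_suml.
rewrite exchange_big; apply: eq_bigr => i _ /=.
under eq_bigr do rewrite -mulrA; rewrite -mulr_sumr; congr (_ * _).
have [U [oU Um Uc k1 o]] := smooth_near_Ck1 cm sf.
have o' := chart_image_open c' (openI (dom_open c') oU).
have Um' : (chart c' @` (dom c' `&` (dom c' `&` U))) (chart c' m) by exists m.
have D := @derive_comp_row _ _ _ _ _ (fun x => chart c (unchart c' x))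
   (f \o unchart c) (chart c' m) i o' o Um' _ _ k1.
have [||_] := D.
- by rewrite chartK //; exists m => //; split => //; exact: Uc.
- by move=> j; apply: chart_transition_Ck => x [_ /Uc].
rewrite chartK // => eD.
transitivity (\sum_j 'D_(delta_mx 0 j) (f \o unchart c) (chart c m) *
     'D_(delta_mx 0 i) (fun y => chart c (unchart c' y) 0 j) (chart c' m)).
  rewrite -eD; apply: near_eq_derive; apply: (near_eq_on o' Um') => _ [x [c'x [_ Ux]] <-] /=.
  by rewrite chartK // chartK //; exact: Uc.
by apply: eq_bigr => j _; rewrite mulrC.
Qed.

Lemma along_smooth q f : Gam q -> smooth f -> smooth (along rho q f).
Proof. by move=> Gq sf; apply: (anchor_smooth hrho) => //; exact: openT. Qed.

Lemma along_tensor m f : smooth f -> tensor_at (@Gam R n M r E) m (fun q => along rho q f m : R^o).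
Proof.
move=> sf; have lin a u v := @anchor_linear _ _ _ _ _ _ hrho m a u v f (smooth_near_smooth m sf).
have rho0 : rho m 0 f = 0.
  by have := lin (-1) 0 0; rewrite scaler0 addr0 mulN1r addNr.
split=> [s t _ _|g s sg _]; rewrite /along /secD /secZ.
  by have := lin 1 (s m) (t m); rewrite scale1r mul1r.
by have := lin (g m) (s m) 0; rewrite addr0 rho0 addr0.
Qed.

Lemma alongD q f g : smooth f -> smooth g ->
  along rho q (fun x => f x + g x) = fun m => along rho q f m + along rho q g m.
Proof. by move=> sf sg; apply/funext => m; apply: anchorD; exact: smooth_near_smooth. Qed.

Lemma alongM m q f g : smooth f -> smooth g ->
  along rho q (fun x => f x * g x) m = f m * along rho q g m + g m * along rho q f m.
Proof. by move=> sf sg; apply: anchorM; exact: smooth_near_smooth. Qed.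

Lemma codiffP f : smooth f -> Gamd (codiff rho f) /\
  forall q, Gam q -> forall m, pairing (codiff rho f) q m = along rho q f m.
Proof.
move=> sf; apply: as_covectorP; split=> [s Gs|m]; first exact: along_smooth.
exact: along_tensor.
Qed.

End Anchors.

(** * The graded algebra of functions *)

Section ShuffleProducts.
Context {R : comPzRingType} {V W : Type}.
Implicit Types (f g : seq V -> seq W -> R) (h k : seq W -> R).

(** The sign that contraction with an odd vector acquires in passing f, read off from the number of
    odd arguments. *)
Definition twist f : seq V -> seq W -> R := fun us xs => (-1) ^+ size us * f us xs.

Lemma gr_mul_cons f g v vs ws : gr_mul f g (v :: vs) ws =
  gr_mul (fun us => f (v :: us)) g vs ws + gr_mul (twist f) (fun us => g (v :: us)) vs ws.
Proof. by []. Qed.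

Lemma eq_sym_mul h h' k k' ws : h =1 h' -> k =1 k' -> sym_mul h k ws = sym_mul h' k' ws.
Proof. by move=> /funext -> /funext ->. Qed.

Lemma eq_gr_mul f f' g g' vs ws : f =2 f' -> g =2 g' -> gr_mul f g vs ws = gr_mul f' g' vs ws.
Proof.
move=> ff gg; have -> : f = f' by apply/funext => us; apply/funext => xs.
by have -> : g = g' by apply/funext => us; apply/funext => xs.
Qed.

Lemma sym_mul_linl (a : R) h h' k ws :
  sym_mul (fun xs => a * h xs + h' xs) k ws = a * sym_mul h k ws + sym_mul h' k ws.
Proof.
elim: ws h h' k => [|w ws IH] h h' k /=; first by ring.
by rewrite (IH (fun xs => h (w :: xs)) (fun xs => h' (w :: xs))) (IH h h'); ring.
Qed.

Lemma sym_mul_linr (a : R) h k k' ws :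
  sym_mul h (fun xs => a * k xs + k' xs) ws = a * sym_mul h k ws + sym_mul h k' ws.
Proof.
elim: ws h k k' => [|w ws IH] h k k' /=; first by ring.
by rewrite (IH h (fun xs => k (w :: xs)) (fun xs => k' (w :: xs))) (IH (fun xs => h (w :: xs)) k k'); ring.
Qed.

Lemma gr_mul_linl (a : R) f f' g vs ws :
  gr_mul (fun us xs => a * f us xs + f' us xs) g vs ws = a * gr_mul f g vs ws + gr_mul f' g vs ws.
Proof.
elim: vs f f' g => [|v vs IH] f f' g; first exact: sym_mul_linl.
rewrite !gr_mul_cons (IH (fun us => f (v :: us)) (fun us => f' (v :: us))).
rewrite (@eq_gr_mul (twist (fun us xs => a * f us xs + f' us xs))
  (fun us xs => a * twist f us xs + twist f' us xs) _ (fun us => g (v :: us))) //.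
  by rewrite IH; ring.
by move=> us xs; rewrite /twist; ring.
Qed.

Lemma gr_mul_linr (a : R) f g g' vs ws :
  gr_mul f (fun us xs => a * g us xs + g' us xs) vs ws = a * gr_mul f g vs ws + gr_mul f g' vs ws.
Proof.
elim: vs f g g' => [|v vs IH] f g g'; first exact: sym_mul_linr.
rewrite !gr_mul_cons (IH _ g g') (IH _ (fun us => g (v :: us)) (fun us => g' (v :: us))).
by ring.
Qed.

Lemma gr_mul0l g vs ws : gr_mul (fun _ _ => 0) g vs ws = 0 :> R.
Proof.
rewrite (@eq_gr_mul _ (fun _ _ => -1 * 0 + 0) g g) //; last by move=> us xs; rewrite mulr0 addr0.
by rewrite (gr_mul_linl _ (fun _ _ => 0) (fun _ _ => 0)) mulN1r addNr.
Qed.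

Lemma gr_mul0r f vs ws : gr_mul f (fun _ _ => 0) vs ws = 0 :> R.
Proof.
rewrite (@eq_gr_mul f f _ (fun _ _ => -1 * 0 + 0)) //; last by move=> us xs; rewrite mulr0 addr0.
by rewrite (gr_mul_linr _ f (fun _ _ => 0) (fun _ _ => 0)) mulN1r addNr.
Qed.

Lemma gr_mulDl f f' g vs ws :
  gr_mul (fun us xs => f us xs + f' us xs) g vs ws = gr_mul f g vs ws + gr_mul f' g vs ws.
Proof.
by rewrite -[X in X + _]mul1r -gr_mul_linl; apply: eq_gr_mul => // us xs; rewrite mul1r.
Qed.

Lemma gr_mulDr f g g' vs ws :
  gr_mul f (fun us xs => g us xs + g' us xs) vs ws = gr_mul f g vs ws + gr_mul f g' vs ws.
Proof.
by rewrite -[X in X + _]mul1r -gr_mul_linr; apply: eq_gr_mul => // us xs; rewrite mul1r.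
Qed.

Lemma gr_mulZl (a : R) f g vs ws :
  gr_mul (fun us xs => a * f us xs) g vs ws = a * gr_mul f g vs ws.
Proof.
rewrite -[RHS]addr0 -(gr_mul0l g vs ws) -gr_mul_linl.
by apply: eq_gr_mul => // us xs; rewrite addr0.
Qed.

Lemma gr_mulZr (a : R) f g vs ws :
  gr_mul f (fun us xs => a * g us xs) vs ws = a * gr_mul f g vs ws.
Proof.
rewrite -[RHS]addr0 -(gr_mul0r f vs ws) -gr_mul_linr.
by apply: eq_gr_mul => // us xs; rewrite addr0.
Qed.

Lemma gr_mulNl f g vs ws :
  gr_mul (fun us xs => - f us xs) g vs ws = - gr_mul f g vs ws.
Proof. by rewrite -mulN1r -gr_mulZl; apply: eq_gr_mul => // us xs; rewrite mulN1r. Qed.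

Lemma gr_mulNr f g vs ws :
  gr_mul f (fun us xs => - g us xs) vs ws = - gr_mul f g vs ws.
Proof. by rewrite -mulN1r -gr_mulZr; apply: eq_gr_mul => // us xs; rewrite mulN1r. Qed.

Lemma sym_mul_scalar_l h k ws : (forall x xs, h (x :: xs) = 0) ->
  sym_mul h k ws = h [::] * k ws.
Proof.
move=> h0; elim: ws k => [//|w ws IH] k /=; rewrite IH.
suff -> : sym_mul (fun us => h (w :: us)) k ws = 0 by rewrite add0r.
clear IH; move: k; elim: ws => [|x xs IH] k /=; first by rewrite h0 mul0r.
rewrite IH addr0 (@eq_sym_mul _ (fun us => h (w :: us)) _ k) ?IH // => us; by rewrite !h0.
Qed.

Lemma sym_mul_scalar_r h k ws : (forall x xs, k (x :: xs) = 0) ->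
  sym_mul h k ws = h ws * k [::].
Proof.
move=> k0; elim: ws h => [//|w ws IH] h /=; rewrite IH.
suff -> : sym_mul h (fun us => k (w :: us)) ws = 0 by rewrite addr0.
clear IH; move: h; elim: ws => [|x xs IH] h /=; first by rewrite k0 mulr0.
rewrite IH add0r (@eq_sym_mul _ h _ (fun us => k (w :: us))) ?IH // => us; by rewrite !k0.
Qed.

Definition null_head f := (forall u us xs, f (u :: us) xs = 0) /\ (forall x xs, f [::] (x :: xs) = 0).

Lemma gr_mul_scalar_l f g vs ws : null_head f -> gr_mul f g vs ws = f [::] [::] * g vs ws.
Proof.
move=> [f0 f1]; elim: vs g => [|v vs IH] g; first exact: sym_mul_scalar_l.
rewrite gr_mul_cons (@eq_gr_mul _ (fun _ _ => 0) g g) // gr_mul0l add0r.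
rewrite (@eq_gr_mul _ f _ (fun us => g (v :: us))) ?IH // => -[|u us] xs; rewrite /twist.
  by rewrite mul1r.
by rewrite f0 mulr0.
Qed.

Lemma gr_mul_scalar_r f g vs ws : null_head g -> gr_mul f g vs ws = f vs ws * g [::] [::].
Proof.
move=> [g0 g1]; elim: vs f => [|v vs IH] f; first exact: sym_mul_scalar_r.
rewrite gr_mul_cons IH [X in _ + X](@eq_gr_mul _ (twist f) _ (fun _ _ => 0)) //.
by rewrite gr_mul0r addr0.
Qed.

End ShuffleProducts.

(** * Multilinearity, symmetry and degree of shuffle products *)

Section MultilinearProducts.
Context {R : comPzRingType} {V W : lmodType R}.
Implicit Types (f g : seq V -> seq W -> R) (h k : seq W -> R).

Definition lin_odd f := forall vs1 vs2 ws (a : R) u v,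
  f (vs1 ++ (a *: u + v) :: vs2) ws = a * f (vs1 ++ u :: vs2) ws + f (vs1 ++ v :: vs2) ws.
Definition lin_even f := forall vs ws1 ws2 (a : R) u w,
  f vs (ws1 ++ (a *: u + w) :: ws2) = a * f vs (ws1 ++ u :: ws2) + f vs (ws1 ++ w :: ws2).
Definition alt_odd f := forall vs1 vs2 ws v, f (vs1 ++ v :: v :: vs2) ws = 0.
Definition sym_even f := forall vs ws1 ws2 u w,
  f vs (ws1 ++ u :: w :: ws2) = f vs (ws1 ++ w :: u :: ws2).
(** The shift i is the degree of the arguments already filled in. Recursion over the arguments
    raises i and leaves d alone, which avoids subtraction of degrees. *)
Definition deg_shift i d f := forall us xs, (size us + 2 * size xs + i != d)%N -> f us xs = 0.

Lemma lin_odd_cons f v : lin_odd f -> lin_odd (fun us => f (v :: us)).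
Proof. by move=> H vs1 vs2 ws a u w; exact: (H (v :: vs1)). Qed.

Lemma lin_odd_twist f : lin_odd f -> lin_odd (twist f).
Proof. by move=> H vs1 vs2 ws a u w; rewrite /twist !size_cat H /=; ring. Qed.

Lemma gr_mul_lin_odd f g : lin_odd f -> lin_odd g -> lin_odd (gr_mul f g).
Proof.
move=> Hf Hg vs1; elim: vs1 f g Hf Hg => [|x vs1 IH] f g Hf Hg vs2 ws a u v.
  rewrite /= -/(twist f).
  rewrite (@eq_gr_mul _ _ _ _ (fun us xs => a * f (u :: us) xs + f (v :: us) xs) g g) //; last first.
    by move=> us xs; exact: (Hf [::]).
  rewrite [X in _ + X](@eq_gr_mul _ _ _ _ (twist f) _ (fun us xs => a * g (u :: us) xs + g (v :: us) xs)) //; last first.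
    by move=> us xs; exact: (Hg [::]).
  by rewrite (gr_mul_linl a (fun us => f (u :: us))) (gr_mul_linr a _ (fun us => g (u :: us))); ring.
rewrite !cat_cons !gr_mul_cons (IH _ _ (lin_odd_cons x Hf) Hg).
by rewrite (IH _ _ (lin_odd_twist Hf) (lin_odd_cons x Hg)); ring.
Qed.

Lemma sym_mul_lin h k : lin_even (fun _ : seq V => h) -> lin_even (fun _ : seq V => k) ->
  lin_even (fun _ : seq V => sym_mul h k).
Proof.
move=> Hh Hk vs ws1; elim: ws1 h k Hh Hk => [|x ws1 IH] h k Hh Hk ws2 a u w.
  rewrite /= (@eq_sym_mul _ _ _ (fun xs => a * h (u :: xs) + h (w :: xs)) k k) //; last first.
    by move=> xs; exact: (Hh [::] [::]).
  rewrite [X in _ + X](@eq_sym_mul _ _ h h _ (fun xs => a * k (u :: xs) + k (w :: xs))) //; last first.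
    by move=> xs; exact: (Hk [::] [::]).
  by rewrite (sym_mul_linl a (fun us => h (u :: us))) (sym_mul_linr a _ (fun us => k (u :: us))); ring.
have Hh' : lin_even (fun _ : seq V => fun xs => h (x :: xs)).
  by move=> vs' ws1' ws2' a' u' w'; exact: (Hh vs' (x :: ws1')).
have Hk' : lin_even (fun _ : seq V => fun xs => k (x :: xs)).
  by move=> vs' ws1' ws2' a' u' w'; exact: (Hk vs' (x :: ws1')).
by rewrite !cat_cons /= (IH _ _ Hh' Hk) (IH _ _ Hh Hk'); ring.
Qed.

Lemma lin_even_cons f v : lin_even f -> lin_even (fun us => f (v :: us)).
Proof. by move=> H vs ws1 ws2 a u w; exact: (H (v :: vs)). Qed.

Lemma lin_even_twist f : lin_even f -> lin_even (twist f).
Proof. by move=> H vs ws1 ws2 a u w; rewrite /twist H; ring. Qed.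

Lemma gr_mul_lin_even f g : lin_even f -> lin_even g -> lin_even (gr_mul f g).
Proof.
move=> Hf Hg vs; elim: vs f g Hf Hg => [|x vs IH] f g Hf Hg ws1 ws2 a u w.
  exact: (sym_mul_lin (h := f [::]) (k := g [::]) (fun _ => Hf [::]) (fun _ => Hg [::]) [::]).
rewrite !gr_mul_cons (IH _ _ (lin_even_cons x Hf) Hg).
by rewrite (IH _ _ (lin_even_twist Hf) (lin_even_cons x Hg)); ring.
Qed.

Lemma twist_cons f v us xs : twist f (v :: us) xs = - twist (fun us => f (v :: us)) us xs.
Proof. by rewrite /twist /= exprS mulN1r mulNr. Qed.

(** If both copies of v go to one factor the term is 0; the two ways of giving one copy to each
    factor cancel by [twist_cons]. *)
Lemma gr_mul_alt f g : alt_odd f -> alt_odd g -> alt_odd (gr_mul f g).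
Proof.
move=> Hf Hg vs1; elim: vs1 f g Hf Hg => [|x vs1 IH] f g Hf Hg vs2 ws v.
  rewrite cat0s !gr_mul_cons.
  rewrite (@eq_gr_mul _ _ _ _ (fun _ _ => 0) g g) //; last by move=> us xs; exact: (Hf [::]).
  rewrite gr_mul0l add0r.
  rewrite [X in _ + (_ + X)](@eq_gr_mul _ _ _ _ (twist (twist f)) _ (fun _ _ => 0)) //; last first.
    by move=> us xs; exact: (Hg [::]).
  rewrite gr_mul0r addr0.
  rewrite [X in _ + X](@eq_gr_mul _ _ _ _ (fun us xs => - twist (fun us => f (v :: us)) us xs)
    _ (fun us => g (v :: us))) //; last by move=> us xs; exact: twist_cons.
  by rewrite gr_mulNl subrr.
have Hf' : alt_odd (fun us => f (x :: us)) by move=> a b c d; exact: (Hf (x :: a)).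
have Hg' : alt_odd (fun us => g (x :: us)) by move=> a b c d; exact: (Hg (x :: a)).
have Ht : alt_odd (twist f) by move=> a b c d; rewrite /twist Hf mulr0.
by rewrite cat_cons gr_mul_cons (IH _ _ Hf' Hg) (IH _ _ Ht Hg') addr0.
Qed.

Lemma sym_mul_sym h k : sym_even (fun _ : seq V => h) -> sym_even (fun _ : seq V => k) ->
  sym_even (fun _ : seq V => sym_mul h k).
Proof.
move=> Hh Hk vs ws1; elim: ws1 h k Hh Hk => [|x ws1 IH] h k Hh Hk ws2 u w.
  rewrite /= (@eq_sym_mul _ _ (fun us => h (u :: w :: us)) (fun us => h (w :: u :: us)) k k) //; last first.
    by move=> xs; exact: (Hh [::] [::]).
  rewrite [X in _ + (_ + X)](@eq_sym_mul _ _ h h (fun us => k (u :: w :: us)) (fun us => k (w :: u :: us))) //; last first.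
    by move=> xs; exact: (Hk [::] [::]).
  by ring.
have Hh' : sym_even (fun _ : seq V => fun xs => h (x :: xs)).
  by move=> vs' ws1' ws2' u' w'; exact: (Hh vs' (x :: ws1')).
have Hk' : sym_even (fun _ : seq V => fun xs => k (x :: xs)).
  by move=> vs' ws1' ws2' u' w'; exact: (Hk vs' (x :: ws1')).
by rewrite !cat_cons /= (IH _ _ Hh' Hk) (IH _ _ Hh Hk').
Qed.

Lemma gr_mul_sym f g : sym_even f -> sym_even g -> sym_even (gr_mul f g).
Proof.
move=> Hf Hg vs; elim: vs f g Hf Hg => [|x vs IH] f g Hf Hg ws1 ws2 u w.
  exact: (sym_mul_sym (h := f [::]) (k := g [::]) (fun _ => Hf [::]) (fun _ => Hg [::]) [::]).
have Hf' : sym_even (fun us => f (x :: us)) by move=> us; exact: (Hf (x :: us)).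
have Hg' : sym_even (fun us => g (x :: us)) by move=> us; exact: (Hg (x :: us)).
have Ht : sym_even (twist f) by move=> us *; rewrite /twist Hf.
by rewrite !gr_mul_cons (IH _ _ Hf' Hg) (IH _ _ Ht Hg').
Qed.

Lemma sym_mul_deg i j d e h k :
  (forall xs, (2 * size xs + i != d)%N -> h xs = 0) ->
  (forall xs, (2 * size xs + j != e)%N -> k xs = 0) ->
  forall ws, (2 * size ws + i + j != d + e)%N -> sym_mul h k ws = 0.
Proof.
move=> Hh Hk ws; elim: ws i j h k Hh Hk => [|w ws IH] i j h k Hh Hk /= ne.
  have [Ei|ni] := eqVneq i d; last by rewrite Hh ?mul0r.
  rewrite Hk ?mulr0 //; apply: contra ne => /= /eqP <-; by rewrite Ei.
have Hh' xs : (2 * size xs + i.+2 != d)%N -> h (w :: xs) = 0.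
  by move=> ne'; apply: Hh => /=; lia.
have Hk' xs : (2 * size xs + j.+2 != e)%N -> k (w :: xs) = 0.
  by move=> ne'; apply: Hk => /=; lia.
by rewrite (IH _ _ _ _ Hh' Hk) ?(IH _ _ _ _ Hh Hk') ?addr0 //; lia.
Qed.

Lemma gr_mul_deg i j d e f g : deg_shift i d f -> deg_shift j e g ->
  deg_shift (i + j) (d + e) (gr_mul f g).
Proof.
move=> Hf Hg vs ws; elim: vs i j f g Hf Hg => [|v vs IH] i j f g Hf Hg ne.
  apply: (@sym_mul_deg i j d e) => [xs ne'|xs ne'|].
  - by apply: Hf; rewrite add0n.
  - by apply: Hg; rewrite add0n.
  - by move: ne; rewrite /=; lia.
have Hf' : deg_shift i.+1 d (fun us => f (v :: us)).
  by move=> us xs ne'; apply: Hf => /=; lia.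
have Hg' : deg_shift j.+1 e (fun us => g (v :: us)).
  by move=> us xs ne'; apply: Hg => /=; lia.
have Ht : deg_shift i d (twist f) by move=> us xs ne'; rewrite /twist Hf // mulr0.
by rewrite gr_mul_cons (IH _ _ _ _ Hf' Hg) ?(IH _ _ _ _ Ht Hg') ?addr0 //; move: ne => /=; lia.
Qed.

Lemma alt_odd_skew f : lin_odd f -> alt_odd f -> forall a b us xs,
  f (a :: b :: us) xs = - f (b :: a :: us) xs.
Proof.
move=> lf af a b us xs; have := af [::] us xs (1 *: a + b).
rewrite (lf [::]) (lf [:: a]) (lf [:: b]) /= (af [::]) (af [::] us xs b) /= !mul1r add0r addr0.
by move=> /eqP; rewrite addr_eq0 => /eqP.
Qed.

End MultilinearProducts.

Arguments gmul {R n rQ rB M Q B} xi eta m vs ws.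
Arguments gadd {R n rQ rB M Q B} xi eta m vs ws.
Arguments gscale {R n rQ rB M Q B} a xi m vs ws.
Arguments gzero {R n rQ rB M Q B} m vs ws.
Arguments of_fun {R n rQ rB M Q B} f m vs ws.
Arguments of_Qd {R n rQ rB M Q B} t m vs ws.
Arguments of_B {R n rQ rB M Q B} b m vs ws.

(** * Homogeneous functions, contractions and Euler's identity *)

Section GradedFunctions.
Context {R : realType} {n rQ rB : nat} {M : manifold R n}.
Context {Q : vbundle M rQ} {B : vbundle M rB}.
Notation gf := (gfun Q B).
Notation g0 := (@gzero R n rQ rB M Q B).
Implicit Types (x y z : gf) (m : M) (f : M -> R) (t : sec (bdual Q)) (b : sec B) (q : sec Q).

Lemma gfun_ext x y : (forall m vs ws, x m vs ws = y m vs ws) -> x = y.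
Proof.
move=> H; apply: functional_extensionality_dep => m.
by apply/funext => vs; apply/funext => ws.
Qed.

Lemma gmulDl x y z : gmul (gadd x y) z = gadd (gmul x z) (gmul y z).
Proof. by apply: gfun_ext => m vs ws; apply: gr_mulDl. Qed.

Lemma gmulDr x y z : gmul z (gadd x y) = gadd (gmul z x) (gmul z y).
Proof. by apply: gfun_ext => m vs ws; apply: gr_mulDr. Qed.

Lemma gmulZl (a : R) x z : gmul (gscale a x) z = gscale a (gmul x z).
Proof. by apply: gfun_ext => m vs ws; apply: gr_mulZl. Qed.

Lemma gmulZr (a : R) x z : gmul z (gscale a x) = gscale a (gmul z x).
Proof. by apply: gfun_ext => m vs ws; apply: gr_mulZr. Qed.

Lemma gmul0l z : gmul g0 z = g0.
Proof. by apply: gfun_ext => m vs ws; apply: gr_mul0l. Qed.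

Lemma gmul0r z : gmul z g0 = g0.
Proof. by apply: gfun_ext => m vs ws; apply: gr_mul0r. Qed.

Lemma gscale1 x : gscale 1 x = x.
Proof. by apply: gfun_ext => m vs ws; rewrite /gscale mul1r. Qed.

Section Pointwise.
Variable m : M.
Implicit Types g : gfib Q B m.

Lemma gr_mul_covec_nil (s : bdual Q m) g ws : gr_mul (of_covec s) g [::] ws = 0.
Proof. by rewrite [LHS]sym_mul_scalar_l //= mul0r. Qed.

Lemma gr_mul_covec_cons (s : bdual Q m) g v vs ws : gr_mul (of_covec s) g (v :: vs) ws =
  s v * g vs ws - gr_mul (of_covec s) (fun us => g (v :: us)) vs ws.
Proof.
rewrite gr_mul_cons gr_mul_scalar_l; last by split=> [u us xs|xx xs] //; case: us.
congr (_ + _); rewrite -gr_mulNl; apply: eq_gr_mul => // -[|u [|u' us]] [|w xs];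
  by rewrite /twist /= ?mulr0 ?oppr0 // expr1 mulN1r.
Qed.

Lemma gr_mul_vec_cons (c : B m) g v vs ws : gr_mul (of_vec c) g (v :: vs) ws =
  gr_mul (of_vec c) (fun us => g (v :: us)) vs ws.
Proof.
rewrite gr_mul_cons (@eq_gr_mul _ _ _ _ (fun _ _ => 0) g g) // gr_mul0l add0r.
by apply: eq_gr_mul => // -[|u us] xs; rewrite /twist /= ?mulr0 // mul1r.
Qed.

Lemma gr_mul_vec_nil (c : B m) g : gr_mul (of_vec c) g [::] [::] = 0.
Proof. exact: mul0r. Qed.

Lemma gr_mul_vec_ncons (c : B m) g w ws : gr_mul (of_vec c) g [::] (w :: ws) =
  w c * g [::] ws + gr_mul (of_vec c) (fun us xs => g us (w :: xs)) [::] ws.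
Proof.
rewrite /gr_mul /= sym_mul_scalar_l //; by move=> xx [].
Qed.

Lemma gr_mul_fun f g vs ws : gr_mul ((of_fun f : gf) m) g vs ws = f m * g vs ws.
Proof. by rewrite gr_mul_scalar_l //; split=> // u us; case. Qed.

Variables (s : nat) (q : 'I_s -> Q m) (tau : 'I_s -> bdual Q m).
Hypothesis qe : forall v, v = \sum_i tau i v *: q i.

Lemma odd_expand g v vs ws : lin_odd g -> g (v :: vs) ws = \sum_i tau i v * g (q i :: vs) ws.
Proof.
move=> lg.
have gz : g (0 :: vs) ws = 0.
  by have := lg [::] vs ws (-1) 0 0; rewrite scaler0 addr0 mulN1r addNr.
rewrite {1}(qe v); elim: (index_enum _) => [|i l IH]; first by rewrite !big_nil.
by rewrite !big_cons (lg [::]) /= IH.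
Qed.

(** Evaluation at the first argument v gives sum tau_i(v) g(q_i, ...) = g(v, ...), plus the same
    identity for the contraction of g with v; the sign from moving v past tau_i is absorbed by
    skew-symmetry. *)
Lemma euler_odd g vs ws : lin_odd g -> alt_odd g ->
  \sum_i gr_mul (of_covec (tau i)) (fun us => g (q i :: us)) vs ws = (size vs)%:R * g vs ws.
Proof.
elim: vs g => [|v vs IH] g lg ag.
  by rewrite big1 ?mul0r // => i _; rewrite gr_mul_covec_nil.
under eq_bigr do rewrite gr_mul_covec_cons.
rewrite sumrB -(odd_expand _ _ _ lg) /= -natr1 mulrDl mul1r addrC; congr (_ + _).
rewrite -(IH (fun us => g (v :: us))); last 2 first.
- exact: lin_odd_cons.
- by move=> a c d e; exact: (ag (v :: a)).
rewrite -sumrN; apply: eq_bigr => i _; rewrite -gr_mulNr.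
by apply: eq_gr_mul => // us xs; rewrite (alt_odd_skew lg ag) opprK.
Qed.

Variables (s' : nat) (c : 'I_s' -> B m) (beta : 'I_s' -> bdual B m).
Hypothesis be : forall w : bdual B m, w = \sum_i w (c i) *: beta i.

Lemma even_expand g w vs ws : lin_even g -> g vs (w :: ws) = \sum_i w (c i) * g vs (beta i :: ws).
Proof.
move=> lg.
have gz : g vs (0 :: ws) = 0.
  by have := lg vs [::] ws (-1) 0 0; rewrite scaler0 addr0 mulN1r addNr.
rewrite {1}(be w); elim: (index_enum _) => [|i l IH]; first by rewrite !big_nil.
by rewrite !big_cons (lg _ [::]) /= IH.
Qed.

(** The argument of [euler_odd] with symmetry in place of skew-symmetry; odd arguments are stripped
    off beforehand, since [of_vec] does not take any. *)
Lemma euler_even g vs ws : lin_even g -> sym_even g ->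
  \sum_i gr_mul (of_vec (c i)) (fun us xs => g us (beta i :: xs)) vs ws = (size ws)%:R * g vs ws.
Proof.
elim: vs g => [|v vs IH] g lg sg; last first.
  under eq_bigr do rewrite gr_mul_vec_cons.
  exact: (IH (fun us => g (v :: us)) (lin_even_cons v lg) (fun us => sg (v :: us))).
elim: ws g lg sg => [|w ws IH] g lg sg.
  by rewrite big1 ?mul0r // => i _; rewrite gr_mul_vec_nil.
under eq_bigr do rewrite gr_mul_vec_ncons.
rewrite big_split -(even_expand _ _ _ lg) /= -natr1 mulrDl mul1r addrC; congr (_ + _).
rewrite -(IH (fun us xs => g us (w :: xs))); last 2 first.
- by move=> us ws1 ws2 a u v; exact: (lg us (w :: ws1)).
- by move=> us ws1 ws2 u v; exact: (sg us (w :: ws1)).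
by apply: eq_bigr => i _; apply: eq_sym_mul => // xs; rewrite (sg [::] [::]).
Qed.

End Pointwise.

(** Past the end of the list [nth] returns the zero section, so G is required to contain it even
    when the list is empty. *)
Definition all_sec (V : M -> vectType R) (G : sec V -> Prop) (l : seq (sec V)) :=
  forall i, G (nth (sec0 V) l i).

(** The smoothness clause of [homog] for lists instead of families indexed by ['I_k]: it is stable
    under filling in the first argument and so fits the recursion of [gr_mul]. *)
Definition smooth_gf x := forall (qs : seq (sec Q)) (bs : seq (sec (bdual B))),
  all_sec (@Gam R n M rQ Q) qs -> all_sec (@Gamd R n M rB B) bs ->
  smooth (fun m => x m [seq s m | s <- qs] [seq s m | s <- bs]).

Lemma all_sec_enum (V : M -> vectType R) (G : sec V -> Prop) k (s : 'I_k -> sec V) : G (sec0 V) ->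
  (forall i, G (s i)) -> all_sec G [seq s i | i <- enum 'I_k].
Proof.
move=> G0 Gs i; have [ik|ik] := ltnP i k.
  rewrite (nth_map (Ordinal ik)) ?size_enum_ord //; exact: Gs.
by rewrite nth_default // size_map size_enum_ord.
Qed.

Lemma map_nth_enum (V : M -> vectType R) (l : seq (sec V)) m :
  [seq nth (sec0 V) l i m | i : 'I_(size l) <- enum 'I_(size l)] = [seq s m | s <- l].
Proof.
rewrite -[X in _ = [seq _ | s <- X]](mkseq_nth (sec0 V)) /mkseq -val_enum_ord -!map_comp.
exact: eq_map.
Qed.

Lemma homog_smooth_gf d x : homog d x -> smooth_gf x.
Proof.
move=> hx qs bs Gq Gb.
have := @homog_smooth _ _ _ _ _ _ _ _ _ hx (size qs) (size bs)
  (fun i => nth (sec0 Q) qs i) (fun i => nth (sec0 (bdual B)) bs i) (fun i => Gq i) (fun i => Gb i).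
apply: (smooth_on_eq openT) => m _.
by rewrite (map_nth_enum qs) (map_nth_enum bs).
Qed.

Lemma smooth_gf_homog x k l (q : 'I_k -> sec Q) (beta : 'I_l -> sec (bdual B)) : smooth_gf x ->
  (forall i, Gam (q i)) -> (forall j, Gamd (beta j)) ->
  smooth (fun m => x m [seq q i m | i <- enum 'I_k] [seq beta j m | j <- enum 'I_l]).
Proof.
move=> sx Gq Gb.
have := sx _ _ (all_sec_enum (sm_0 (Gam_module Q)) Gq) (all_sec_enum (sm_0 (Gamd_module B)) Gb).
by apply: (smooth_on_eq openT) => m _; rewrite -!map_comp.
Qed.

Lemma smooth_gf_cons x q : smooth_gf x -> Gam q -> smooth_gf (fun m us => x m (q m :: us)).
Proof. by move=> sx Gq qs bs aq ab; apply: (sx (q :: qs)) => // -[|i] //=; exact: aq. Qed.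

Lemma smooth_gf_bcons x (beta : sec (bdual B)) : smooth_gf x -> Gamd beta ->
  smooth_gf (fun m us xs => x m us (beta m :: xs)).
Proof. by move=> sx Gq qs bs aq ab; apply: (sx qs (beta :: bs)) => // -[|i] //=; exact: ab. Qed.

Lemma smooth_gf_twist x : smooth_gf x -> smooth_gf (fun m => twist (x m)).
Proof.
move=> sx qs bs aq ab.
apply: (smooth_on_eq openT _ (smoothM (smooth_cst ((-1) ^+ size qs)) (sx qs bs aq ab))) => m _.
by rewrite /twist size_map.
Qed.

Lemma smooth_gf_mul x y : smooth_gf x -> smooth_gf y -> smooth_gf (gmul x y).
Proof.
move=> sx sy qs; elim: qs x y sx sy => [|q qs IH] x y sx sy bs aq ab; last first.
  have Gq : Gam q := aq 0%N.
  have aqs : all_sec (@Gam R n M rQ Q) qs by move=> i; exact: (aq i.+1).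
  have := smoothD (IH _ _ (smooth_gf_cons sx Gq) sy bs aqs ab)
    (IH _ _ (smooth_gf_twist sx) (smooth_gf_cons sy Gq) bs aqs ab).
  exact: (smooth_on_eq openT).
elim: bs x y sx sy ab => [|c bs IH] x y sx sy ab; first exact: smoothM (sx [::] [::] aq ab) (sy [::] [::] aq ab).
have Gc : Gamd c := ab 0%N.
have abs : all_sec (@Gamd R n M rB B) bs by move=> i; exact: (ab i.+1).
have := smoothD (IH _ _ (smooth_gf_bcons sx Gc) sy abs) (IH _ _ sx (smooth_gf_bcons sy Gc) abs).
exact: (smooth_on_eq openT).
Qed.

Lemma homog_lin_odd d x m : homog d x -> lin_odd (x m).
Proof. by move=> hx *; exact: (homog_lin1 hx). Qed.

Lemma homog_lin_even d x m : homog d x -> lin_even (x m).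
Proof. by move=> hx *; exact: (homog_lin2 hx). Qed.

Lemma homog_alt_odd d x m : homog d x -> alt_odd (x m).
Proof. by move=> hx *; exact: (homog_alt hx). Qed.

Lemma homog_sym_even d x m : homog d x -> sym_even (x m).
Proof. by move=> hx *; exact: (homog_sym hx). Qed.

Lemma homog_gmul k l x y : homog k x -> homog l y -> homog (k + l) (gmul x y).
Proof.
move=> hx hy; split.
- move=> m vs ws ne; apply: (@gr_mul_deg _ _ _ 0 0 k l); last by rewrite !addn0.
    by move=> us xs; rewrite addn0; exact: homog_deg.
  by move=> us xs; rewrite addn0; exact: homog_deg.
- by move=> m; apply: gr_mul_lin_odd; apply: homog_lin_odd; eassumption.
- by move=> m; apply: gr_mul_lin_even; apply: homog_lin_even; eassumption.
- by move=> m; apply: gr_mul_alt; apply: homog_alt_odd; eassumption.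
- by move=> m; apply: gr_mul_sym; apply: homog_sym_even; eassumption.
- move=> p p' q beta; apply: smooth_gf_homog; apply: smooth_gf_mul; apply: homog_smooth_gf; eassumption.
Qed.

Lemma homog_gzero d : homog d g0.
Proof. by split=> // *; rewrite /gzero ?mulr0 ?addr0 //; exact: smooth_cst. Qed.

Lemma homog_lin d (a : R) x y : homog d x -> homog d y -> homog d (gadd (gscale a x) y).
Proof.
move=> hx hy; split; rewrite /gadd /gscale.
- by move=> m vs ws ne; rewrite (homog_deg hx) // (homog_deg hy) // mulr0 addr0.
- by move=> m vs1 vs2 ws k u v; rewrite (homog_lin1 hx) (homog_lin1 hy); ring.
- by move=> m vs1 vs2 ws k u v; rewrite (homog_lin2 hx) (homog_lin2 hy); ring.
- by move=> m vs1 vs2 ws v; rewrite (homog_alt hx) (homog_alt hy) mulr0 addr0.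
- by move=> m vs ws1 ws2 u v; rewrite (homog_sym hx) (homog_sym hy).
- move=> k l q beta Gq Gb; apply: smoothD; last exact: homog_smooth hy _ _ _ _ Gq Gb.
  by apply: smoothM; [exact: smooth_cst|exact: homog_smooth hx _ _ _ _ Gq Gb].
Qed.

Lemma homog_gscale d (a : R) x : homog d x -> homog d (gscale a x).
Proof.
move=> hx; rewrite (_ : gscale a x = gadd (gscale a x) g0).
  by apply: homog_lin => //; exact: homog_gzero.
by apply: gfun_ext => m vs ws; rewrite /gadd /gzero addr0.
Qed.

Lemma homog_gadd d x y : homog d x -> homog d y -> homog d (gadd x y).
Proof. by move=> hx hy; rewrite -[x]gscale1; exact: homog_lin. Qed.

Lemma homog_of_fun f : smooth f -> homog 0 (of_fun f : gf).
Proof.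
move=> sf; split.
- by move=> m [|v vs] [|w ws].
- by move=> m [|? ?] vs2 ws a u v; rewrite /= mulr0 addr0.
- by move=> m [|? ?] [|? ?] ws2 a u v; rewrite /= mulr0 addr0.
- by move=> m [|? ?].
- by move=> m [|? ?] [|? ?].
- move=> k l q beta Gq Gb; apply: (smooth_gf_homog (x := of_fun f)) => // -[|? ?] [|? ?] ? ? //=; exact: smooth_cst.
Qed.

Lemma homog_of_Qd t : Gamd t -> homog 1 (of_Qd t : gf).
Proof.
move=> st; split; rewrite /of_Qd /of_covec.
- by move=> m [|v [|? ?]] [|w ws].
- move=> m [|? [|? ?]] [|? ?] [|? ?] a u v; rewrite /= ?mulr0 ?addr0 //.
  by rewrite linearP.
- by move=> m [|? [|? ?]] [|? ?] ws2 a u v; rewrite /= mulr0 addr0.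
- by move=> m [|? [|? ?]].
- by move=> m [|? [|? ?]] [|? ?].
- move=> k l q beta Gq Gb; apply: (smooth_gf_homog (x := of_Qd t)) => // -[|? [|? ?]] [|? ?] aq ? //=; try exact: smooth_cst.
  exact: pairing_smooth st (aq 0%N).
Qed.

Lemma homog_of_B b : Gam b -> homog 2 (of_B b : gf).
Proof.
move=> sb; split; rewrite /of_B /of_vec.
- by move=> m [|? ?] [|? [|? ?]] //; rewrite /= ?muln1.
- by move=> m [|? ?] vs2 ws a u v; rewrite /= mulr0 addr0.
- move=> m [|? ?] [|? [|? ?]] [|? ?] a u v; rewrite /= ?mulr0 ?addr0 //.
  by rewrite add_lfunE scale_lfunE.
- by move=> m [|? ?].
- by move=> m [|? ?] [|? [|? ?]].
- move=> k l q beta Gq Gb; apply: (smooth_gf_homog (x := of_B b)) => // -[|? ?] [|? [|? ?]] ? ab //=; try exact: smooth_cst.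
  exact: pairing_smooth (ab 0%N) sb.
Qed.

Definition i_Q q x : gf := fun m => d_tau (q m) (x m).
Definition i_B (beta : sec (bdual B)) x : gf := fun m => d_b (beta m) (x m).

(** For d = 0 the truncated predecessor is harmless, the contraction being zero. The same holds for
    [d - 2] in [homog_i_B]. *)
Lemma homog_i_Q d q x : Gam q -> homog d x -> homog d.-1 (i_Q q x).
Proof.
move=> Gq hx; split; rewrite /i_Q /d_tau.
- move=> m vs ws ne; apply: (homog_deg hx); move: ne.
  rewrite -[size (_ :: vs)]/((size vs).+1); case: (d) => [|d'] //=; lia.
- by move=> m vs1; exact: (homog_lin1 hx (_ :: vs1)).
- by move=> m vs; exact: (homog_lin2 hx (_ :: vs)).
- by move=> m vs1; exact: (homog_alt hx (_ :: vs1)).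
- by move=> m vs; exact: (homog_sym hx (_ :: vs)).
- move=> k l qs beta Gqs Gb; apply: (smooth_gf_homog (x := i_Q q x)) => //.
  by apply: smooth_gf_cons => //; exact: homog_smooth_gf hx.
Qed.

Lemma homog_i_B d (beta : sec (bdual B)) x : Gamd beta -> homog d x -> homog (d - 2) (i_B beta x).
Proof.
move=> Gq hx; split; rewrite /i_B /d_b.
- by move=> m vs ws ne; apply: (homog_deg hx); move: ne; rewrite -[size (_ :: ws)]/((size ws).+1); lia.
- by move=> m vs1 vs2 ws; exact: (homog_lin1 hx).
- by move=> m vs ws1; exact: (homog_lin2 hx vs (_ :: ws1)).
- by move=> m vs1 vs2 ws; exact: (homog_alt hx).
- by move=> m vs ws1; exact: (homog_sym hx vs (_ :: ws1)).
- move=> k l qs bs Gqs Gb; apply: (smooth_gf_homog (x := i_B beta x)) => //.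
  by apply: smooth_gf_bcons => //; exact: homog_smooth_gf hx.
Qed.

End GradedFunctions.

Arguments i_Q {R n rQ rB M Q B} q x m vs ws.
Arguments i_B {R n rQ rB M Q B} beta x m vs ws.

(** * Local derivations *)

Section Derivations.
Context {R : realType} {n rQ rB : nat} {M : manifold R n}.
Context {Q : vbundle M rQ} {B : vbundle M rB}.
Notation gf := (gfun Q B).
Notation g0 := (@gzero R n rQ rB M Q B).
Implicit Types (x y z : gf) (m : M) (f : M -> R) (t : sec (bdual Q)) (b : sec B) (q : sec Q).

Lemma local_frames_at m : exists (c : atlas M) (U : set M) (q : 'I_rQ -> sec Q)
    (tau : 'I_rQ -> sec (bdual Q)) (beta : 'I_rB -> sec (bdual B)) (b : 'I_rB -> sec B),
  [/\ open U, U m, U `<=` dom c & local_frames U q tau beta b].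
Proof.
have [c cm] := dom_cover m.
have [U [q [tau [oU Um Gq Gt dQ]]]] := frames_at Q m.
have [V [b [beta [oV Vm Gb Gbt dB]]]] := frames_at B m.
exists c, (dom c `&` (U `&` V)), q, tau, beta, b; split.
- by apply: openI; [exact: dom_open|exact: openI].
- by [].
- by move=> x [].
- split=> //; first by move=> x i j [_ [Ux _]]; exact: dQ.
  by move=> x i j [_ [_ Vx]]; exact: dB.
Qed.

Section InFrame.
Variables (U : set M) (q : 'I_rQ -> sec Q) (tau : 'I_rQ -> sec (bdual Q)).
Variables (beta : 'I_rB -> sec (bdual B)) (b : 'I_rB -> sec B).
Hypothesis lf : local_frames U q tau beta b.

Lemma lf_vQ m (v : Q m) : U m -> v = \sum_i tau i m v *: q i m.
Proof. by move=> Um; have [e _] := dual_expand (fun i j => lf_dualQ lf i j Um); exact: e. Qed.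

Lemma lf_vB m (v : B m) : U m -> v = \sum_i beta i m v *: b i m.
Proof. by move=> Um; have [e _] := dual_expand (fun i j => lf_dualB lf i j Um); exact: e. Qed.

Lemma lf_tB m (s : bdual B m) : U m -> s = \sum_i s (b i m) *: beta i m.
Proof. by move=> Um; have [_ e] := dual_expand (fun i j => lf_dualB lf i j Um); exact: e. Qed.

(** An odd argument counts once and an even one twice, and wherever x is nonzero the counts add up
    to d. *)
Lemma euler d x m vs ws : homog d x -> U m ->
  d%:R * x m vs ws = \sum_i gmul (of_Qd (tau i)) (i_Q (q i) x) m vs ws +
    2 * \sum_l gmul (of_B (b l)) (i_B (beta l) x) m vs ws.
Proof.
move=> hx Um.
have -> := euler_odd (fun v => lf_vQ v Um) vs ws (homog_lin_odd (m := m) hx) (homog_alt_odd (m := m) hx).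
have -> := euler_even (fun v => lf_tB v Um) vs ws (homog_lin_even (m := m) hx) (homog_sym_even (m := m) hx).
have [<-|ne] := eqVneq (size vs + 2 * size ws)%N d.
  by rewrite natrD natrM; ring.
by rewrite (homog_deg hx) // !mulr0 addr0.
Qed.

End InFrame.

(* With [P] set, [hom P k] is the space of k-forms, i.e. functions of degree k
   that do not involve the generators of degree 2. *)
Definition hom (P : bool) k x := homog k x /\ (P -> forall m vs w ws, x m vs (w :: ws) = 0).

Lemma hom_lin P k (a : R) x y : hom P k x -> hom P k y -> hom P k (gadd (gscale a x) y).
Proof.
move=> [hx px] [hy py]; split; first exact: homog_lin.
by move=> PP m vs w ws; rewrite /gadd /gscale px // py // mulr0 addr0.
Qed.

Lemma hom0 P k : hom P k g0.
Proof. by split=> //; exact: homog_gzero. Qed.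

Lemma hom_gscale P k (a : R) x : hom P k x -> hom P k (gscale a x).
Proof.
move=> [hx px]; split; first exact: homog_gscale.
by move=> PP m vs w ws; rewrite /gscale px // mulr0.
Qed.

Lemma hom_gadd P k x y : hom P k x -> hom P k y -> hom P k (gadd x y).
Proof. by move=> hx hy; rewrite -[x]gscale1; exact: hom_lin. Qed.

Lemma hom_fmul P k f x : smooth f -> hom P k x -> hom P k (gmul (of_fun f) x).
Proof.
move=> sf [hx px]; split; first exact: (homog_gmul (homog_of_fun sf) hx).
by move=> PP m vs w ws; rewrite /gmul gr_mul_fun px // mulr0.
Qed.

Lemma hom_tmul P k t x : Gamd t -> hom P k x -> hom P k.+1 (gmul (of_Qd t) x).
Proof.
move=> st [hx px]; split; first exact: (homog_gmul (homog_of_Qd st) hx).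
move=> PP m vs w ws.
have H (g : gfib Q B m) : (forall us xs, g us (w :: xs) = 0) -> gr_mul (of_covec (t m)) g vs (w :: ws) = 0.
  elim: vs g => [|v vs IH] g gz; first by rewrite gr_mul_covec_nil.
  by rewrite gr_mul_covec_cons gz mulr0 IH ?subrr.
by apply: H => us xs; exact: px.
Qed.

Lemma hom_i_Q P k q x : Gam q -> hom P k x -> hom P k.-1 (i_Q q x).
Proof.
move=> Gq [hx px]; split; first exact: homog_i_Q.
by move=> PP m vs w ws; rewrite /i_Q /d_tau px.
Qed.

Definition gsum I (r : seq I) (F : I -> gf) : gf := fun m vs ws => \sum_(i <- r) F i m vs ws.

Arguments gsum {I} r F m vs ws.

Lemma gsum_nil I (F : I -> gf) : gsum [::] F = g0.
Proof. by apply: gfun_ext => m vs ws; rewrite /gsum big_nil. Qed.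

Lemma gsum_cons I (i : I) r (F : I -> gf) : gsum (i :: r) F = gadd (gscale 1 (F i)) (gsum r F).
Proof. by rewrite gscale1; apply: gfun_ext => m vs ws; rewrite /gsum big_cons. Qed.

Lemma hom_gsum P k I (r : seq I) (F : I -> gf) : (forall i, hom P k (F i)) -> hom P k (gsum r F).
Proof.
move=> hF; elim: r => [|i r IH]; first by rewrite gsum_nil; exact: hom0.
by rewrite gsum_cons; exact: hom_lin.
Qed.

(** The Leibniz rule is asked for products with a generator on the left, the shape in which [euler]
    presents a function; p gives the parity of L. With P set, L is a derivation on the algebra of
    forms, with values in all functions. *)
Record der (P : bool) (p : nat) (L : gf -> gf) : Prop := {
  der_lin : forall k (a : R) x y, hom P k x -> hom P k y ->
    L (gadd (gscale a x) y) = gadd (gscale a (L x)) (L y);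
  der_f : forall k f x, smooth f -> hom P k x ->
    L (gmul (of_fun f) x) = gadd (gmul (L (of_fun f)) x) (gmul (of_fun f) (L x));
  der_t : forall k t x, Gamd t -> hom P k x ->
    L (gmul (of_Qd t) x) = gadd (gmul (L (of_Qd t)) x) (gscale ((-1) ^+ p) (gmul (of_Qd t) (L x)));
  der_b : ~~ P -> forall k b x, Gam b -> hom P k x ->
    L (gmul (of_B b) x) = gadd (gmul (L (of_B b)) x) (gmul (of_B b) (L x)) }.

Section Der.
Variables (P : bool) (p : nat) (L : gf -> gf).
Arguments L : clear implicits.
Hypothesis hL : der P p L.

Lemma der0 : L g0 = g0.
Proof.
have := der_lin hL (-1) (hom0 P 0) (hom0 P 0).
have -> : gadd (gscale (-1) g0) g0 = g0 by apply: gfun_ext => m vs ws; rewrite /gadd /gscale mulr0 addr0.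
move=> ->; apply: gfun_ext => m vs ws; rewrite /gadd /gscale /gzero; ring.
Qed.

Lemma derZ k a x : hom P k x -> L (gscale a x) = gscale a (L x).
Proof.
move=> hx; have E z : gscale a z = gadd (gscale a z) g0.
  by apply: gfun_ext => m vs ws; rewrite /gadd /gzero addr0.
by rewrite E (der_lin hL a hx (hom0 P k)) der0 -E.
Qed.

Lemma derD k x y : hom P k x -> hom P k y -> L (gadd x y) = gadd (L x) (L y).
Proof. by move=> hx hy; rewrite -{1}[x]gscale1 (der_lin hL 1 hx hy) gscale1. Qed.

Lemma der_gsum k I (r : seq I) (F : I -> gf) : (forall i, hom P k (F i)) ->
  L (gsum r F) = gsum r (fun i => L (F i)).
Proof.
move=> hF; elim: r => [|i r IH]; first by rewrite !gsum_nil der0.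
by rewrite !gsum_cons (der_lin hL 1 (hF i) (hom_gsum r hF)) IH.
Qed.

(** Write x = (1 - chi) x with chi = 1 at m. Both terms of L((1 - chi) x) vanish at m: one contains
    x, the other 1 - chi. *)
Lemma der_local0 k x U m vs ws : hom P k x -> open U -> U m ->
  (forall m', U m' -> forall us xs, x m' us xs = 0) -> L x m vs ws = 0.
Proof.
move=> hx oU Um x0; have [chi [W [Z [schi [_ Wm _] chi1 _ [chi0 cov]]]]] := bump_exists oU Um.
have s1 : smooth (fun u => 1 - chi u) by apply: smoothB => //; exact: smooth_cst.
have E : gmul (of_fun (fun u => 1 - chi u)) x = x.
  apply: gfun_ext => m' us xs; rewrite /gmul gr_mul_fun.
  by case: (cov m') => [/x0 ->|/chi0 ->]; rewrite ?mulr0 // subr0 mul1r.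
rewrite -[X in L X]E (der_f hL s1 hx) /gadd /gmul gr_mul_fun chi1 // subrr mul0r addr0.
rewrite (@eq_gr_mul _ _ _ _ (L (of_fun (fun u => 1 - chi u)) m) (x m) (fun _ _ => 0)) ?gr_mul0r //.
by move=> us xs; exact: x0.
Qed.

Lemma der_eq_near k x y U m vs ws : hom P k x -> hom P k y -> open U -> U m ->
  (forall m', U m' -> forall us xs, x m' us xs = y m' us xs) -> L x m vs ws = L y m vs ws.
Proof.
move=> hx hy oU Um xy; apply/eqP; rewrite -subr_eq0; apply/eqP.
have hxy := hom_gadd hx (hom_gscale (-1) hy).
have := @der_local0 _ _ U m vs ws hxy oU Um.
rewrite (derD hx (hom_gscale (-1) hy)) (derZ _ hy) /gadd /gscale mulN1r; apply.
by move=> m' Um' us xs; rewrite xy // mulN1r subrr.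
Qed.

Section InFrame.
Variables (U : set M) (q : 'I_rQ -> sec Q) (tau : 'I_rQ -> sec (bdual Q)).
Variables (beta : 'I_rB -> sec (bdual B)) (b : 'I_rB -> sec B).
Hypothesis lf : local_frames U q tau beta b.
Hypothesis oU : open U.

(** If k < 2, or if x is a form, contraction with [beta l] gives 0. This settles the cases in which
    the truncated degree k - 2 or the restriction to forms would get in the way. *)
Lemma hom_bterm k l x : hom P k x -> hom P k (gmul (of_B (b l)) (i_B (beta l) x)) /\
  (P || (k < 2)%N -> gmul (of_B (b l)) (i_B (beta l) x) = g0).
Proof.
move=> [hx px].
have Z : P || (k < 2)%N -> gmul (of_B (b l)) (i_B (beta l) x) = g0.
  move=> H; rewrite (_ : i_B _ _ = g0) ?gmul0r //.
  apply: gfun_ext => m vs ws; rewrite /i_B /d_b; case/orP: H => [/px -> //|k2].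
  by rewrite (homog_deg hx) //=; apply/eqP => E; move: k2; rewrite -E mulnS; lia.
split=> //; have [/Z -> |/norP[nP k2]] := boolP (P || (k < 2)%N); first exact: hom0.
split; last by rewrite (negbTE nP).
have -> : k = (2 + (k - 2))%N by lia.
exact: homog_gmul (homog_of_B (lf_b lf l)) (homog_i_B (lf_beta lf l) hx).
Qed.

(** Euler's identity holds over U only, so it is the locality of L that allows L to be applied to
    it. *)
Lemma der_euler k x m vs ws : hom P k x -> U m ->
  k%:R * L x m vs ws = \sum_i L (gmul (of_Qd (tau i)) (i_Q (q i) x)) m vs ws +
    2 * \sum_l L (gmul (of_B (b l)) (i_B (beta l) x)) m vs ws.
Proof.
case: k => [|k] hx Um.
  rewrite mul0r.
  have iz i : i_Q (q i) x = g0.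
    by apply: gfun_ext => m' us xs; rewrite /i_Q /d_tau (homog_deg hx.1).
  rewrite !big1 ?mulr0 ?addr0 // => i _.
    by have [_ ->] := hom_bterm i hx; rewrite ?orbT // der0.
  by rewrite iz gmul0r der0.
have hq i : hom P k.+1 (gmul (of_Qd (tau i)) (i_Q (q i) x)).
  by apply: hom_tmul (lf_tau lf i) (hom_i_Q (lf_q lf i) hx).
have hb l := (hom_bterm l hx).1.
have h1 := hom_gsum (index_enum _) hq; have h2 := hom_gsum (index_enum _) hb.
have h12 := hom_gadd h1 (hom_gscale 2 h2).
have -> : k.+1%:R * L x m vs ws = L (gscale k.+1%:R x) m vs ws by rewrite (derZ _ hx).
rewrite (der_eq_near vs ws (hom_gscale _ hx) h12 oU Um); last first.
  move=> m1 Um1 us xs; rewrite /gadd /gscale /gsum. exact: (euler lf us xs hx.1 Um1).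
by rewrite (derD h1 (hom_gscale 2 h2)) (derZ _ h2) (der_gsum _ hq) (der_gsum _ hb).
Qed.

End InFrame.

(** Strong induction on the degree: every term of [der_euler] is L of a generator times a
    contraction of lower degree, so both Leibniz terms vanish, and a positive degree is invertible
    in R. *)
Lemma der_vanish : (forall f, smooth f -> L (of_fun f) = g0) ->
  (forall t, Gamd t -> L (of_Qd t) = g0) -> (~~ P -> forall b, Gam b -> L (of_B b) = g0) ->
  forall k x, hom P k x -> L x = g0.
Proof.
move=> Lf Lt Lb k x hx; elim/ltn_ind: k x hx => -[|k] IH x hx.
  have sx : smooth (fun m => x m [::] [::]).
    apply: (homog_smooth_gf hx.1 (qs := [::]) (bs := [::])) => i; rewrite nth_nil.
    exact: sm_0 (Gam_module Q).
  exact: sm_0 (Gamd_module B).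
  rewrite -(Lf _ sx); congr L; apply: gfun_ext => m [|v vs] [|w ws] //=;
    by rewrite (homog_deg hx.1).
apply: gfun_ext => m vs ws.
have [c [U [q [tau [beta [b [oU Um _ lf]]]]]]] := local_frames_at m.
have := der_euler lf oU vs ws hx Um.
rewrite [X in _ = X + _]big1 => [|i _]; last first.
  rewrite (der_t hL (lf_tau lf i) (hom_i_Q (lf_q lf i) hx)) (Lt _ (lf_tau lf i)).
  rewrite (IH k (ltnSn k) _ (hom_i_Q (lf_q lf i) hx)) gmul0l gmul0r.
  by rewrite /gadd /gscale mulr0 addr0.
rewrite [X in _ = _ + 2 * X]big1 => [|l _]; last first.
  have [hb0 bz] := hom_bterm lf l hx.
  have [/bz -> |/norP[nP k2]] := boolP (P || (k.+1 < 2)%N); first by rewrite der0.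
  have hib : hom P (k.+1 - 2) (i_B (beta l) x).
    by split; [exact: homog_i_B (lf_beta lf l) hx.1|rewrite (negbTE nP)].
  rewrite (der_b hL nP (lf_b lf l) hib) (Lb nP _ (lf_b lf l)) gmul0l.
  by rewrite (IH (k.+1 - 2)%N _ _ hib) ?gmul0r /gadd /gzero ?addr0 //; lia.
rewrite mulr0 addr0 => /eqP; rewrite mulf_eq0 pnatr_eq0 /= => /eqP; exact.
Qed.

End Der.

Lemma der_sub P p L L' : der P p L -> der P p L' ->
  der P p (fun x => gadd (L x) (gscale (-1) (L' x))).
Proof.
move=> dL dL'; split.
- move=> k a x y hx hy; rewrite (der_lin dL a hx hy) (der_lin dL' a hx hy).
  by apply: gfun_ext => m vs ws; rewrite /gadd /gscale; ring.
- move=> k f x sf hx; rewrite (der_f dL sf hx) (der_f dL' sf hx) !gmulDl !gmulDr !gmulZl !gmulZr.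
  by apply: gfun_ext => m vs ws; rewrite /gadd /gscale; ring.
- move=> k t x st hx; rewrite (der_t dL st hx) (der_t dL' st hx) !gmulDl !gmulDr !gmulZl !gmulZr.
  by apply: gfun_ext => m vs ws; rewrite /gadd /gscale; ring.
- move=> nP k b x sb hx; rewrite (der_b dL nP sb hx) (der_b dL' nP sb hx) !gmulDl !gmulDr !gmulZl !gmulZr.
  by apply: gfun_ext => m vs ws; rewrite /gadd /gscale; ring.
Qed.

Lemma der_unique P p L L' : der P p L -> der P p L' ->
  (forall f, smooth f -> L (of_fun f) = L' (of_fun f)) ->
  (forall t, Gamd t -> L (of_Qd t) = L' (of_Qd t)) ->
  (~~ P -> forall b, Gam b -> L (of_B b) = L' (of_B b)) ->
  forall k x, hom P k x -> L x = L' x.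
Proof.
move=> dL dL' Ef Et Eb k x hx.
have Z z : gadd z (gscale (-1) z) = g0.
  by apply: gfun_ext => m vs ws; rewrite /gadd /gscale mulN1r subrr.
have H : gadd (L x) (gscale (-1) (L' x)) = g0.
  by apply: (der_vanish (der_sub dL dL') _ _ _ hx) => [f sf|t st|nP b sb]; rewrite ?Ef ?Et ?Eb.
apply: gfun_ext => m vs ws; have := congr1 (fun z : gf => z m vs ws) H.
by rewrite /gadd /gscale mulN1r => /subr0_eq.
Qed.

End Derivations.

Arguments gsum {R n rQ rB M Q B I} r F m vs ws.

(** * Sums of symmetric families over increasing indices *)

Section IndexSums.
Context {R : realType} {r : nat}.

Lemma sum_lt2 (F : 'I_r -> 'I_r -> R) : (forall i j, F i j = F j i) -> (forall i, F i i = 0) ->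
  \sum_i \sum_j F i j = 2 * \sum_(j < r) \sum_(i < r | (i < j)%N) F i j.
Proof.
move=> sF dF.
pose S := \sum_(i < r) \sum_(j < r) (i < j)%N%:R * F i j.
have -> : \sum_(j < r) \sum_(i < r | (i < j)%N) F i j = S.
  rewrite /S exchange_big; apply: eq_bigr => j _; rewrite big_mkcond; apply: eq_bigr => i _.
  by case: ifP => _; rewrite ?mul1r ?mul0r.
have S' : S = \sum_(i < r) \sum_(j < r) (j < i)%N%:R * F i j.
  rewrite /S exchange_big; apply: eq_bigr => j _; apply: eq_bigr => i _; by rewrite sF.
rewrite mulr2n mulrDl mul1r {2}S' /S -big_split; apply: eq_bigr => i _ /=.
rewrite -big_split; apply: eq_bigr => j _ /=.
have [ij|ij|/val_inj ->] := ltngtP i j; rewrite ?dF ?mulr0 ?addr0 // mul1r mul0r ?addr0 ?add0r //.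
Qed.

(** The 3! orderings of three distinct indices contribute equally, and repeated indices contribute
    nothing. The sum over each ordering is written with an indicator, and the two transpositions
    identify these sums. *)
Lemma sum_lt3 (F : 'I_r -> 'I_r -> 'I_r -> R) :
  (forall i j k, F i j k = F j i k) -> (forall i j k, F i j k = F i k j) -> (forall i k, F i i k = 0) ->
  \sum_i \sum_j \sum_k F i j k =
  6 * \sum_(k < r) \sum_(j < r | (j < k)%N) \sum_(i < r | (i < j)%N) F i j k.
Proof.
move=> s1 s2 d1.
pose S (P : 'I_r -> 'I_r -> 'I_r -> bool) := \sum_i \sum_j \sum_k (P i j k)%:R * F i j k.
have -> : \sum_(k < r) \sum_(j < r | (j < k)%N) \sum_(i < r | (i < j)%N) F i j k =
    S (fun i j k => (i < j)%N && (j < k)%N).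
  rewrite /S; under [RHS]eq_bigr do rewrite exchange_big.
  rewrite [RHS]exchange_big; apply: eq_bigr => k _ /=.
  rewrite [RHS]exchange_big big_mkcond; apply: eq_bigr => j _ /=; case: ifP => jk.
    by rewrite big_mkcond; apply: eq_bigr => i _; case: ifP => _; rewrite ?mul1r ?mul0r.
  by rewrite big1 // => i _; rewrite andbF mul0r.
have x12 P : S P = S (fun i j k => P j i k).
  rewrite /S exchange_big; apply: eq_bigr => j _; apply: eq_bigr => i _; apply: eq_bigr => k _.
  by rewrite s1.
have x23 P : S P = S (fun i j k => P i k j).
  rewrite /S; apply: eq_bigr => i _; rewrite exchange_big; apply: eq_bigr => j _; apply: eq_bigr => k _.
  by rewrite s2.
pose P0 (i j k : 'I_r) := (i < j)%N && (j < k)%N.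
have e1 := x12 P0; have e2 := x23 P0; have e3 := x23 (fun i j k => P0 j i k).
have e4 := x12 (fun i j k => P0 i k j); have e5 := x12 (fun i j k => P0 k i j).
have e6 : S (fun i j k => P0 j i k) = S (fun i j k => P0 k i j) by rewrite x23.
have e7 : S (fun i j k => P0 i k j) = S (fun i j k => P0 j k i) by rewrite x12.
have e8 : S (fun i j k => P0 j k i) = S (fun i j k => P0 k j i) by rewrite x23.
transitivity (S P0 + S (fun i j k => P0 j i k) + S (fun i j k => P0 i k j) +
  S (fun i j k => P0 k i j) + S (fun i j k => P0 j k i) + S (fun i j k => P0 k j i)); last first.
  by rewrite -/(S P0) -e8 -e7 -e6 -e2 -e1; ring.
rewrite /S -!big_split; apply: eq_bigr => i _ /=; rewrite -!big_split; apply: eq_bigr => j _ /=.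
rewrite -!big_split; apply: eq_bigr => k _ /=; rewrite /P0 -!mulrDl.
have d2 i' k' : F i' k' k' = 0 by rewrite s1 s2 d1.
have d3 i' k' : F i' k' i' = 0 by rewrite s2 d1.
case: (ltngtP i j) => [ij|ij|/val_inj ->]; last by rewrite d1 mulr0.
  case: (ltngtP j k) => [jk|jk|/val_inj ->]; last by rewrite d2 mulr0.
    by case: (ltngtP i k) => [ik|ik|ik] /=; [ring|exfalso; lia|exfalso; lia].
  by case: (ltngtP i k) => [ik|ik|/val_inj ->] /=; [ring|ring|rewrite d3 mulr0].
case: (ltngtP j k) => [jk|jk|/val_inj ->]; last by rewrite d2 mulr0.
  by case: (ltngtP i k) => [ik|ik|/val_inj ->] /=; [ring|ring|rewrite d3 mulr0].
by case: (ltngtP i k) => [ik|ik|ik] /=; [exfalso; lia|ring|exfalso; lia].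
Qed.

End IndexSums.

(** * Dorfman 2-representations *)

Section Pairings.
Context {R : realType} {n r : nat} {M : manifold R n} {E : vbundle M r}.
Implicit Types (t : sec (bdual E)) (s : sec E).

Lemma pairingDl t t' s m : pairing (secD t t') s m = pairing t s m + pairing t' s m.
Proof. by rewrite /pairing /secD add_lfunE. Qed.

Lemma pairingZl (f : M -> R) t s m : pairing (secZ f t) s m = f m * pairing t s m.
Proof. by rewrite /pairing /secZ scale_lfunE. Qed.

Lemma pairingDr t s s' m : pairing t (secD s s') m = pairing t s m + pairing t s' m.
Proof. by rewrite /pairing /secD linearD. Qed.

Lemma pairingZr (f : M -> R) t s m : pairing t (secZ f s) m = f m * pairing t s m.
Proof. by rewrite /pairing /secZ linearZ. Qed.

Lemma pairingNr t s m : pairing t (secN s) m = - pairing t s m.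
Proof. by rewrite /pairing /secN linearN. Qed.

Lemma pairing_suml (I : Type) (l : seq I) (t : I -> sec (bdual E)) s m :
  pairing (fun x => \sum_(i <- l) t i x) s m = \sum_(i <- l) pairing (t i) s m.
Proof. by rewrite /pairing sum_lfunE. Qed.

Lemma along_cst (rho : anchor_map E) (hrho : is_anchor rho) s (a : R) m : along rho s (fun=> a) m = 0.
Proof. exact: anchor_cst. Qed.

End Pairings.

Section DorfmanTheory.
Context {R : realType} {n rQ rB : nat} {M : manifold R n}.
Context {Q : vbundle M rQ} {B : vbundle M rB}.
Variables (D : dorfman2 Q B) (hD : is_dorfman2 D).
Implicit Types (m : M) (f : M -> R) (t : sec (bdual Q)) (q : sec Q) (b : sec B) (beta : sec (bdual B)).

Let hrho := d2_anchor hD.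

Lemma dB_tensor beta : Gamd beta -> cinf_linear (@Gamd R n M rQ Q) (fun t => pairing beta (dBs D t)).
Proof.
move=> Gb; split=> [t Gt|m]; first exact: pairing_smooth Gb (d2_dB hD Gt).
split=> [s t _ _|f s _ _]; rewrite /pairing /dBs /secD /secZ; first by rewrite !linearD.
by rewrite !linearZ.
Qed.

Lemma dBtP beta : Gamd beta -> Gam (dBt D beta) /\
  forall t, Gamd t -> forall m, pairing t (dBt D beta) m = pairing beta (dBs D t) m.
Proof. by move=> Gb; exact: as_vectorP (dB_tensor Gb). Qed.

(** The term (rho(q1) f) <t, q2> arises twice, from the anchor and from [Delta_scaler]; it cancels
    in the difference, which is therefore C^oo-linear in t. The same cancellation underlies
    [dual_connP]. *)
Lemma dullP q1 q2 : Gam q1 -> Gam q2 -> Gam (dull D q1 q2) /\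
  forall t, Gamd t -> forall m, pairing t (dull D q1 q2) m =
    along (rhoQ D) q1 (pairing t q2) m - pairing (Delta D q1 t) q2 m.
Proof.
move=> G1 G2; apply: as_vectorP; have hDl := d2_Delta hD.
split=> [t Gt|m].
  apply: smoothB; first exact: (along_smooth hrho G1 (pairing_smooth Gt G2)).
  exact: (pairing_smooth (Delta_sec hDl G1 Gt) G2).
split=> [s t Gs Gt|f s sf Gs].
  rewrite (Delta_addr hDl) //.
  rewrite (funext (pairingDl _ _ _)) (alongD hrho); try exact: pairing_smooth.
  by rewrite pairingDl; ring.
rewrite (Delta_scaler hDl) // (funext (pairingZl _ _ _)).
rewrite (alongM hrho) //; last exact: pairing_smooth.
by rewrite pairingDl !pairingZl -[RHS]/(_ * _); ring.
Qed.

Lemma dual_connP q beta : Gam q -> Gamd beta -> Gamd (dual_conn (rhoQ D) (nabQB D) q beta) /\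
  forall b, Gam b -> forall m, pairing (dual_conn (rhoQ D) (nabQB D) q beta) b m =
    along (rhoQ D) q (pairing beta b) m - pairing beta (nabQB D q b) m.
Proof.
move=> Gq Gb; apply: as_covectorP; have hn := d2_nab hD.
split=> [s Gs|m].
  apply: smoothB; first exact: (along_smooth hrho Gq (pairing_smooth Gb Gs)).
  exact: (pairing_smooth Gb (conn_sec hn Gq Gs)).
split=> [s t Gs Gt|f s sf Gs].
  rewrite (conn_addr hn) //.
  rewrite (funext (pairingDr _ _ _)) (alongD hrho); try exact: pairing_smooth.
  by rewrite pairingDr; ring.
rewrite (conn_scaler hn) // (funext (pairingZr _ _ _)).
rewrite (alongM hrho) //; last exact: pairing_smooth.
by rewrite pairingDr !pairingZr -[RHS]/(_ * _); ring.
Qed.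

Lemma dull_Zl f q1 q2 t m : smooth f -> Gam q1 -> Gam q2 -> Gamd t ->
  pairing t (dull D (secZ f q1) q2) m =
  f m * pairing t (dull D q1 q2) m - along (rhoQ D) q2 f m * pairing t q1 m.
Proof.
move=> sf G1 G2 Gt; have hDl := d2_Delta hD.
have GZ := sm_Z (Gam_module Q) sf G1.
have [_ E] := dullP GZ G2; have [_ E1] := dullP G1 G2.
rewrite (E t Gt m) (E1 t Gt m) (Delta_scalel hDl) //.
have [Gc Ec] := codiffP hrho sf.
rewrite (tensorZ (along_tensor hrho m (pairing_smooth Gt G2)) sf G1).
rewrite pairingDl !pairingZl (Ec _ G2 m) -[X in X - _]/(_ * _); ring.
Qed.

Lemma dull_Dl q1 q1' q2 : Gam q1 -> Gam q1' -> Gam q2 ->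
  dull D (secD q1 q1') q2 = secD (dull D q1 q2) (dull D q1' q2).
Proof.
move=> G1 G1' G2; have hDl := d2_Delta hD.
have GD := sm_D (Gam_module Q) G1 G1'.
apply: Gam_eq => t Gt m; rewrite pairingDr.
have [_ E] := dullP GD G2; have [_ E1] := dullP G1 G2; have [_ E2] := dullP G1' G2.
rewrite (E t Gt m) (E1 t Gt m) (E2 t Gt m) (Delta_addl hDl) //.
by rewrite (tensorD (along_tensor hrho m (pairing_smooth Gt G2)) G1 G1') pairingDl; ring.
Qed.

Lemma dull_Dr q1 q2 q2' : Gam q1 -> Gam q2 -> Gam q2' ->
  dull D q1 (secD q2 q2') = secD (dull D q1 q2) (dull D q1 q2').
Proof.
move=> G1 G2 G2'; have GD := sm_D (Gam_module Q) G2 G2'.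
rewrite (d2_skew hD G1 GD) dull_Dl // (d2_skew hD G1 G2) (d2_skew hD G1 G2').
by apply: functional_extensionality_dep => m; rewrite /secN /secD opprD.
Qed.

Lemma dull_Zr f q1 q2 t m : smooth f -> Gam q1 -> Gam q2 -> Gamd t ->
  pairing t (dull D q1 (secZ f q2)) m =
  f m * pairing t (dull D q1 q2) m + along (rhoQ D) q1 f m * pairing t q2 m.
Proof.
move=> sf G1 G2 Gt; have GZ := sm_Z (Gam_module Q) sf G2.
by rewrite (d2_skew hD G1 GZ) (d2_skew hD G1 G2) !pairingNr (dull_Zl m sf G2 G1 Gt); ring.
Qed.

(** Constants have zero derivative along the anchor, so both Leibniz rules of the bracket reduce to
    linearity. *)
Lemma dull_cst r (k l : 'I_r -> R) (q1 q2 : 'I_r -> sec Q) (t : sec (bdual Q)) m :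
  (forall i, Gam (q1 i)) -> (forall i, Gam (q2 i)) -> Gamd t ->
  pairing t (dull D (fun x => \sum_i secZ (fun=> k i) (q1 i) x) (fun x => \sum_i secZ (fun=> l i) (q2 i) x)) m =
  \sum_i \sum_j k i * l j * pairing t (dull D (q1 i) (q2 j)) m.
Proof.
move=> G1 G2 Gt; have hG := Gam_module Q.
have Z1 i := sm_Z hG (smooth_cst (k i)) (G1 i); have Z2 i := sm_Z hG (smooth_cst (l i)) (G2 i).
have a0 (a : R) q : along (rhoQ D) q (fun=> a) m = 0 by exact: along_cst.
have big_secD (I : Type) (s : seq I) (F : I -> sec Q) i :
    (fun x => \sum_(i <- i :: s) F i x) = secD (F i) (fun x => \sum_(i <- s) F i x).
  by apply: functional_extensionality_dep => x; rewrite big_cons.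
have big_sec0 (I : Type) (F : I -> sec Q) : (fun x => \sum_(i <- [::]) F i x) = secZ (fun=> 0) (sec0 Q).
  by apply: functional_extensionality_dep => x; rewrite big_nil /secZ scale0r.
have Gs1 (s : seq 'I_r) : Gam (fun x => \sum_(i <- s) secZ (fun=> k i) (q1 i) x) by exact: sm_sum.
have Gs2 (s : seq 'I_r) : Gam (fun x => \sum_(i <- s) secZ (fun=> l i) (q2 i) x) by exact: sm_sum.
have G0 : Gam (sec0 Q) by exact: sm_0 hG.
have L2 q (s : seq 'I_r) : Gam q -> pairing t (dull D q (fun x => \sum_(i <- s) secZ (fun=> l i) (q2 i) x)) m =
    \sum_(j <- s) l j * pairing t (dull D q (q2 j)) m.
  move=> Gq; elim: s => [|j s IH].
    by rewrite [RHS]big_nil big_sec0 (dull_Zr m (smooth_cst 0) Gq G0 Gt) a0 !mul0r addr0.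
  rewrite [RHS]big_cons big_secD (dull_Dr Gq (Z2 j) (Gs2 s)) pairingDr IH.
  by rewrite (dull_Zr m (smooth_cst (l j)) Gq (G2 j) Gt) a0 mul0r addr0.
transitivity (\sum_i k i * pairing t (dull D (q1 i) (fun x => \sum_i secZ (fun=> l i) (q2 i) x)) m); last first.
  by apply: eq_bigr => i _; rewrite L2 // mulr_sumr; apply: eq_bigr => j _; rewrite mulrA.
elim: {1 3}(index_enum _) => [|i s IH].
  by rewrite [RHS]big_nil big_sec0 (dull_Zl m (smooth_cst 0) G0 (Gs2 _) Gt) a0 !mul0r subr0.
rewrite [RHS]big_cons big_secD (dull_Dl (Z1 i) (Gs1 s) (Gs2 _)) pairingDr IH.
by rewrite (dull_Zl m (smooth_cst (k i)) (G1 i) (Gs2 _) Gt) a0 mul0r subr0.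
Qed.

Lemma RQ_alt23 m (u v w : Q m) (c : B m) : RQ D u v c w = - RQ D u w c v.
Proof.
have [q1 G1 <-] := sec_through (Gam_module Q) u; have [q2 G2 <-] := sec_through (Gam_module Q) v.
have [q3 G3 <-] := sec_through (Gam_module Q) w; have [b Gb <-] := sec_through (Gam_module B) c.
exact: (d2_RQ_alt hD G1 G2 G3 Gb).
Qed.

Lemma RQ_alt12 m (u v w : Q m) (c : B m) : RQ D u v c w = - RQ D v u c w.
Proof. by rewrite (d2_RQ_skew hD) !opp_lfunE. Qed.

End DorfmanTheory.

Arguments d_x {R n rQ rB M Q B} c q tau beta b j xi m vs ws.

(** * The homological vector field on generators *)

Section VectorField.
Context {R : realType} {n rQ rB : nat} {M : manifold R n}.
Context {Q : vbundle M rQ} {B : vbundle M rB}.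
Notation gf := (gfun Q B).
Variables (QQ : gf -> gf) (hQQ : homological QQ).
Variables (D : dorfman2 Q B) (hD : is_dorfman2 D) (hQQD : encodes_vf QQ D).
Arguments QQ : clear implicits.
Implicit Types (xi : gf) (f : M -> R).

Let hrho := d2_anchor hD.

Lemma gr_mul_eq0r {V W : Type} (F g : seq V -> seq W -> R) vs ws :
  (forall us xs, g us xs = 0) -> gr_mul F g vs ws = 0.
Proof. by move=> gz; rewrite (@eq_gr_mul _ _ _ F F g (fun _ _ => 0)) ?gr_mul0r. Qed.

Lemma gr_mul_sumr {V W : Type} I (r : seq I) (F : seq V -> seq W -> R) (g : I -> seq V -> seq W -> R) vs ws :
  gr_mul F (fun us xs => \sum_(i <- r) g i us xs) vs ws = \sum_(i <- r) gr_mul F (g i) vs ws.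
Proof.
elim: r => [|i r IH].
  by rewrite big_nil gr_mul_eq0r // => us xs; rewrite big_nil.
by rewrite big_cons -IH -gr_mulDr; apply: eq_gr_mul => // us xs; rewrite big_cons.
Qed.

Lemma homog_ext1 (x y : gf) : homog 1 x -> homog 1 y ->
  (forall m v, x m [:: v] [::] = y m [:: v] [::]) -> x = y.
Proof.
move=> hx hy H; apply: gfun_ext => m vs ws.
have [|ne] := eqVneq (size vs + 2 * size ws)%N 1%N; last by rewrite (homog_deg hx) // (homog_deg hy).
case: vs => [|v [|v' vs]]; case: ws => [|w ws] => /=; rewrite ?mulnS //; lia.
Qed.

Lemma homog_ext2 (x y : gf) : homog 2 x -> homog 2 y ->
  (forall m v v', x m [:: v; v'] [::] = y m [:: v; v'] [::]) ->
  (forall m w, x m [::] [:: w] = y m [::] [:: w]) -> x = y.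
Proof.
move=> hx hy H H'; apply: gfun_ext => m vs ws.
have [|ne] := eqVneq (size vs + 2 * size ws)%N 2%N; last by rewrite (homog_deg hx) // (homog_deg hy).
case: vs => [|v [|v' [|v'' vs]]]; case: ws => [|w [|w' ws]] => /=; rewrite ?mulnS //; lia.
Qed.

Lemma homog_ext3 (x y : gf) : homog 3 x -> homog 3 y ->
  (forall m v v' v'', x m [:: v; v'; v''] [::] = y m [:: v; v'; v''] [::]) ->
  (forall m v w, x m [:: v] [:: w] = y m [:: v] [:: w]) -> x = y.
Proof.
move=> hx hy H H'; apply: gfun_ext => m vs ws.
have [|ne] := eqVneq (size vs + 2 * size ws)%N 3%N; last by rewrite (homog_deg hx) // (homog_deg hy).
case: vs => [|v [|v' [|v'' [|v''' vs]]]]; case: ws => [|w [|w' ws]] => /=; rewrite ?mulnS //; lia.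
Qed.

Section InFrame.
Variables (c : atlas M) (U : set M) (q : 'I_rQ -> sec Q) (tau : 'I_rQ -> sec (bdual Q)).
Variables (beta : 'I_rB -> sec (bdual B)) (b : 'I_rB -> sec B).
Hypothesis lf : local_frames U q tau beta b.
Hypotheses (oU : open U) (Uc : U `<=` dom c).
Variable m : M.
Hypothesis Um : U m.

(** The extension of a vector at m must have constant coefficients in the frame, because [d_x]
    differentiates coefficients and keeps the frame fixed. The same goes for [bt]. *)
Definition qt (v : Q m) : sec Q := fun x => \sum_i secZ (fun=> tau i m v) (q i) x.
Definition bt (w : bdual B m) : sec (bdual B) := fun x => \sum_i secZ (fun=> w (b i m)) (beta i) x.

Lemma Gam_qt v : Gam (qt v).
Proof.
apply: (sm_sum (Gam_module Q)) => i; apply: (sm_Z (Gam_module Q)); [exact: smooth_cst|exact: lf_q lf i].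
Qed.

Lemma Gamd_bt w : Gamd (bt w).
Proof.
apply: (sm_sum (Gamd_module B)) => i; apply: (sm_Z (Gamd_module B)); [exact: smooth_cst|exact: lf_beta lf i].
Qed.

Lemma qt_at v : qt v m = v.
Proof. exact/esym/(lf_vQ lf v Um). Qed.

Lemma bt_at w : bt w m = w.
Proof. exact/esym/(lf_tB lf w Um). Qed.

(** The derivative along [q i] of the coefficients of xi, the frame elements counting as
    constants. *)
Definition lie_frame xi i (us : seq (Q m)) (xs : seq (bdual B m)) : R :=
  rhoQ D (q i m) (fun x => xi x [seq qt v x | v <- us] [seq bt w x | w <- xs]).

Notation T i := (of_covec (tau i m) : gfib Q B m).

Lemma smooth_frame_coeff k xi us xs : homog k xi ->
  smooth (fun x => xi x [seq qt v x | v <- us] [seq bt w x | w <- xs]).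
Proof.
move=> hx; have := homog_smooth_gf hx (qs := map qt us) (bs := map bt xs).
have -> : (fun x => xi x [seq s x | s <- map qt us] [seq s x | s <- map bt xs]) =
    (fun x => xi x [seq qt v x | v <- us] [seq bt w x | w <- xs]).
  by apply/funext => x; rewrite -!map_comp.
apply=> i.
  have [iu|iu] := ltnP i (size us); last by rewrite nth_default ?size_map //; exact: sm_0 (Gam_module Q).
  by case: us iu => // u0 us iu; rewrite (nth_map u0) //; exact: Gam_qt.
have [iu|iu] := ltnP i (size xs); last by rewrite nth_default ?size_map //; exact: sm_0 (Gamd_module B).
by case: xs iu => // u0 xs iu; rewrite (nth_map u0) //; exact: Gamd_bt.
Qed.

(** By [anchor_chart] the sum over the coordinates of the chart is the tangent vector rho(q_i)
    itself, so the chart disappears from the formula. *)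
Lemma d_x_sum k xi vs ws : homog k xi ->
  \sum_i \sum_j rhoQ D (q i m) (fun x => chart c x 0 j) *
     gr_mul (T i) (d_x c q tau beta b j xi m) vs ws =
  \sum_i gr_mul (T i) (lie_frame xi i) vs ws.
Proof.
move=> hx; apply: eq_bigr => i _.
rewrite -[RHS](_ : gr_mul (T i) (fun us xs => \sum_j rhoQ D (q i m) (fun x => chart c x 0 j) *
    d_x c q tau beta b j xi m us xs) vs ws = _).
  by rewrite gr_mul_sumr; apply: eq_bigr => j _; rewrite gr_mulZr.
apply: eq_gr_mul => // us xs; rewrite /lie_frame.
rewrite (anchor_chart hrho (q i m) (Uc Um)) //.
exact: smooth_near_smooth (smooth_frame_coeff us xs hx).
Qed.

Lemma d_tau_sum (F X : gfib Q B m) v vs ws : lin_odd X ->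
  \sum_k tau k m v * gr_mul F (d_tau (q k m) X) vs ws = gr_mul F (d_tau v X) vs ws.
Proof.
move=> lX; rewrite (@eq_gr_mul _ _ _ F F (d_tau v X)
  (fun us xs => \sum_k tau k m v * d_tau (q k m) X us xs)) //.
  by rewrite gr_mul_sumr; apply: eq_bigr => k _; rewrite gr_mulZr.
by move=> us xs; rewrite /d_tau (odd_expand (fun v => lf_vQ lf v Um)).
Qed.

Lemma d_b_sum (F X : gfib Q B m) (w : bdual B m) vs ws : lin_even X ->
  \sum_k w (b k m) * gr_mul F (d_b (beta k m) X) vs ws = gr_mul F (d_b w X) vs ws.
Proof.
move=> lX; rewrite (@eq_gr_mul _ _ _ F F (d_b w X)
  (fun us xs => \sum_k w (b k m) * d_b (beta k m) X us xs)) //.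
  by rewrite gr_mul_sumr; apply: eq_bigr => k _; rewrite gr_mulZr.
by move=> us xs; rewrite /d_b (even_expand (fun v => lf_tB lf v Um)).
Qed.

Lemma QQ_formula k xi vs ws : homog k xi ->
  QQ xi m vs ws = \sum_i gr_mul (T i) (lie_frame xi i) vs ws
  - \sum_(j < rQ) \sum_(i < rQ | (i < j)%N)
       gr_mul (gr_mul (T i) (T j)) (d_tau (dull D (q i) (q j) m) (xi m)) vs ws
  + \sum_r gr_mul (of_vec (b r m)) (d_tau (dBt D (beta r) m) (xi m)) vs ws
  - \sum_(k < rQ) \sum_(j < rQ | (j < k)%N) \sum_(i < rQ | (i < j)%N) \sum_l
       omegaR D (q i) (q j) (q k) (b l) m *
       gr_mul (gr_mul (gr_mul (T i) (T j)) (T k)) (d_b (beta l m) (xi m)) vs ws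
  - \sum_i \sum_j gr_mul (gr_mul (T i) (of_vec (b j m)))
      (d_b (dual_conn (rhoQ D) (nabQB D) (q i) (beta j) m) (xi m)) vs ws.
Proof.
move=> hx; rewrite (hQQD oU Uc lf hx vs ws Um) (d_x_sum _ _ hx).
congr (_ - _ + _ - _ - _).
- apply: eq_bigr => j _; apply: eq_bigr => i _; exact: d_tau_sum (homog_lin_odd hx).
- apply: eq_bigr => j _; exact: d_tau_sum (homog_lin_odd hx).
- apply: eq_bigr => i _; apply: eq_bigr => j _; exact: d_b_sum (homog_lin_even hx).
Qed.

Lemma anchor_expand v f : smooth f -> \sum_i tau i m v * rhoQ D (q i m) f = rhoQ D v f.
Proof.
move=> sf; have H := along_tensor hrho m sf.
have := tensor_sum (Gam_module Q) H (index_enum _)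
  (fun i => sm_Z (Gam_module Q) (smooth_cst (tau i m v)) (lf_q lf i)).
rewrite -/(qt v) /along qt_at => ->; apply: eq_bigr => i _.
exact/esym/(tensorZ H (smooth_cst _) (lf_q lf i)).
Qed.

Lemma sum_alt2 (S : 'I_rQ -> 'I_rQ -> R) (v1 v2 : Q m) : (forall i j, S i j = - S j i) ->
  \sum_(j < rQ) \sum_(i < rQ | (i < j)%N) (tau i m v1 * tau j m v2 - tau i m v2 * tau j m v1) * S i j =
  \sum_i \sum_j tau i m v1 * tau j m v2 * S i j.
Proof.
move=> skS; pose F i j := (tau i m v1 * tau j m v2 - tau i m v2 * tau j m v1) * S i j.
have sF i j : F i j = F j i by rewrite /F skS; ring.
have S0 i : S i i = 0 by have := skS i i; lra.
have dF i : F i i = 0 by rewrite /F S0 mulr0.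
have half : forall x y : R, 2 * x = 2 * y -> x = y by move=> x y; lra.
apply: half; rewrite -(sum_lt2 sF dF) mulr2n mulrDl mul1r [X in _ = X + _]exchange_big -big_split.
apply: eq_bigr => i _ /=; rewrite -big_split; apply: eq_bigr => j _ /=.
by rewrite /F [S j i]skS; ring.
Qed.

Lemma dull_alt_sum t v1 v2 : Gamd t ->
  \sum_(j < rQ) \sum_(i < rQ | (i < j)%N)
     gr_mul (gr_mul (T i) (T j)) (d_tau (dull D (q i) (q j) m) (of_covec (t m))) [:: v1; v2] [::] =
  pairing t (dull D (qt v1) (qt v2)) m.
Proof.
move=> Gt; rewrite (dull_cst hD (fun i => tau i m v1) (fun i => tau i m v2) m (lf_q lf) (lf_q lf) Gt).
rewrite -(sum_alt2 _ _ (S := fun i j => pairing t (dull D (q i) (q j)) m)); last first.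
  by move=> i j; rewrite (d2_skew hD (lf_q lf i) (lf_q lf j)) pairingNr.
apply: eq_bigr => j _; apply: eq_bigr => i _.
rewrite gr_mul_scalar_r; last by split=> // -[].
by rewrite !gr_mul_covec_cons !gr_mul_covec_nil !subr0.
Qed.

End InFrame.

(** Matches the five sums of [QQ_formula] one at a time with the value expected of each. *)
Lemma five_terms (A A' F F' C C' E E' G G' : R) :
  A = A' -> F = F' -> C = C' -> E = E' -> G = G' -> A - F + C - E - G = A' - F' + C' - E' - G'.
Proof. by move=> -> -> -> -> ->. Qed.

Lemma QQ_fun f : smooth f -> QQ (of_fun f) = of_Qd (codiff (rhoQ D) f).
Proof.
move=> sf; have hf : homog 0 (of_fun f : gf) by exact: homog_of_fun.
have [Gc Ec] := codiffP hrho sf.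
have h1 := hvf_deg hQQ hf; have h2 : homog 1 (of_Qd (codiff (rhoQ D) f) : gf) by exact: homog_of_Qd.
apply: homog_ext1 h1 h2 _ => m v.
have [c [U [q [tau [beta [b [oU Um Uc lf]]]]]]] := local_frames_at (Q := Q) (B := B) m.
rewrite (QQ_formula lf oU Uc Um _ _ hf); transitivity (rhoQ D v f - 0 + 0 - 0 - 0); last first.
  have [s Gs sv] := sec_through (Gam_module Q) v.
  rewrite !subr0 addr0 -[RHS]/(codiff (rhoQ D) f m v) -sv.
  by have := Ec s Gs m; rewrite /pairing => ->.
apply: five_terms.
- rewrite -(anchor_expand lf Um v sf); apply: eq_bigr => i _.
  by rewrite gr_mul_covec_cons gr_mul_covec_nil subr0.
- by rewrite big1 // => j _; rewrite big1 // => i _; apply: gr_mul_eq0r.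
- by rewrite big1 // => r _; apply: gr_mul_eq0r.
- rewrite big1 // => k _; rewrite big1 // => j _; rewrite big1 // => i _; rewrite big1 // => l _.
  by rewrite gr_mul_eq0r ?mulr0 // => -[].
- by rewrite big1 // => i _; rewrite big1 // => j _; apply: gr_mul_eq0r => -[].
Qed.

Lemma QQ_Qd_B t m w : Gamd t -> QQ (of_Qd t) m [::] [:: w] = w (dB D m (t m)).
Proof.
move=> Gt; have ht : homog 1 (of_Qd t : gf) by exact: homog_of_Qd.
have [c [U [q [tau [beta [b [oU Um Uc lf]]]]]]] := local_frames_at (Q := Q) (B := B) m.
rewrite (QQ_formula lf oU Uc Um _ _ ht); transitivity (0 - 0 + w (dB D m (t m)) - 0 - 0); last first.
  by rewrite !subr0 add0r.
apply: five_terms.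
- by rewrite big1 // => i _; exact: gr_mul_covec_nil.
- rewrite big1 // => j _; rewrite big1 // => i _; rewrite gr_mul_scalar_r; last by split=> // -[].
  by rewrite gr_mul_covec_nil mul0r.
- rewrite [in RHS](lf_vB lf (dB D m (t m)) Um) linear_sum; apply: eq_bigr => r _.
  rewrite gr_mul_scalar_r; last by split=> // -[].
  rewrite linearZ /= [RHS]mulrC; congr (_ * _); have [_ H] := dBtP hD (lf_beta lf r); exact: (H t Gt m).
- rewrite big1 // => k _; rewrite big1 // => j _; rewrite big1 // => i _; rewrite big1 // => l _.
  by rewrite gr_mul_eq0r ?mulr0 // => -[|? []].
- by rewrite big1 // => i _; rewrite big1 // => j _; apply: gr_mul_eq0r => -[|? []].
Qed.

Definition koszul1 (t : sec (bdual Q)) (q1 q2 : sec Q) (m : M) : R :=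
  along (rhoQ D) q1 (pairing t q2) m - along (rhoQ D) q2 (pairing t q1) m - pairing t (dull D q1 q2) m.

Lemma koszul1_skew t q1 q2 m : Gam q1 -> Gam q2 -> koszul1 t q1 q2 m = - koszul1 t q2 q1 m.
Proof. by move=> G1 G2; rewrite /koszul1 (d2_skew hD G1 G2) pairingNr; ring. Qed.

Lemma koszul1_tensor t q2 m : Gamd t -> Gam q2 ->
  tensor_at (@Gam R n M rQ Q) m (fun q1 => koszul1 t q1 q2 m : R^o).
Proof.
move=> Gt G2; have H := along_tensor hrho m (pairing_smooth Gt G2); split=> [s s' Gs Gs'|f s sf Gs].
  rewrite /koszul1 (tensorD H Gs Gs') (funext (pairingDr _ _ _)) (alongD hrho); try exact: pairing_smooth.
  by rewrite (dull_Dl hD Gs Gs' G2) pairingDr; ring.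
rewrite /koszul1 (tensorZ H sf Gs) (funext (pairingZr _ _ _)) (alongM hrho) //; last exact: pairing_smooth.
rewrite (dull_Zl hD m sf Gs G2 Gt) -[X in X - _ - _]/(_ * _) -[RHS]/(_ * _); ring.
Qed.

Lemma koszul1_eq t q1 q1' q2 q2' m : Gamd t -> Gam q1 -> Gam q1' -> Gam q2 -> Gam q2' ->
  q1 m = q1' m -> q2 m = q2' m -> koszul1 t q1 q2 m = koszul1 t q1' q2' m.
Proof.
move=> Gt G1 G1' G2 G2' e1 e2.
rewrite (tensor_eq (Gam_module Q) (koszul1_tensor m Gt G2) G1 G1' e1) (koszul1_skew t m G1' G2).
by rewrite (tensor_eq (Gam_module Q) (koszul1_tensor m Gt G1') G2 G2' e2) -(koszul1_skew t m G1' G2').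
Qed.

Lemma QQ_Qd_QQ t m q1 q2 : Gamd t -> Gam q1 -> Gam q2 ->
  QQ (of_Qd t) m [:: q1 m; q2 m] [::] = koszul1 t q1 q2 m.
Proof.
move=> Gt G1 G2; have ht : homog 1 (of_Qd t : gf) by exact: homog_of_Qd.
have [c [U [q [tau [beta [b [oU Um Uc lf]]]]]]] := local_frames_at (Q := Q) (B := B) m.
set v1 := q1 m; set v2 := q2 m.
have G v := Gam_qt lf (m := m) v.
(* The right-hand side is C^oo-linear in both sections, so they may be exchanged for the
   constant-coefficient extensions to which [QQ_formula] refers. *)
rewrite (@koszul1_eq t q1 (qt q tau v1) q2 (qt q tau v2) m) ?(qt_at lf Um) // /koszul1.
rewrite (QQ_formula lf oU Uc Um _ _ ht); transitivity (
  (along (rhoQ D) (qt q tau v1) (pairing t (qt q tau v2)) m -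
   along (rhoQ D) (qt q tau v2) (pairing t (qt q tau v1)) m)
   - pairing t (dull D (qt q tau v1) (qt q tau v2)) m + 0 - 0 - 0); last first.
  by rewrite !subr0 addr0.
apply: five_terms.
- rewrite /along !(qt_at lf Um) -(anchor_expand lf Um v1) -?(anchor_expand lf Um v2); try exact: pairing_smooth.
  rewrite -sumrB; apply: eq_bigr => i _.
  by rewrite !gr_mul_covec_cons gr_mul_covec_nil subr0.
- exact: (dull_alt_sum lf v1 v2 Gt).
- by rewrite big1 // => r _; rewrite gr_mul_vec_cons gr_mul_eq0r.
- rewrite big1 // => k _; rewrite big1 // => j _; rewrite big1 // => i _; rewrite big1 // => l _.
  by rewrite gr_mul_eq0r ?mulr0 // => -[|? []].
- by rewrite big1 // => i _; rewrite big1 // => j _; apply: gr_mul_eq0r => -[|? []].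
Qed.

End VectorField.

(** * The vector field on sections of B and on 2-forms *)

Section VectorField2.
Context {R : realType} {n rQ rB : nat} {M : manifold R n}.
Context {Q : vbundle M rQ} {B : vbundle M rB}.
Notation gf := (gfun Q B).
Variables (QQ : gf -> gf) (hQQ : homological QQ).
Variables (D : dorfman2 Q B) (hD : is_dorfman2 D) (hQQD : encodes_vf QQ D).
Arguments QQ : clear implicits.
Implicit Types (xi : gf) (f : M -> R).

Let hrho := d2_anchor hD.

Lemma nabQB_tensor (s : sec (bdual B)) b m : Gamd s -> Gam b ->
  tensor_at (@Gam R n M rQ Q) m (fun q => pairing s (nabQB D q b) m : R^o).
Proof.
move=> Gs Gb; have hn := d2_nab hD; split=> [q q' Gq Gq'|f q sf Gq].
  by rewrite (conn_addl hn Gq Gq' Gb) pairingDr.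
by rewrite (conn_scalel hn sf Gq Gb) pairingZr.
Qed.

Lemma gr_mul_pure {V W : Type} (F g : seq V -> seq W -> R) vs w ws :
  (forall us x xs, F us (x :: xs) = 0) -> (forall us x xs, g us (x :: xs) = 0) ->
  gr_mul F g vs (w :: ws) = 0.
Proof.
elim: vs F g => [|v vs IH] F g F0 G0; last first.
  by rewrite gr_mul_cons !IH ?addr0 // => us x xs; rewrite /twist F0 mulr0.
rewrite /= (@eq_sym_mul _ _ _ (fun _ => 0) (g [::]) (g [::])) // sym_mul_scalar_l // mul0r add0r.
rewrite (@eq_sym_mul _ _ (F [::]) (F [::]) _ (fun _ => 0)) // sym_mul_scalar_r // mulr0 //.
Qed.

Lemma of_covec_pure m (s : bdual Q m) us x (xs : seq (bdual B m)) : of_covec s us (x :: xs) = 0.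
Proof. by case: us => [|? []]. Qed.

(** With w extended by constant coefficients, the anchor sum contributes rho(q) <w, b> and the sum
    with the dual connection removes rho(q) <w, b> - <w, nabla_q b>; the other three sums have no
    component of this type. *)
Lemma QQ_B_QB b q m w : Gam b -> Gam q -> QQ (of_B b) m [:: q m] [:: w] = w (nabQB D q b m).
Proof.
move=> Gb Gq; have hb : homog 2 (of_B b : gf) by exact: homog_of_B.
have [c [U [q' [tau [beta [b' [oU Um Uc lf]]]]]]] := local_frames_at (Q := Q) (B := B) m.
set v := q m; have Gw := Gamd_bt lf w; have Gv := Gam_qt lf v.
have wat := bt_at lf Um w.
have Tn := nabQB_tensor m Gw Gb.
have -> : w (nabQB D q b m) = pairing (bt beta b' w) (nabQB D (qt q' tau v) b) m.
  rewrite -(tensor_eq (Gam_module Q) Tn Gq Gv) ?(qt_at lf Um) //.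
  by rewrite /pairing wat.
rewrite (QQ_formula hD hQQD lf oU Uc Um _ _ hb).
pose S1 := \sum_i tau i m v * rhoQ D (q' i m) (pairing (bt beta b' w) b).
pose S2 := \sum_i tau i m v * (rhoQ D (q' i m) (pairing (bt beta b' w) b) -
   pairing (bt beta b' w) (nabQB D (q' i) b) m).
transitivity (S1 - 0 + 0 - 0 - S2); last first.
  rewrite !subr0 addr0 /S1 /S2 -sumrB /qt.
  rewrite (tensor_sum (Gam_module Q) Tn); last first.
    by move=> i; apply: (sm_Z (Gam_module Q)); [exact: smooth_cst|exact: lf_q lf i].
  apply: eq_bigr => i _; rewrite (tensorZ Tn (smooth_cst _) (lf_q lf i)).
  by rewrite -[RHS]/(_ * _); ring.
apply: five_terms.
- apply: eq_bigr => i _.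
  by rewrite gr_mul_covec_cons gr_mul_covec_nil subr0.
- by rewrite big1 // => j _; rewrite big1 // => i _; apply: gr_mul_eq0r.
- by rewrite big1 // => r _; apply: gr_mul_eq0r.
- rewrite big1 // => k _; rewrite big1 // => j _; rewrite big1 // => i _; rewrite big1 // => l _.
  rewrite gr_mul_scalar_r; last by split=> // x [].
  rewrite gr_mul_pure ?mul0r ?mulr0 //; last by move=> *; exact: of_covec_pure.
  by move=> us x xs; apply: gr_mul_pure => *; exact: of_covec_pure.
- apply: eq_bigr => i _.
  have hn := d2_nab hD; have Gn := conn_sec hn (lf_q lf i) Gb.
  transitivity (\sum_j tau i m v * (w (b' j m) * (rhoQ D (q' i m) (pairing (beta j) b) -
     pairing (beta j) (nabQB D (q' i) b) m))).
    apply: eq_bigr => j _.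
    rewrite gr_mul_scalar_r; last by split=> // x [].
    rewrite gr_mul_covec_cons gr_mul_covec_nil subr0 -mulrA; congr (_ * (_ * _)).
    have [_ H] := dual_connP hD (lf_q lf i) (lf_beta lf j); exact: (H b Gb m).
  rewrite -mulr_sumr; congr (_ * _).
  under eq_bigr do rewrite mulrBr; rewrite sumrB; congr (_ - _); last first.
    by rewrite /bt pairing_suml; apply: eq_bigr => j _; rewrite pairingZl.
  have -> : pairing (bt beta b' w) b = fun x => \sum_j w (b' j m) * pairing (beta j) b x.
    by apply/funext => x; rewrite /bt pairing_suml; apply: eq_bigr => j _; rewrite pairingZl.
  have sp j := pairing_smooth (lf_beta lf j) Gb.
  elim: (index_enum _) => [|j l IH].
    rewrite big_nil; under eq_fun do rewrite big_nil; by rewrite (anchor_cst hrho).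
  rewrite big_cons IH; under [in RHS]eq_fun do rewrite big_cons.
  rewrite (anchorD hrho); last 2 first.
  + by apply: smooth_near_smooth; apply: smoothM => //; exact: smooth_cst.
  + by apply: smooth_near_smooth; apply: smooth_sum => k; apply: smoothM => //; exact: smooth_cst.
  congr (_ + _); rewrite (anchorM hrho); try by apply: smooth_near_smooth; try exact: smooth_cst.
  by rewrite (anchor_cst hrho) mulr0 addr0.
Qed.

Lemma RQ_expand U q tau beta b m (v1 v2 v3 : Q m) (a : B m) :
  @local_frames R n rQ rB M Q B U q tau beta b -> U m ->
  \sum_i \sum_j \sum_k tau i m v1 * tau j m v2 * tau k m v3 * RQ D (q i m) (q j m) a (q k m) =
  RQ D v1 v2 a v3.
Proof.
move=> lf Um.
have L1 u u' w : RQ D u u' a w = \sum_k tau k m w * RQ D u u' a (q k m).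
  rewrite {1}(lf_vQ lf w Um) linear_sum; apply: eq_bigr => k _; by rewrite linearZ.
have L2 u u' w : RQ D u u' a w = \sum_j tau j m u' * RQ D u (q j m) a w.
  by rewrite (RQ_alt23 hD) L1 -sumrN; apply: eq_bigr => j _; rewrite -mulrN -(RQ_alt23 hD).
have L3 u u' w : RQ D u u' a w = \sum_i tau i m u * RQ D (q i m) u' a w.
  by rewrite (RQ_alt12 hD) L2 -sumrN; apply: eq_bigr => j _; rewrite -mulrN -(RQ_alt12 hD).
rewrite L3; apply: eq_bigr => i _; rewrite L2 mulr_sumr; apply: eq_bigr => j _.
by rewrite L1 !mulr_sumr; apply: eq_bigr => k _; rewrite !mulrA.
Qed.

Lemma QQ_B_QQQ b m v1 v2 v3 : Gam b ->
  QQ (of_B b) m [:: v1; v2; v3] [::] = - RQ D v1 v2 (b m) v3.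
Proof.
move=> Gb; have hb : homog 2 (of_B b : gf) by exact: homog_of_B.
have [c [U [q [tau [beta [b' [oU Um Uc lf]]]]]]] := local_frames_at (Q := Q) (B := B) m.
rewrite (QQ_formula hD hQQD lf oU Uc Um _ _ hb).
transitivity (0 - 0 + 0 - RQ D v1 v2 (b m) v3 - 0); last by ring.
apply: five_terms.
- rewrite big1 // => i _; rewrite !gr_mul_covec_cons gr_mul_covec_nil /lie_frame /= /of_B /of_vec.
  by rewrite !(anchor_cst hrho); ring.
- by rewrite big1 // => j _; rewrite big1 // => i _; apply: gr_mul_eq0r.
- by rewrite big1 // => r _; apply: gr_mul_eq0r.
- pose W i j k := RQ D (q i m) (q j m) (b m) (q k m).
  (* The value of tau_i tau_j tau_k on (v1, v2, v3), a 3 by 3 determinant. Its product with the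
     skew-symmetric W is symmetric, so the sum over i < j < k is one sixth of the full sum; the
     factor 6 is used up by the six terms of the determinant, which contribute equally. *)
  pose d i j k : R := tau i m v1 * tau j m v2 * tau k m v3 - tau i m v1 * tau j m v3 * tau k m v2
    - tau i m v2 * tau j m v1 * tau k m v3 + tau i m v2 * tau j m v3 * tau k m v1
    + tau i m v3 * tau j m v1 * tau k m v2 - tau i m v3 * tau j m v2 * tau k m v1.
  pose F i j k := d i j k * W i j k.
  have sF1 i j k : F i j k = F j i k by rewrite /F /W (RQ_alt12 hD) /d; ring.
  have sF2 i j k : F i j k = F i k j by rewrite /F /W (RQ_alt23 hD) /d; ring.
  have dF i k : F i i k = 0 by rewrite /F /d; ring.
  have six : forall x y : R, 6 * x = 6 * y -> x = y by move=> x y; lra.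
  apply: six; transitivity (6 * \sum_(k < rQ) \sum_(j < rQ | (j < k)%N) \sum_(i < rQ | (i < j)%N) F i j k).
    congr (_ * _); apply: eq_bigr => k _; apply: eq_bigr => j _; apply: eq_bigr => i _.
    transitivity (\sum_l d i j k * (beta l m (b m) * omegaR D (q i) (q j) (q k) (b' l) m)).
      apply: eq_bigr => l _; rewrite gr_mul_scalar_r; last by split=> // x [].
      rewrite !gr_mul_cons /twist /= /d /d_b /of_B /of_vec /of_covec; ring.
    rewrite -mulr_sumr /F /W; congr (_ * _); rewrite [in RHS](lf_vB lf (b m) Um) linear_sum sum_lfunE.
    by apply: eq_bigr => l _; rewrite linearZ scale_lfunE.
  rewrite -(sum_lt3 sF1 sF2 dF).
  have E x y z := RQ_expand x y z (b m) lf Um.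
  rewrite (_ : 6 * RQ D v1 v2 (b m) v3 = RQ D v1 v2 (b m) v3 - RQ D v1 v3 (b m) v2 - RQ D v2 v1 (b m) v3
    + RQ D v2 v3 (b m) v1 + RQ D v3 v1 (b m) v2 - RQ D v3 v2 (b m) v1); last first.
    have e132 := RQ_alt23 hD v1 v3 v2 (b m); have e213 := RQ_alt12 hD v2 v1 v3 (b m).
    have e231 := RQ_alt23 hD v2 v3 v1 (b m); have e312 := RQ_alt12 hD v3 v1 v2 (b m).
    have e321 := RQ_alt23 hD v3 v2 v1 (b m).
    by rewrite e321 e312 e231 e213 e132; ring.
  rewrite -!E -!sumrB -!big_split -sumrB; apply: eq_bigr => i _ /=.
  rewrite -!sumrB -!big_split -sumrB; apply: eq_bigr => j _ /=.
  rewrite -!sumrB -!big_split -sumrB; apply: eq_bigr => k _ /=.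
  by rewrite /F /d /W; ring.
- by rewrite big1 // => i _; rewrite big1 // => j _; rewrite gr_mul_scalar_r;
    [rewrite !gr_mul_covec_cons gr_mul_covec_nil /= /of_vec; ring|split=> // x []].
Qed.

Lemma dull_Zl_vec f q1 q2 m : smooth f -> Gam q1 -> Gam q2 ->
  dull D (secZ f q1) q2 m = f m *: dull D q1 q2 m - along (rhoQ D) q2 f m *: q1 m.
Proof.
move=> sf G1 G2; apply: vec_eq => s; have [t Gt <-] := sec_through (Gamd_module Q) s.
have := dull_Zl hD m sf G1 G2 Gt; rewrite /pairing => ->.
by rewrite linearB !linearZ.
Qed.

Definition ev2 (om : gf) (q1 q2 : sec Q) : M -> R := fun m => om m [:: q1 m; q2 m] [::].

Definition koszul2 (om : gf) (q1 q2 q3 : sec Q) (m : M) : R :=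
  along (rhoQ D) q1 (ev2 om q2 q3) m - along (rhoQ D) q2 (ev2 om q1 q3) m + along (rhoQ D) q3 (ev2 om q1 q2) m
  - ev2 om (dull D q1 q2) q3 m + ev2 om (dull D q1 q3) q2 m - ev2 om (dull D q2 q3) q1 m.

Section TwoForm.
Variable om : gf.
Arguments om : clear implicits.
Hypothesis hom2 : hom true 2 om.

Lemma ev2_smooth q1 q2 : Gam q1 -> Gam q2 -> smooth (ev2 om q1 q2).
Proof.
move=> G1 G2; have := homog_smooth_gf hom2.1 (qs := [:: q1; q2]) (bs := [::]); apply=> i.
  by case: i => [|[|i]] //=; rewrite nth_nil; exact: sm_0 (Gam_module Q).
rewrite nth_nil; exact: sm_0 (Gamd_module B).
Qed.

Lemma om_linl m (a : R) u v w : om m [:: a *: u + v; w] [::] = a * om m [:: u; w] [::] + om m [:: v; w] [::].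
Proof. exact: (homog_lin1 hom2.1 [::] [:: w]). Qed.

Lemma om_skew m u v : om m [:: u; v] [::] = - om m [:: v; u] [::].
Proof. exact: (alt_odd_skew (homog_lin_odd (m := m) hom2.1) (homog_alt_odd hom2.1)). Qed.

Lemma om_addl m u v w : om m [:: u + v; w] [::] = om m [:: u; w] [::] + om m [:: v; w] [::].
Proof. by have := om_linl 1 u v w; rewrite scale1r mul1r. Qed.

Lemma om_scalel m (a : R) u w : om m [:: a *: u; w] [::] = a * om m [:: u; w] [::].
Proof.
have z : om m [:: 0; w] [::] = 0.
  by have := om_linl (-1) 0 0 w; rewrite scaler0 addr0 mulN1r addNr.
by rewrite -[a *: u]addr0 om_linl z addr0.
Qed.

Lemma om_addr m u v w : om m [:: w; u + v] [::] = om m [:: w; u] [::] + om m [:: w; v] [::].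
Proof. by rewrite om_skew om_addl opprD -!om_skew. Qed.

Lemma om_scaler m (a : R) u w : om m [:: w; a *: u] [::] = a * om m [:: w; u] [::].
Proof. by rewrite om_skew om_scalel -mulrN -om_skew. Qed.

Lemma om_suml (I : Type) (r : seq I) m (F : I -> Q m) v :
  om m [:: \sum_(i <- r) F i; v] [::] = \sum_(i <- r) om m [:: F i; v] [::].
Proof.
elim: r => [|i r IH]; last by rewrite !big_cons om_addl IH.
by rewrite !big_nil -[0 in LHS](scale0r 0) om_scalel mul0r.
Qed.

Lemma ev2_skew q1 q2 : ev2 om q1 q2 = fun m => (-1) * ev2 om q2 q1 m.
Proof. by apply/funext => m; rewrite /ev2 om_skew mulN1r. Qed.

Lemma alongN_ev2 q q1 q2 m : Gam q1 -> Gam q2 ->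
  along (rhoQ D) q (ev2 om q1 q2) m = - along (rhoQ D) q (ev2 om q2 q1) m.
Proof.
move=> G1 G2; rewrite ev2_skew (alongM hrho); [|exact: smooth_cst|exact: ev2_smooth].
by rewrite /along (anchor_cst hrho) mulr0 addr0 mulN1r.
Qed.

Lemma koszul2_skew12 q1 q2 q3 m : Gam q1 -> Gam q2 -> Gam q3 ->
  koszul2 om q1 q2 q3 m = - koszul2 om q2 q1 q3 m.
Proof.
move=> G1 G2 G3; rewrite /koszul2 (alongN_ev2 q3 m G1 G2) (d2_skew hD G1 G2).
have -> : ev2 om (secN (dull D q2 q1)) q3 m = - ev2 om (dull D q2 q1) q3 m.
  by rewrite /ev2 /secN -scaleN1r om_scalel mulN1r.
by ring.
Qed.

Lemma koszul2_skew23 q1 q2 q3 m : Gam q1 -> Gam q2 -> Gam q3 ->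
  koszul2 om q1 q2 q3 m = - koszul2 om q1 q3 q2 m.
Proof.
move=> G1 G2 G3; rewrite /koszul2 (alongN_ev2 q1 m G2 G3) (d2_skew hD G2 G3).
have -> : ev2 om (secN (dull D q3 q2)) q1 m = - ev2 om (dull D q3 q2) q1 m.
  by rewrite /ev2 /secN -scaleN1r om_scalel mulN1r.
by ring.
Qed.

Lemma koszul2_tensor q2 q3 m : Gam q2 -> Gam q3 ->
  tensor_at (@Gam R n M rQ Q) m (fun q1 => koszul2 om q1 q2 q3 m : R^o).
Proof.
move=> G2 G3; have H := along_tensor hrho m (ev2_smooth G2 G3).
have eD s s' q : ev2 om (secD s s') q = fun x => ev2 om s q x + ev2 om s' q x.
  by apply/funext => x; rewrite /ev2 /secD om_addl.
have eZ f s q : ev2 om (secZ f s) q = fun x => f x * ev2 om s q x.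
  by apply/funext => x; rewrite /ev2 /secZ om_scalel.
split=> [s s' Gs Gs'|f s sf Gs].
  rewrite /koszul2 (tensorD H Gs Gs') !eD !(alongD hrho); try exact: ev2_smooth.
  rewrite !(dull_Dl hD) // !eD /ev2 /secD om_addr; ring.
rewrite /koszul2 (tensorZ H sf Gs) !eZ !(alongM hrho) //; try exact: ev2_smooth.
rewrite /ev2 !dull_Zl_vec // -!scaleNr !om_addl !om_scalel om_scaler.
rewrite -[X in X - _ + _ - _ + _ - _]/(_ * _) -[RHS]/(_ * _) /ev2.
by ring.
Qed.

(** C^oo-linearity is known in the first slot; skew-symmetry brings the other two there in turn. *)
Lemma koszul2_eq q1 q1' q2 q2' q3 q3' m : Gam q1 -> Gam q1' -> Gam q2 -> Gam q2' -> Gam q3 -> Gam q3' ->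
  q1 m = q1' m -> q2 m = q2' m -> q3 m = q3' m -> koszul2 om q1 q2 q3 m = koszul2 om q1' q2' q3' m.
Proof.
move=> G1 G1' G2 G2' G3 G3' e1 e2 e3; have hG := Gam_module Q.
rewrite (tensor_eq hG (koszul2_tensor m G2 G3) G1 G1' e1) (koszul2_skew12 m G1' G2 G3).
rewrite (tensor_eq hG (koszul2_tensor m G1' G3) G2 G2' e2) (koszul2_skew23 m G2' G1' G3).
rewrite (koszul2_skew12 m G2' G3 G1') (tensor_eq hG (koszul2_tensor m G2' G1') G3 G3' e3).
by rewrite -(koszul2_skew12 m G2' G3' G1') -(koszul2_skew23 m G2' G1' G3') -(koszul2_skew12 m G1' G2' G3').
Qed.

Lemma QQ_2form_QQQ q1 q2 q3 m : Gam q1 -> Gam q2 -> Gam q3 ->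
  QQ om m [:: q1 m; q2 m; q3 m] [::] = koszul2 om q1 q2 q3 m.
Proof.
move=> G1 G2 G3.
have [c [U [q [tau [beta [b [oU Um Uc lf]]]]]]] := local_frames_at (Q := Q) (B := B) m.
set v1 := q1 m; set v2 := q2 m; set v3 := q3 m.
have G v := Gam_qt lf (m := m) v.
rewrite (@koszul2_eq q1 (qt q tau v1) q2 (qt q tau v2) q3 (qt q tau v3) m) ?(qt_at lf Um) //.
rewrite (QQ_formula hD hQQD lf oU Uc Um _ _ hom2.1).
transitivity (
  (along (rhoQ D) (qt q tau v1) (ev2 om (qt q tau v2) (qt q tau v3)) m
   - along (rhoQ D) (qt q tau v2) (ev2 om (qt q tau v1) (qt q tau v3)) m
   + along (rhoQ D) (qt q tau v3) (ev2 om (qt q tau v1) (qt q tau v2)) m)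
  - (ev2 om (dull D (qt q tau v1) (qt q tau v2)) (qt q tau v3) m
     - ev2 om (dull D (qt q tau v1) (qt q tau v3)) (qt q tau v2) m
     + ev2 om (dull D (qt q tau v2) (qt q tau v3)) (qt q tau v1) m) + 0 - 0 - 0); last first.
  by rewrite /koszul2; ring.
apply: five_terms.
- rewrite /along !(qt_at lf Um).
  rewrite -(anchor_expand hD lf Um v1 (ev2_smooth (G v2) (G v3))).
  rewrite -(anchor_expand hD lf Um v2 (ev2_smooth (G v1) (G v3))).
  rewrite -(anchor_expand hD lf Um v3 (ev2_smooth (G v1) (G v2))).
  rewrite -sumrB -big_split; apply: eq_bigr => i _.
  by rewrite !gr_mul_covec_cons gr_mul_covec_nil subr0 /lie_frame /ev2 /=; ring.
- pose S w i j := om m [:: dull D (q i) (q j) m; w] [::].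
  have skS w i j : S w i j = - S w j i.
    by rewrite /S (d2_skew hD (lf_q lf i) (lf_q lf j)) /secN -scaleN1r om_scalel mulN1r.
  have ES v v' w : ev2 om (dull D (qt q tau v) (qt q tau v')) (qt q tau w) m =
      \sum_i \sum_j tau i m v * tau j m v' * S w i j.
    rewrite /ev2 (qt_at lf Um) (_ : dull D _ _ m =
      \sum_i \sum_j (tau i m v * tau j m v') *: dull D (q i) (q j) m).
      rewrite om_suml; apply: eq_bigr => k _; rewrite om_suml; apply: eq_bigr => j _.
      by rewrite om_scalel.
    apply: vec_eq => s; have [t Gt <-] := sec_through (Gamd_module Q) s.
    have := dull_cst hD (fun i => tau i m v) (fun i => tau i m v') m (lf_q lf) (lf_q lf) Gt.
    rewrite /pairing => ->; rewrite linear_sum; apply: eq_bigr => k _.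
    by rewrite linear_sum; apply: eq_bigr => j _; rewrite linearZ.
  rewrite !ES -!(sum_alt2 _ _ _ (skS _)) -sumrB -big_split; apply: eq_bigr => j _ /=.
  rewrite -sumrB -big_split; apply: eq_bigr => i _ /=.
  rewrite /d_tau /of_covec /S /=; ring.
- by rewrite big1 // => r _; rewrite !gr_mul_vec_cons gr_mul_vec_nil.
- rewrite big1 // => k _; rewrite big1 // => j _; rewrite big1 // => i _; rewrite big1 // => l _.
  by rewrite gr_mul_eq0r ?mulr0 // => us xs; rewrite /d_b hom2.2.
- by rewrite big1 // => i _; rewrite big1 // => j _; apply: gr_mul_eq0r => us xs; rewrite /d_b hom2.2.
Qed.

(** On a form only the [dBt] sum of the vector field creates a generator of degree 2. *)
Lemma QQ_2form_QB (bb : sec (bdual B)) m (v : Q m) : Gamd bb ->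
  QQ om m [:: v] [:: bb m] = om m [:: dBt D bb m; v] [::].
Proof.
move=> Gb.
have [c [U [q [tau [beta [b [oU Um Uc lf]]]]]]] := local_frames_at (Q := Q) (B := B) m.
set w := bb m; rewrite (QQ_formula hD hQQD lf oU Uc Um _ _ hom2.1).
transitivity (0 - 0 + om m [:: dBt D bb m; v] [::] - 0 - 0); last by ring.
apply: five_terms.
- rewrite big1 // => i _; rewrite gr_mul_covec_cons gr_mul_covec_nil /lie_frame /= subr0.
  rewrite (_ : (fun x => _) = fun=> 0); first by rewrite (anchor_cst hrho) mulr0.
  by apply/funext => x; rewrite hom2.2.
- rewrite big1 // => j _; rewrite big1 // => i _; apply: gr_mul_pure; last by move=> us x xs; rewrite /d_tau hom2.2.
  by move=> us x xs; apply: gr_mul_pure => *; exact: of_covec_pure.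
- have -> : dBt D bb m = \sum_r w (b r m) *: dBt D (beta r) m.
    apply: vec_eq => s; have [t Gt <-] := sec_through (Gamd_module Q) s.
    have [_ H] := dBtP hD Gb; have := H t Gt m; rewrite /pairing => ->.
    rewrite linear_sum /= -/w [in LHS](lf_tB lf w Um) sum_lfunE; apply: eq_bigr => r _.
    rewrite scale_lfunE linearZ /=; congr (_ * _).
    by have [_ H'] := dBtP hD (lf_beta lf r); have := H' t Gt m; rewrite /pairing => ->.
  rewrite om_suml; apply: eq_bigr => r _; rewrite om_scalel.
  by rewrite gr_mul_vec_cons gr_mul_vec_ncons gr_mul_vec_nil addr0.
- rewrite big1 // => k _; rewrite big1 // => j _; rewrite big1 // => i _; rewrite big1 // => l _.
  by rewrite gr_mul_eq0r ?mulr0 // => us xs; rewrite /d_b hom2.2.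
- by rewrite big1 // => i _; rewrite big1 // => j _; apply: gr_mul_eq0r => us xs; rewrite /d_b hom2.2.
Qed.

End TwoForm.
End VectorField2.

(** * The Poisson bracket on forms *)

Section Bracket.
Context {R : realType} {n rQ rB : nat} {M : manifold R n}.
Context {Q : vbundle M rQ} {B : vbundle M rB}.
Notation gf := (gfun Q B).
Notation g0 := (@gzero R n rQ rB M Q B).
Implicit Types (x y z om : gf) (m : M) (f : M -> R) (t : sec (bdual Q)) (b : sec B) (q : sec Q).

Lemma i_Q_lin q (a : R) x y : i_Q q (gadd (gscale a x) y) = gadd (gscale a (i_Q q x)) (i_Q q y).
Proof. by []. Qed.

Lemma i_Q_add q x y : i_Q q (gadd x y) = gadd (i_Q q x) (i_Q q y).
Proof. by []. Qed.

Lemma i_Q_scale q (a : R) x : i_Q q (gscale a x) = gscale a (i_Q q x).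
Proof. by []. Qed.

Lemma i_Q_fun q f : i_Q q (of_fun f) = g0.
Proof. by []. Qed.

Lemma i_Q_Qd q t : i_Q q (of_Qd t) = of_fun (pairing t q) :> gf.
Proof. by apply: gfun_ext => m [|? ?] [|? ?]. Qed.

Lemma i_Q_fmul q f x : i_Q q (gmul (of_fun f) x) = gmul (of_fun f) (i_Q q x).
Proof. by apply: gfun_ext => m vs ws; rewrite /i_Q /d_tau /gmul !gr_mul_fun. Qed.

Lemma i_Q_tmul q t x : i_Q q (gmul (of_Qd t) x) =
  gadd (gmul (of_fun (pairing t q)) x) (gscale (-1) (gmul (of_Qd t) (i_Q q x))).
Proof.
apply: gfun_ext => m vs ws.
by rewrite /i_Q /d_tau /gadd /gscale /gmul gr_mul_fun gr_mul_covec_cons mulN1r.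
Qed.

Lemma i_Q_der q : Gam q -> der true 1 (i_Q q : gf -> gf).
Proof.
move=> Gq; split=> //.
- move=> k f x sf hx; rewrite i_Q_fmul i_Q_fun gmul0l.
  by apply: gfun_ext => m vs ws; rewrite /gadd /gzero add0r.
- by move=> k t x Gt hx; rewrite i_Q_tmul i_Q_Qd expr1.
Qed.

Lemma der_pure p (L : gf -> gf) : der false p L -> der true p L.
Proof.
have hw k x : hom true k x -> hom false k x by move=> [hx _]; split.
move=> dL; split=> //.
- by move=> k a x y /hw hx /hw hy; exact: (der_lin dL a hx hy).
- by move=> k f x sf /hw hx; exact: (der_f dL sf hx).
- by move=> k t x Gt /hw hx; exact: (der_t dL Gt hx).
Qed.

Lemma gr_mul_covec_pure m (s : bdual Q m) (g : gfib Q B m) vs w ws :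
  (forall us, g us (w :: ws) = 0) -> gr_mul (of_covec s) g vs (w :: ws) = 0.
Proof.
elim: vs g => [|v vs IH] g gz; first by rewrite gr_mul_covec_nil.
by rewrite gr_mul_covec_cons gz mulr0 IH ?subrr.
Qed.

Lemma homog0E x : homog 0 x -> x = of_fun (fun m => x m [::] [::]).
Proof.
by move=> hx; apply: gfun_ext => m [|v vs] [|w ws] //=; rewrite (homog_deg hx).
Qed.

Lemma homog0_smooth x : homog 0 x -> smooth (fun m => x m [::] [::]).
Proof.
move=> hx; apply: (homog_smooth_gf hx (qs := [::]) (bs := [::])) => i; rewrite nth_nil.
  exact: sm_0 (Gam_module Q).
exact: sm_0 (Gamd_module B).
Qed.

(** Euler's identity reduces a form to products of some tau_i with a contraction; the Leibniz rule
    and induction on the degree then leave only products of forms. *)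
Lemma der_pres_pure p (L : gf -> gf) : der true p L ->
  (forall f m vs w ws, smooth f -> (L (of_fun f) : gf) m vs (w :: ws) = 0) ->
  (forall t m vs w ws, Gamd t -> (L (of_Qd t) : gf) m vs (w :: ws) = 0) ->
  forall k x, hom true k x -> forall m vs w ws, (L x : gf) m vs (w :: ws) = 0.
Proof.
move=> dL Lf Lt; elim=> [|k IH] x hx m vs w ws.
  by rewrite (homog0E hx.1) Lf //; exact: homog0_smooth hx.1.
have [c [U [q [tau [beta [b [oU Um _ lf]]]]]]] := local_frames_at (Q := Q) (B := B) m.
have := der_euler dL lf oU vs (w :: ws) hx Um.
rewrite [X in _ = X + _]big1 => [|i _]; last first.
  have hq := hom_i_Q (lf_q lf i) hx.
  rewrite (der_t dL (lf_tau lf i) hq) /gadd /gscale /gmul.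
  rewrite [X in _ + _ * X]gr_mul_covec_pure; last by move=> us; exact: IH hq _ _ _ _.
  rewrite mulr0 addr0; apply: gr_mul_pure => us y ys; first exact: Lt (lf_tau lf i).
  exact: hq.2.
rewrite [X in _ = _ + 2 * X]big1 => [|l _]; last by have [_ ->] := hom_bterm dL lf l hx; rewrite ?(der0 dL).
by rewrite mulr0 addr0 => /eqP; rewrite mulf_eq0 pnatr_eq0 /= => /eqP.
Qed.

Definition pure x : gf := fun m vs ws => if ws is [::] then x m vs [::] else 0.

Lemma hom_pure k x : homog k x -> hom true k (pure x).
Proof.
move=> hx; split=> //; split; rewrite /pure.
- by move=> m vs [|w ws] ne //; exact: (homog_deg hx).
- by move=> m vs1 vs2 [|w ws] a u v; [exact: (homog_lin1 hx)|rewrite mulr0 addr0].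
- by move=> m vs [|? ?] ws2 a u v; rewrite /= mulr0 addr0.
- by move=> m vs1 vs2 [|w ws] v //; exact: (homog_alt hx).
- by move=> m vs [|? ?] ws2 u v.
- move=> k' l q beta Gq Gb; apply: (smooth_gf_homog (x := pure x)) => // qs [|? ?] aq ab; last exact: smooth_cst.
  exact: (homog_smooth_gf hx aq ab).
Qed.

Variables (br : gf -> gf -> gf) (hbr : poisson br).
Variables (A : lie_algebroid B) (P : two_rep Q B).
Variables (hA : is_lie_algebroid A) (hP : is_self_dual A P) (hbrP : encodes_poisson br A P).
Arguments br : clear implicits.

Let hT := sd_two_rep hP.

Lemma br_der k x : homog k x -> der false k (br x).
Proof.
move=> hx; split.
- by move=> l a y z [hy _] [hz _]; exact: (br_linr hbr a hx hy hz).
- move=> l f y sf [hy _]; rewrite (br_leibniz hbr hx (homog_of_fun sf) hy).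
  by rewrite muln0 /gsign expr0 gscale1.
- by move=> l t y Gt [hy _]; rewrite (br_leibniz hbr hx (homog_of_Qd Gt) hy) muln1.
- move=> _ l b y Gb [hy _]; rewrite (br_leibniz hbr hx (homog_of_B Gb) hy).
  by rewrite /gsign mulnC exprM sqrrN expr1n expr1n gscale1.
Qed.

Lemma gscaleN1K x : gscale (-1) (gscale (-1) x) = x.
Proof. by apply: gfun_ext => m vs ws; rewrite /gscale mulrA mulrNN !mul1r. Qed.

Lemma br_fb f b : smooth f -> Gam b -> br (of_fun f) (of_B b) = gscale (-1) (of_fun (along (rhoB A) b f)).
Proof.
by move=> sf Gb; rewrite (br_skew hbr (homog_of_fun sf) (homog_of_B Gb)) mul0n expr0 (ep_bf hbrP Gb sf).
Qed.

Lemma br_tb t b : Gamd t -> Gam b -> br (of_Qd t) (of_B b) = gscale (-1) (of_Qd (nabBQd P b t)).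
Proof.
move=> Gt Gb; rewrite (br_skew hbr (homog_of_Qd Gt) (homog_of_B Gb)) (ep_bt hbrP Gb Gt).
by rewrite mul1n sqrrN expr1n.
Qed.

Lemma br_tf f t : smooth f -> Gamd t -> br (of_Qd t) (of_fun f) = g0.
Proof.
move=> sf Gt; rewrite (br_skew hbr (homog_of_Qd Gt) (homog_of_fun sf)) (ep_ft hbrP sf Gt).
by apply: gfun_ext => m vs ws; rewrite /gscale mulr0.
Qed.

Lemma dQs_Gam t : Gamd t -> Gam (dQs P t).
Proof. exact: (tr_dQ hT). Qed.

(** Both sides are odd derivations on forms that kill functions, and on tau' both give <tau', dQ
    tau>. *)
Lemma br_t_pure t k om : Gamd t -> hom true k om -> br (of_Qd t) om = i_Q (dQs P t) om.
Proof.
move=> Gt; apply: (der_unique (der_pure (br_der (homog_of_Qd Gt))) (i_Q_der (dQs_Gam Gt))) => //.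
- by move=> f sf; rewrite (br_tf sf Gt).
- by move=> t' Gt'; rewrite (ep_tt hbrP Gt Gt') i_Q_Qd.
Qed.

Lemma br_f_pure f k om : smooth f -> hom true k om -> br (of_fun f) om = g0.
Proof.
move=> sf; apply: (der_vanish (der_pure (br_der (homog_of_fun sf)))) => //.
- by move=> g sg; exact: (ep_ff hbrP sf sg).
- by move=> t Gt; exact: (ep_ft hbrP sf Gt).
Qed.

Lemma br_b_pure_pure b k om m vs w ws : Gam b -> hom true k om -> br (of_B b) om m vs (w :: ws) = 0.
Proof.
move=> Gb hx; apply: (der_pres_pure (der_pure (br_der (homog_of_B Gb))) _ _ hx).
- by move=> f m' [|? ?] w' ws' sf; rewrite (ep_bf hbrP Gb sf).
- by move=> t m' vs' w' ws' Gt; rewrite (ep_bt hbrP Gb Gt); exact: of_covec_pure.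
Qed.

Lemma nabBQ_Gam b q : Gam b -> Gam q -> Gam (nabBQ P b q).
Proof. exact: (conn_sec (tr_nabQ hT)). Qed.

Lemma nabBQd_Gamd b t : Gam b -> Gamd t -> Gamd (nabBQd P b t).
Proof. exact: (conn_sec (tr_nabQd hT)). Qed.

(* [{b, -}, i_q] = i_(nabla_b q), since both sides are derivations that agree on f and tau;
   on tau this is the duality of the two B-connections. *)
Lemma br_b_pure b q k om : Gam b -> Gam q -> hom true k om ->
  i_Q q (br (of_B b) om) = gadd (br (of_B b) (i_Q q om)) (gscale (-1) (i_Q (nabBQ P b q) om)).
Proof.
move=> Gb Gq hom_.
have dB := der_pure (br_der (homog_of_B Gb)).
have Gn := nabBQ_Gam Gb Gq.
pose L y := gadd (br (of_B b) (i_Q q y)) (gscale (-1) (gadd (i_Q q (br (of_B b) y)) (i_Q (nabBQ P b q) y))).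
have Lf f : smooth f -> L (of_fun f) = g0.
  move=> sf; rewrite /L !i_Q_fun (der0 dB) (ep_bf hbrP Gb sf) i_Q_fun.
  by apply: gfun_ext => m vs ws; rewrite /gadd /gscale /gzero; ring.
have dL : der true 1 L.
  split=> //.
  - move=> l a y z hy hz; rewrite /L !i_Q_lin (der_lin dB a (hom_i_Q Gq hy) (hom_i_Q Gq hz)).
    rewrite (der_lin dB a hy hz) i_Q_lin.
    by apply: gfun_ext => m vs ws; rewrite /gadd /gscale; ring.
  - move=> l f y sf hy; rewrite Lf // gmul0l /L !i_Q_fmul.
    rewrite (der_f dB sf (hom_i_Q Gq hy)) (der_f dB sf hy) i_Q_add (ep_bf hbrP Gb sf) !i_Q_fmul.
    rewrite !gmulDr !gmulZr !gmulDr.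
    by apply: gfun_ext => m vs ws; rewrite /gadd /gscale /gzero; ring.
  - move=> l t y Gt hy; rewrite /L !i_Q_tmul !i_Q_Qd.
    have st : smooth (pairing t q) by exact: pairing_smooth.
    have hq := hom_i_Q Gq hy.
    have htq : hom true l (gmul (of_Qd t) (i_Q q y)).
      (* For l = 0 the product with tau would have degree 1 instead of 0, but the contraction of a
         function is zero. *)
      case: l hy hq => [|l] hy hq; last exact: hom_tmul.
      rewrite (_ : i_Q q y = g0) ?gmul0r; first exact: hom0.
      by apply: gfun_ext => m vs ws; rewrite /i_Q /d_tau (homog_deg hy.1).
    rewrite (derD dB (hom_fmul st hy) (hom_gscale (-1) htq)) (derZ dB _ htq).
    rewrite (der_f dB st hy) (der_t dB Gt hq) (der_t dB Gt hy) i_Q_add i_Q_scale !i_Q_tmul.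
    rewrite (ep_bf hbrP Gb st) (ep_bt hbrP Gb Gt) i_Q_tmul i_Q_Qd.
    rewrite !(gmulDr, gmulZr, gmulDl, gmulZl).
    apply: gfun_ext => m vs ws; rewrite /gadd /gscale /gmul !gr_mul_fun.
    by rewrite (sd_nab hP Gb Gq Gt); ring.
have Lt t : Gamd t -> L (of_Qd t) = g0.
  move=> Gt; have st : smooth (pairing t q) by exact: pairing_smooth.
  rewrite /L !i_Q_Qd (ep_bf hbrP Gb st) (ep_bt hbrP Gb Gt) i_Q_Qd.
  apply: gfun_ext => m [|? ?] [|? ?]; rewrite /gadd /gscale /gzero /of_fun; try ring.
  by rewrite (sd_nab hP Gb Gq Gt); ring.
have Z : L om = g0 by apply: (der_vanish dL Lf Lt _ hom_).
apply: gfun_ext => m vs ws; have := congr1 (fun z : gf => z m vs ws) Z.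
rewrite /L /gadd /gscale /gzero; lra.
Qed.

(** One contraction at a time is moved through {b, -} until a function remains. The outcome, here
    and in the two lemmas that follow, is the Lie derivative of a form along b for the B-connection
    on Q. *)
Lemma br_b_1 b om q1 m : Gam b -> Gam q1 -> hom true 1 om ->
  br (of_B b) om m [:: q1 m] [::] =
  along (rhoB A) b (fun p => om p [:: q1 p] [::]) m - om m [:: nabBQ P b q1 m] [::].
Proof.
move=> Gb G1 ho; have := br_b_pure Gb G1 ho.
have h1 := (hom_i_Q G1 ho).1.
rewrite [i_Q q1 om](homog0E h1) (ep_bf hbrP Gb (homog0_smooth h1)).
by move=> /(congr1 (fun z : gf => z m [::] [::])); rewrite /i_Q /d_tau /gadd /gscale mulN1r.
Qed.

Lemma br_b_2 b om q1 q2 m : Gam b -> Gam q1 -> Gam q2 -> hom true 2 om ->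
  br (of_B b) om m [:: q1 m; q2 m] [::] =
  along (rhoB A) b (fun p => om p [:: q1 p; q2 p] [::]) m - om m [:: nabBQ P b q1 m; q2 m] [::]
  - om m [:: q1 m; nabBQ P b q2 m] [::].
Proof.
move=> Gb G1 G2 ho; have := br_b_pure Gb G1 ho.
move=> /(congr1 (fun z : gf => z m [:: q2 m] [::])); rewrite {1}/i_Q /d_tau => ->.
rewrite /gadd /gscale mulN1r (br_b_1 m Gb G2 (hom_i_Q G1 ho)) /i_Q /d_tau; ring.
Qed.

Lemma br_b_3 b om q1 q2 q3 m : Gam b -> Gam q1 -> Gam q2 -> Gam q3 -> hom true 3 om ->
  br (of_B b) om m [:: q1 m; q2 m; q3 m] [::] =
  along (rhoB A) b (fun p => om p [:: q1 p; q2 p; q3 p] [::]) m - om m [:: nabBQ P b q1 m; q2 m; q3 m] [::]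
  - om m [:: q1 m; nabBQ P b q2 m; q3 m] [::] - om m [:: q1 m; q2 m; nabBQ P b q3 m] [::].
Proof.
move=> Gb G1 G2 G3 ho; have := br_b_pure Gb G1 ho.
move=> /(congr1 (fun z : gf => z m [:: q2 m; q3 m] [::])); rewrite {1}/i_Q /d_tau => ->.
rewrite /gadd /gscale mulN1r (br_b_2 m Gb G2 G3 (hom_i_Q G1 ho)) /i_Q /d_tau; ring.
Qed.

Definition RBf b1 b2 : gf := of_2form (fun m v1 v2 => RB P (b1 m) (b2 m) v1 v2).

Lemma hom_RBf b1 b2 : Gam b1 -> Gam b2 -> hom true 2 (RBf b1 b2).
Proof.
move=> G1 G2; split; last by move=> _ m [|? [|? []]].
split; rewrite /RBf /of_2form.
- by move=> m [|? [|? [|? ?]]] [|? ?].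
- move=> m [|? [|? [|? ?]]] [|? [|? ?]] [|? ?] a u v; rewrite /= ?mulr0 ?addr0 //.
    by rewrite linearP add_lfunE scale_lfunE.
  by rewrite linearP.
- by move=> m [|? [|? [|? ?]]] [|? ?] ws2 a u v; rewrite /= mulr0 addr0.
- move=> m [|? [|? [|? ?]]] [|? ?] [|? ?] v //=.
  by have := sd_RB hP (b1 m) (b2 m) v v; lra.
- by move=> m [|? [|? [|? ?]]] [|? ?].
- move=> k l q beta Gq Gb; apply: (smooth_gf_homog (x := RBf b1 b2)) => //.
  move=> [|s1 [|s2 [|? ?]]] [|? ?] aq ab; try exact: smooth_cst.
  exact: pairing_smooth (tr_RB_smooth hT G1 G2 (aq 0%N)) (aq 1%N).
Qed.

Lemma br_bbE b1 b2 : Gam b1 -> Gam b2 ->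
  br (of_B b1) (of_B b2) = gadd (of_B (lie A b1 b2)) (gscale (-1) (RBf b1 b2)).
Proof. exact: (ep_bb hbrP). Qed.

End Bracket.

Arguments pure {R n rQ rB M Q B} x m vs ws.
Arguments RBf {R n rQ rB M Q B} P b1 b2 m vs ws.

(** * Brackets with the images of the generators *)

Section Compatibility.
Context {R : realType} {n rQ rB : nat} {M : manifold R n}.
Context {Q : vbundle M rQ} {B : vbundle M rB}.
Notation gf := (gfun Q B).
Notation g0 := (@gzero R n rQ rB M Q B).
Variables (QQ : gf -> gf) (br : gf -> gf -> gf).
Variables (D : dorfman2 Q B) (A : lie_algebroid B) (P : two_rep Q B).
Variables (hQQ : homological QQ) (hbr : poisson br).
Variables (hD : is_dorfman2 D) (hQQD : encodes_vf QQ D).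
Variables (hA : is_lie_algebroid A) (hP : is_self_dual A P) (hbrP : encodes_poisson br A P).
Arguments QQ : clear implicits.
Arguments br : clear implicits.
Implicit Types (x y z om : gf) (m : M) (f : M -> R) (t : sec (bdual Q)) (b : sec B) (q : sec Q).

Let hT := sd_two_rep hP.
Let hrB := la_anchor hA.

(** In degree 2 there are only sections of B and 2-forms, and brackets with each are within reach:
    with the former by [encodes_poisson], with the latter through contractions. *)
Lemma QQ_Qd_dec t : Gamd t -> QQ (of_Qd t) = gadd (of_B (dBs D t)) (pure (QQ (of_Qd t))).
Proof.
move=> Gt; have h2 := hvf_deg hQQ (homog_of_Qd Gt).
apply: homog_ext2 h2 (homog_gadd (homog_of_B (d2_dB hD Gt)) (hom_pure h2).1) _ _.
  by move=> m v v'; rewrite /gadd /pure add0r.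
by move=> m w; rewrite (QQ_Qd_B hD hQQD) // /gadd /pure addr0.
Qed.

Lemma hom_pure_Qt t : Gamd t -> hom true 2 (pure (QQ (of_Qd t))).
Proof. by move=> Gt; exact: hom_pure (hvf_deg hQQ (homog_of_Qd Gt)). Qed.

Lemma hom_pure_Qb b : Gam b -> hom true 3 (pure (QQ (of_B b))).
Proof. by move=> Gb; exact: hom_pure (hvf_deg hQQ (homog_of_B Gb)). Qed.

Lemma br_x_Qt k x t : homog k x -> Gamd t ->
  br x (QQ (of_Qd t)) = gadd (br x (of_B (dBs D t))) (br x (pure (QQ (of_Qd t)))).
Proof.
move=> hx Gt; rewrite {1}(QQ_Qd_dec Gt).
have h1 := homog_of_B (d2_dB hD Gt); have h2 := (hom_pure_Qt Gt).1.
by apply: (derD (br_der hbr hx) (k := 2)); split.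
Qed.

Lemma br_t_Qt t t' q m : Gamd t -> Gamd t' -> Gam q ->
  br (of_Qd t) (QQ (of_Qd t')) m [:: q m] [::] =
  - pairing (nabBQd P (dBs D t') t) q m + koszul1 D t' (dQs P t) q m.
Proof.
move=> Gt Gt' Gq; rewrite (br_x_Qt (homog_of_Qd Gt) Gt') (br_tb hbr hbrP Gt (d2_dB hD Gt')).
rewrite (br_t_pure hbr hP hbrP Gt (hom_pure_Qt Gt')) /gadd /gscale mulN1r; congr (_ + _).
exact: (QQ_Qd_QQ hD hQQD m Gt' (dQs_Gam hP Gt) Gq).
Qed.

Lemma br_f_Qt f t : smooth f -> Gamd t ->
  br (of_fun f) (QQ (of_Qd t)) = gscale (-1) (of_fun (along (rhoB A) (dBs D t) f)).
Proof.
move=> sf Gt; rewrite (br_x_Qt (homog_of_fun sf) Gt) (br_fb hbr hbrP sf (d2_dB hD Gt)).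
rewrite (br_f_pure hbr hbrP sf (hom_pure_Qt Gt)).
by apply: gfun_ext => m vs ws; rewrite /gadd /gzero addr0.
Qed.

Lemma br_b_Qt_B b t m w : Gam b -> Gamd t ->
  br (of_B b) (QQ (of_Qd t)) m [::] [:: w] = w (lie A b (dBs D t) m).
Proof.
move=> Gb Gt; rewrite (br_x_Qt (homog_of_B Gb) Gt) (br_bbE hbrP Gb (d2_dB hD Gt)).
rewrite /gadd (br_b_pure_pure hbr hbrP _ _ _ Gb (hom_pure_Qt Gt)).
by rewrite /gscale /RBf /of_2form mulr0 !addr0.
Qed.

Lemma br_b_Qt_QQ b t q1 q2 m : Gam b -> Gamd t -> Gam q1 -> Gam q2 ->
  br (of_B b) (QQ (of_Qd t)) m [:: q1 m; q2 m] [::] =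
  - RB P (b m) (dBs D t m) (q1 m) (q2 m) + along (rhoB A) b (koszul1 D t q1 q2) m
  - koszul1 D t (nabBQ P b q1) q2 m - koszul1 D t q1 (nabBQ P b q2) m.
Proof.
move=> Gb Gt G1 G2; rewrite (br_x_Qt (homog_of_B Gb) Gt) (br_bbE hbrP Gb (d2_dB hD Gt)).
rewrite /gadd (br_b_2 hbr hP hbrP m Gb G1 G2 (hom_pure_Qt Gt)) /gscale /RBf /of_2form mulN1r.
have E (s s' : sec Q) (p : M) : Gam s -> Gam s' -> pure (QQ (of_Qd t)) p [:: s p; s' p] [::] = koszul1 D t s s' p.
  by move=> Gs Gs'; exact: (QQ_Qd_QQ hD hQQD p Gt Gs Gs').
rewrite (E _ _ m (nabBQ_Gam hP Gb G1) G2) (E _ _ m G1 (nabBQ_Gam hP Gb G2)).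
have -> : (fun p => pure (QQ (of_Qd t)) p [:: q1 p; q2 p] [::]) = koszul1 D t q1 q2.
  by apply/funext => p; exact: E.
by rewrite /of_B /of_vec add0r !addrA.
Qed.

Lemma nabQB_Gam q b : Gam q -> Gam b -> Gam (nabQB D q b).
Proof. exact: (conn_sec (d2_nab hD)). Qed.

Section InFrame.
Variables (U : set M) (q : 'I_rQ -> sec Q) (tau : 'I_rQ -> sec (bdual Q)).
Variables (beta : 'I_rB -> sec (bdual B)) (b' : 'I_rB -> sec B).
Hypothesis lf : local_frames U q tau beta b'.
Hypothesis oU : open U.

Lemma frame_nab_at b (s : sec Q) m : Gam b -> Gam s -> U m ->
  nabQB D s b m = \sum_i tau i m (s m) *: nabQB D (q i) b m.
Proof.
move=> Gb Gs Um; apply: vec_eq => w; have [t Gt <-] := sec_through (Gamd_module B) w.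
have T := nabQB_tensor hD m Gt Gb; have Z i := sm_Z (Gam_module Q) (smooth_cst (tau i m (s m))) (lf_q lf i).
have Gs' := sm_sum (Gam_module Q) (index_enum _) Z.
have := tensor_eq (Gam_module Q) T Gs Gs' (lf_vQ lf (s m) Um); rewrite /pairing => ->.
have := tensor_sum (Gam_module Q) T (index_enum _) Z; rewrite /pairing => ->.
rewrite linear_sum; apply: eq_bigr => i _; rewrite linearZ.
exact: (tensorZ T (smooth_cst _) (lf_q lf i)).
Qed.

Lemma frame_nab (W : lmodType R) (F : sec B -> W) b (s : sec Q) m : tensor_at (@Gam R n M rB B) m F ->
  Gam b -> Gam s -> U m -> \sum_i tau i m (s m) *: F (nabQB D (q i) b) = F (nabQB D s b).
Proof.
move=> T Gb Gs Um; have Gn i := nabQB_Gam (lf_q lf i) Gb.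
have Z i := sm_Z (Gam_module B) (smooth_cst (tau i m (s m))) (Gn i).
rewrite (tensor_eq (Gam_module B) T (nabQB_Gam Gs Gb) (sm_sum (Gam_module B) (index_enum _) Z)).
  rewrite (tensor_sum (Gam_module B) T _ Z); apply: eq_bigr => i _.
  exact/esym/(tensorZ T (smooth_cst _) (Gn i)).
exact: frame_nab_at.
Qed.

(* The component of QQ b in Q^* (x) B over a local frame. *)
Definition mixed b : gf := gsum (index_enum 'I_rQ) (fun i => gmul (of_Qd (tau i)) (of_B (nabQB D (q i) b))).
Arguments mixed b m vs ws : clear implicits.

Lemma hom_mixed_term b i : Gam b -> hom false 3 (gmul (of_Qd (tau i)) (of_B (nabQB D (q i) b))).
Proof.
move=> Gb; split=> //.
exact: (homog_gmul (homog_of_Qd (lf_tau lf i)) (homog_of_B (nabQB_Gam (lf_q lf i) Gb))).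
Qed.

Lemma mixed_term_B b i m v w : gmul (of_Qd (tau i)) (of_B (nabQB D (q i) b)) m [:: v] [:: w] =
  tau i m v * w (nabQB D (q i) b m).
Proof. by rewrite /gmul gr_mul_covec_cons gr_mul_covec_nil subr0. Qed.

Lemma Qb_near b m vs ws : Gam b -> U m ->
  QQ (of_B b) m vs ws = gadd (mixed b) (pure (QQ (of_B b))) m vs ws.
Proof.
move=> Gb Um; have h1 := hvf_deg hQQ (homog_of_B Gb).
have h2 : homog 3 (gadd (mixed b) (pure (QQ (of_B b)))).
  apply: homog_gadd; last exact: (hom_pure_Qb Gb).1.
  exact: (hom_gsum _ (fun i => hom_mixed_term i Gb)).1.
have [|ne] := eqVneq (size vs + 2 * size ws)%N 3%N; last by rewrite (homog_deg h1) // (homog_deg h2).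
case: vs => [|v [|v' [|v'' [|v''' vs]]]]; case: ws => [|w [|w' ws]] => /=; rewrite ?mulnS //; try lia.
  move=> _; have [s Gs <-] := sec_through (Gam_module Q) v.
  rewrite (QQ_B_QB hD hQQD w Gb Gs) /gadd /pure addr0 (frame_nab_at Gb Gs Um) linear_sum.
  by apply: eq_bigr => i _; rewrite linearZ mixed_term_B.
move=> _; rewrite /gadd /pure /mixed /gsum big1 ?add0r // => i _.
by rewrite /gmul !gr_mul_covec_cons gr_mul_covec_nil /of_B /of_vec; ring.
Qed.

(** The splitting of QQ b into a mixed part and a 3-form holds over the domain of the frame only;
    the locality of {x, -} makes it usable inside the bracket. *)
Lemma br_x_Qb k x b m vs ws : homog k x -> Gam b -> U m ->
  br x (QQ (of_B b)) m vs ws =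
  \sum_i br x (gmul (of_Qd (tau i)) (of_B (nabQB D (q i) b))) m vs ws + br x (pure (QQ (of_B b))) m vs ws.
Proof.
move=> hx Gb Um; have dx := br_der hbr hx.
have h1 : hom false 3 (QQ (of_B b)) by split=> //; exact: (hvf_deg hQQ (homog_of_B Gb)).
have hm := hom_gsum (index_enum 'I_rQ) (fun i => hom_mixed_term i Gb).
have hp : hom false 3 (pure (QQ (of_B b))) by split=> //; exact: (hom_pure_Qb Gb).1.
rewrite (der_eq_near dx vs ws h1 (hom_gadd hm hp) oU Um); last first.
  by move=> p Up us xs; exact: Qb_near.
by rewrite (derD dx hm hp) (der_gsum dx _ (fun i => hom_mixed_term i Gb)).
Qed.

Lemma br_t_mixed t b i m : Gamd t -> Gam b ->
  br (of_Qd t) (gmul (of_Qd (tau i)) (of_B (nabQB D (q i) b))) =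
  gadd (gmul (of_fun (pairing (tau i) (dQs P t))) (of_B (nabQB D (q i) b)))
       (gmul (of_Qd (tau i)) (of_Qd (nabBQd P (nabQB D (q i) b) t))).
Proof.
move=> Gt Gb; have Gn := nabQB_Gam (lf_q lf i) Gb; have Gti := lf_tau lf i.
rewrite (der_t (br_der hbr (homog_of_Qd Gt)) Gti (k := 2)); last by split=> //; exact: homog_of_B.
rewrite (ep_tt hbrP Gt Gti) (br_tb hbr hbrP Gt Gn) gmulZr expr1 gscaleN1K //.
Qed.

Lemma br_b_mixed b1 b i : Gam b1 -> Gam b ->
  br (of_B b1) (gmul (of_Qd (tau i)) (of_B (nabQB D (q i) b))) =
  gadd (gmul (of_Qd (nabBQd P b1 (tau i))) (of_B (nabQB D (q i) b)))
       (gmul (of_Qd (tau i)) (gadd (of_B (lie A b1 (nabQB D (q i) b)))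
          (gscale (-1) (RBf P b1 (nabQB D (q i) b))))).
Proof.
move=> Gb1 Gb; have Gn := nabQB_Gam (lf_q lf i) Gb; have Gti := lf_tau lf i.
rewrite (der_t (br_der hbr (homog_of_B Gb1)) Gti (k := 2)); last by split=> //; exact: homog_of_B.
by rewrite (ep_bt hbrP Gb1 Gti) (br_bbE hbrP Gb1 Gn) sqrrN expr1n gscale1.
Qed.

End InFrame.

Lemma br_f_Qb f b q m : smooth f -> Gam b -> Gam q ->
  br (of_fun f) (QQ (of_B b)) m [:: q m] [::] = - along (rhoB A) (nabQB D q b) f m.
Proof.
move=> sf Gb Gq.
have [c [U [qs [tau [beta [b' [oU Um _ lf]]]]]]] := local_frames_at (Q := Q) (B := B) m.
rewrite (br_x_Qb lf oU [:: q m] [::] (homog_of_fun sf) Gb Um).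
rewrite (br_f_pure hbr hbrP sf (hom_pure_Qb Gb)) /gzero addr0.
have := frame_nab lf (along_tensor hrB m sf) Gb Gq Um; rewrite /= => <-.
rewrite -sumrN; apply: eq_bigr => i _; have Gn := nabQB_Gam (lf_q lf i) Gb.
rewrite (der_t (br_der hbr (homog_of_fun sf)) (lf_tau lf i) (k := 2)); last by split=> //; exact: homog_of_B.
rewrite (ep_ft hbrP sf (lf_tau lf i)) gmul0l (br_fb hbr hbrP sf Gn) gmulZr expr0 gscale1.
rewrite /gadd /gscale /gzero add0r /gmul gr_mul_covec_cons gr_mul_covec_nil subr0 mulN1r.
by [].
Qed.

Lemma br_t_Qb_B t b m w : Gamd t -> Gam b ->
  br (of_Qd t) (QQ (of_B b)) m [::] [:: w] = w (nabQB D (dQs P t) b m).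
Proof.
move=> Gt Gb.
have [c [U [qs [tau [beta [b' [oU Um _ lf]]]]]]] := local_frames_at (Q := Q) (B := B) m.
rewrite (br_x_Qb lf oU [::] [:: w] (homog_of_Qd Gt) Gb Um).
rewrite (br_t_pure hbr hP hbrP Gt (hom_pure_Qb Gb)) /i_Q /d_tau /pure addr0.
rewrite (frame_nab_at lf Gb (dQs_Gam hP Gt) Um) linear_sum; apply: eq_bigr => i _.
rewrite (br_t_mixed lf i m Gt Gb) /gadd /gmul gr_mul_fun gr_mul_covec_nil addr0 linearZ.
by [].
Qed.

Lemma br_t_Qb_QQ t b q1 q2 m : Gamd t -> Gam b -> Gam q1 -> Gam q2 ->
  br (of_Qd t) (QQ (of_B b)) m [:: q1 m; q2 m] [::] =
  pairing (nabBQd P (nabQB D q1 b) t) q2 m - pairing (nabBQd P (nabQB D q2 b) t) q1 m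
  - RQ D (dQs P t m) (q1 m) (b m) (q2 m).
Proof.
move=> Gt Gb G1 G2.
have [c [U [qs [tau [beta [b' [oU Um _ lf]]]]]]] := local_frames_at (Q := Q) (B := B) m.
rewrite (br_x_Qb lf oU [:: q1 m; q2 m] [::] (homog_of_Qd Gt) Gb Um).
rewrite (br_t_pure hbr hP hbrP Gt (hom_pure_Qb Gb)) /i_Q /d_tau /pure (QQ_B_QQQ hD hQQD) //.
congr (_ - _).
have T q : Gam q -> tensor_at (@Gam R n M rB B) m (fun c => pairing (nabBQd P c t) q m : R^o).
  move=> Gq; have hn := tr_nabQd hT; split=> [s s' Gs Gs'|f s sf Gs].
    by rewrite (conn_addl hn Gs Gs' Gt) pairingDl.
  by rewrite (conn_scalel hn sf Gs Gt) pairingZl.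
have := frame_nab lf (T q2 G2) Gb G1 Um; rewrite /= => <-.
have := frame_nab lf (T q1 G1) Gb G2 Um; rewrite /= => <-.
rewrite -sumrB; apply: eq_bigr => i _.
rewrite (br_t_mixed lf i m Gt Gb) /gadd /gmul gr_mul_fun !gr_mul_covec_cons gr_mul_covec_nil subr0.
by rewrite {1}/of_B /of_vec mulr0 add0r.
Qed.

(** [b1, -] is not C^oo-linear, so nabla_q b cannot be replaced by its value at m. Near m it is sum
    <tau_i, q> nabla_(q_i) b, the function X of the proof; the derivatives rho(b1) <tau_i, q>
    produced by this sum are matched, through duality of the connections, with {b1, tau_i} and with
    the coefficients of nabla_b1 q. *)
Lemma br_b_Qb_QB b1 b q m w : Gam b1 -> Gam b -> Gam q ->
  br (of_B b1) (QQ (of_B b)) m [:: q m] [:: w] =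
  w (lie A b1 (nabQB D q b) m) - w (nabQB D (nabBQ P b1 q) b m).
Proof.
move=> Gb1 Gb Gq.
have [c [U [qs [tau [beta [b' [oU Um _ lf]]]]]]] := local_frames_at (Q := Q) (B := B) m.
rewrite (br_x_Qb lf oU [:: q m] [:: w] (homog_of_B Gb1) Gb Um).
rewrite (br_b_pure_pure hbr hbrP _ _ _ Gb1 (hom_pure_Qb Gb)) addr0.
have Gn i := nabQB_Gam (lf_q lf i) Gb; have Gs := nabQB_Gam Gq Gb.
have st i := pairing_smooth (lf_tau lf i) Gq.
have dB := br_der hbr (homog_of_B Gb1).
have hB b2 : Gam b2 -> hom false 2 (of_B b2 : gf) by move=> G2; split=> //; exact: homog_of_B.
pose X : gf := gsum (index_enum 'I_rQ) (fun i => gmul (of_fun (pairing (tau i) q)) (of_B (nabQB D (qs i) b))).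
have hX i := hom_fmul (st i) (hB _ (Gn i)).
have hXs := hom_gsum (index_enum 'I_rQ) hX.
have near p us xs : U p -> (of_B (nabQB D q b) : gf) p us xs = X p us xs.
  move=> Up; rewrite /X /gsum; case: us => [|u us]; last first.
    by rewrite big1 // => i _; rewrite /gmul gr_mul_fun mulr0.
  case: xs => [|u [|u' xs]].
  - by rewrite big1 // => i _; rewrite /gmul gr_mul_fun mulr0.
  - rewrite /of_B /of_vec (frame_nab_at lf Gb Gq Up) linear_sum; apply: eq_bigr => i _.
    by rewrite linearZ /gmul gr_mul_fun.
  - by rewrite big1 // => i _; rewrite /gmul gr_mul_fun mulr0.
have E : w (lie A b1 (nabQB D q b) m) = br (of_B b1) X m [::] [:: w].
  rewrite -(der_eq_near dB [::] [:: w] (hB _ Gs) hXs oU Um (fun p Up us xs => near p us xs Up)).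
  by rewrite (br_bbE hbrP Gb1 Gs) /gadd /gscale /RBf /of_2form mulr0 addr0.
rewrite E /X (der_gsum dB _ hX) /gsum.
rewrite (frame_nab_at lf Gb (nabBQ_Gam hP Gb1 Gq) Um) linear_sum -sumrB.
apply: eq_bigr => i _; rewrite (der_f dB (st i) (hB _ (Gn i))) (br_b_mixed lf i Gb1 Gb).
rewrite (br_bbE hbrP Gb1 (Gn i)) (ep_bf hbrP Gb1 (st i)).
rewrite /gadd /gmul !gr_mul_fun !gr_mul_covec_cons !gr_mul_covec_nil !subr0 linearZ.
have := sd_nab hP Gb1 Gq (lf_tau lf i) m; rewrite /pairing => ->.
rewrite /gscale /RBf /of_2form /of_B /of_vec.
set u1 := w _; set u2 := w _; set a1 := nabBQd _ _ _ _ _; set a2 := tau _ _ _; set a3 := tau _ _ _.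
by rewrite -[X in _ - X]/(a3 * u1); ring.
Qed.

Lemma br_b_Qb_QQQ b1 b q1 q2 q3 m : Gam b1 -> Gam b -> Gam q1 -> Gam q2 -> Gam q3 ->
  br (of_B b1) (QQ (of_B b)) m [:: q1 m; q2 m; q3 m] [::] =
  - (RB P (b1 m) (nabQB D q1 b m) (q2 m) (q3 m) - RB P (b1 m) (nabQB D q2 b m) (q1 m) (q3 m)
     + RB P (b1 m) (nabQB D q3 b m) (q1 m) (q2 m))
  - (along (rhoB A) b1 (omegaR D q1 q2 q3 b) m - omegaR D (nabBQ P b1 q1) q2 q3 b m
     - omegaR D q1 (nabBQ P b1 q2) q3 b m - omegaR D q1 q2 (nabBQ P b1 q3) b m).
Proof.
move=> Gb1 Gb G1 G2 G3.
have [c [U [qs [tau [beta [b' [oU Um _ lf]]]]]]] := local_frames_at (Q := Q) (B := B) m.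
rewrite (br_x_Qb lf oU [:: q1 m; q2 m; q3 m] [::] (homog_of_B Gb1) Gb Um).
rewrite (br_b_3 hbr hP hbrP m Gb1 G1 G2 G3 (hom_pure_Qb Gb)); congr (_ + _); last first.
  have -> : (fun p => pure (QQ (of_B b)) p [:: q1 p; q2 p; q3 p] [::]) =
      fun p => -1 * omegaR D q1 q2 q3 b p.
    by apply/funext => p; rewrite /pure (QQ_B_QQQ hD hQQD) // mulN1r.
  have so : smooth (omegaR D q1 q2 q3 b) by exact: pairing_smooth (d2_RQ_smooth hD G1 G2 Gb) G3.
  rewrite (alongM hrB) //; last exact: smooth_cst.
  rewrite (along_cst hrB) /pure !(QQ_B_QQQ hD hQQD) // /omegaR /pairing /RQs; ring.
have T u v : tensor_at (@Gam R n M rB B) m (fun e => RB P (b1 m) (e m) u v : R^o).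
  have L a e e' : RB P (b1 m) (a *: e + e') u v = a * RB P (b1 m) e u v + RB P (b1 m) e' u v.
    rewrite (tr_RB_skew hT) (tr_RB_lin hT) opprD -scalerN -!(tr_RB_skew hT).
    by rewrite add_lfunE scale_lfunE add_lfunE scale_lfunE.
  have L0 : RB P (b1 m) 0 u v = 0 by have := L (-1) 0 0; rewrite scaler0 addr0; lra.
  split=> [s s' _ _|f s _ _]; first by have := L 1 (s m) (s' m); rewrite scale1r mul1r.
  by have := L (f m) (s m) 0; rewrite addr0 L0 addr0.
have := frame_nab lf (T (q2 m) (q3 m)) Gb G1 Um; rewrite /= => <-.
have := frame_nab lf (T (q1 m) (q3 m)) Gb G2 Um; rewrite /= => <-.
have := frame_nab lf (T (q1 m) (q2 m)) Gb G3 Um; rewrite /= => <-.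
rewrite -sumrB -big_split -sumrN; apply: eq_bigr => i _ /=.
rewrite (br_b_mixed lf i Gb1 Gb) /gadd /gmul !gr_mul_covec_cons !gr_mul_covec_nil !subr0.
rewrite /gscale /RBf /of_2form /of_B /of_vec -![_ *: _]/(_ * _); ring.
Qed.

End Compatibility.

(** * The compatibility defect is a biderivation *)

Section Defect.
Context {R : realType} {n rQ rB : nat} {M : manifold R n}.
Context {Q : vbundle M rQ} {B : vbundle M rB}.
Notation gf := (gfun Q B).
Notation g0 := (@gzero R n rQ rB M Q B).
Variables (QQ : gf -> gf) (br : gf -> gf -> gf).
Variables (hQQ : homological QQ) (hbr : poisson br).
Arguments QQ : clear implicits.
Arguments br : clear implicits.
Implicit Types (x y z : gf) (m : M) (f g : M -> R) (t : sec (bdual Q)) (b : sec B).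

(** The degree k of x is a separate argument because it cannot be recovered from x: zero is
    homogeneous of every degree. *)
Definition defect k x y : gf :=
  gadd (QQ (br x y)) (gscale (-1) (gadd (br (QQ x) y) (gscale ((-1) ^+ k) (br x (QQ y))))).

Lemma homog_br k l x y : homog k x -> homog l y -> homog (k + l - 2) (br x y).
Proof.
by move=> hx hy; have := br_deg hbr hx hy; case: ifP => // _ ->; exact: homog_gzero.
Qed.

Lemma vf0 : QQ g0 = g0.
Proof.
have E : gadd (gscale (-1) g0) g0 = g0.
  by apply: gfun_ext => m vs ws; rewrite /gadd /gscale mulr0 addr0.
have := hvf_lin hQQ (-1) (homog_gzero 0) (homog_gzero 0); rewrite E => ->.
by apply: gfun_ext => m vs ws; rewrite /gadd /gscale /gzero mulN1r addNr.
Qed.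

Lemma vfZ k a x : homog k x -> QQ (gscale a x) = gscale a (QQ x).
Proof.
move=> hx; have E z : gscale a z = gadd (gscale a z) g0.
  by apply: gfun_ext => m vs ws; rewrite /gadd /gzero addr0.
by rewrite E (hvf_lin hQQ a hx (homog_gzero k)) vf0 -E.
Qed.

Lemma vfD k x y : homog k x -> homog k y -> QQ (gadd x y) = gadd (QQ x) (QQ y).
Proof. by move=> hx hy; rewrite -{1}[x]gscale1 (hvf_lin hQQ 1 hx hy) gscale1. Qed.

(* For k + l < 2 the bracket vanishes, so the truncated degree k + l - 2 does no harm. *)
Lemma vf_br_mul k l p x y z : homog k x -> homog l y -> homog p z ->
  QQ (gmul (br x y) z) = gadd (gmul (QQ (br x y)) z) (gscale ((-1) ^+ (k + l)) (gmul (br x y) (QQ z))).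
Proof.
move=> hx hy hz; have := br_deg hbr hx hy; case: ltnP => [_ ->|kl hb].
  rewrite gmul0l vf0 !gmul0l.
  by apply: gfun_ext => m vs ws; rewrite /gadd /gscale /gzero mulr0 addr0.
rewrite (hvf_der hQQ hb hz) /gsign; congr (gadd _ (gscale _ _)).
by rewrite -{2}(subnK kl) addn2 !exprS !mulN1r opprK.
Qed.

Lemma defect_leibniz k l p x y z : homog k x -> homog l y -> homog p z ->
  defect k x (gmul y z) =
  gadd (gmul (defect k x y) z) (gscale ((-1) ^+ (k.+1 * l)) (gmul y (defect k x z))).
Proof.
move=> hx hy hz; have hQx := hvf_deg hQQ hx; have hQy := hvf_deg hQQ hy; have hQz := hvf_deg hQQ hz.
rewrite /defect (br_leibniz hbr hx hy hz) (br_leibniz hbr hQx hy hz) /gsign.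
have h1 := homog_gmul (homog_br hx hy) hz.
have h2 := homog_gmul hy (homog_br hx hz).
have E : QQ (gadd (gmul (br x y) z) (gscale ((-1) ^+ (k * l)) (gmul y (br x z)))) =
  gadd (QQ (gmul (br x y) z)) (gscale ((-1) ^+ (k * l)) (QQ (gmul y (br x z)))).
  have z0 a : gadd g0 (gscale a g0) = g0.
    by apply: gfun_ext => m vs ws; rewrite /gadd /gscale /gzero mulr0 addr0.
  (* Linearity of QQ needs both summands in one degree. Their truncated degrees agree if k + l and k
     + p are at least 2; otherwise the offending bracket is zero. *)
  have [kl|kl] := ltnP (k + l) 2; have [kp|kp] := ltnP (k + p) 2.
  - have := br_deg hbr hx hy; have := br_deg hbr hx hz; rewrite kl kp => -> ->.
    by rewrite gmul0l gmul0r z0 !vf0 z0.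
  - have := br_deg hbr hx hy; rewrite kl => ->.
    by rewrite gmul0l vf0 (vfD (homog_gzero _) (homog_gscale _ h2)) vf0 (vfZ _ h2).
  - have := br_deg hbr hx hz; rewrite kp => ->.
    by rewrite gmul0r vf0 (vfD h1 (homog_gscale _ (homog_gzero _))) (vfZ _ (homog_gzero 0)) vf0.
  - have e : (l + (k + p - 2) = k + l - 2 + p)%N by lia.
    by rewrite e in h2; rewrite (vfD h1 (homog_gscale _ h2)) (vfZ _ h2).
rewrite E (vf_br_mul hx hy hz) (hvf_der hQQ hy (homog_br hx hz)) (hvf_der hQQ hy hz) /gsign.
have h3 := homog_gmul hQy hz; have h4 := homog_gmul hy hQz; rewrite addnS -addSn in h4.
have dx := br_der hbr hx.
have f3 : hom false (l.+1 + p) (gmul (QQ y) z) by split.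
have f4 : hom false (l.+1 + p) (gmul y (QQ z)) by split.
rewrite (derD dx f3 (hom_gscale _ f4)) (derZ dx _ f4).
rewrite (br_leibniz hbr hx hQy hz) (br_leibniz hbr hx hy hQz) /gsign.
rewrite !(gmulDl, gmulDr, gmulZl, gmulZr).
apply: gfun_ext => m vs ws; rewrite /gadd /gscale.
(* All signs depend on the parities of k and l alone, and each of the four cases is a ring
   identity. *)
rewrite -(signr_odd R (k * l)) -(signr_odd R (k * l.+1)) -(signr_odd R (k.+1 * l)) -(signr_odd R k).
rewrite -(signr_odd R l) -(signr_odd R (k + l)) !oddM !oddD !oddS.
by case: (odd k); case: (odd l); rewrite /= ?expr1 ?expr0; ring.
Qed.

Lemma defect_skew k l x y : homog k x -> homog l y ->
  defect k x y = gscale (- (-1) ^+ (k * l)) (defect l y x).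
Proof.
move=> hx hy; have hQx := hvf_deg hQQ hx; have hQy := hvf_deg hQQ hy.
rewrite /defect (br_skew hbr hx hy) (vfZ _ (homog_br hy hx)).
rewrite (br_skew hbr hQx hy) (br_skew hbr hx hQy).
apply: gfun_ext => m vs ws; rewrite /gadd /gscale.
rewrite -(signr_odd R (k * l)) -(signr_odd R (k * l.+1)) -(signr_odd R (k.+1 * l)) -(signr_odd R k).
rewrite -(signr_odd R l) !oddM !oddS.
by case: (odd k); case: (odd l); rewrite /= ?expr1 ?expr0; ring.
Qed.

Lemma defect_der k x : homog k x -> der false k.+1 (defect k x).
Proof.
move=> hx; have hQx := hvf_deg hQQ hx; have dx := br_der hbr hx; have dQx := br_der hbr hQx.
split.
- move=> l a y z hy hz; have hQy := hvf_deg hQQ hy.1; have hQz := hvf_deg hQQ hz.1.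
  rewrite /defect (der_lin dx a hy hz) (der_lin dQx a hy hz) (hvf_lin hQQ a hy.1 hz.1).
  rewrite (hvf_lin hQQ a (homog_br hx hy.1) (homog_br hx hz.1)) (br_linr hbr a hx hQy hQz).
  by apply: gfun_ext => m vs ws; rewrite /gadd /gscale; ring.
- move=> l f y sf [hy _]; rewrite (defect_leibniz hx (homog_of_fun sf) hy) muln0 expr0 gscale1 //.
- by move=> l t y Gt [hy _]; rewrite (defect_leibniz hx (homog_of_Qd Gt) hy) muln1.
- move=> _ l b y Gb [hy _]; rewrite (defect_leibniz hx (homog_of_B Gb) hy).
  by rewrite mulnC exprM sqrrN expr1n expr1n gscale1.
Qed.

Lemma defect_skew0 k l x y : homog k x -> homog l y -> defect l y x = g0 -> defect k x y = g0.
Proof.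
by move=> hx hy e; rewrite (defect_skew hx hy) e; apply: gfun_ext => m vs ws; rewrite /gscale /gzero mulr0.
Qed.

Hypothesis Zff : forall f g, smooth f -> smooth g -> defect 0 (of_fun f) (of_fun g) = g0.
Hypothesis Zft : forall f t, smooth f -> Gamd t -> defect 0 (of_fun f) (of_Qd t) = g0.
Hypothesis Zbf : forall b f, Gam b -> smooth f -> defect 2 (of_B b) (of_fun f) = g0.
Hypothesis Ztt : forall t t', Gamd t -> Gamd t' -> defect 1 (of_Qd t) (of_Qd t') = g0.
Hypothesis Zbt : forall b t, Gam b -> Gamd t -> defect 2 (of_B b) (of_Qd t) = g0.
Hypothesis Zbb : forall b b', Gam b -> Gam b' -> defect 2 (of_B b) (of_B b') = g0.

(* A biderivation is determined by its values on pairs of generators. *)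
Lemma defect_eq0 k l x y : homog k x -> homog l y -> defect k x y = g0.
Proof.
have hw i z : homog i z -> hom false i z by split.
have Zf f i z : smooth f -> homog i z -> defect 0 (of_fun f) z = g0.
  move=> sf /hw; have hf : homog 0 (of_fun f : gf) by exact: homog_of_fun.
  apply: (der_vanish (defect_der hf)) => [g|t|_ b]; [exact: Zff|exact: Zft|] => Gb.
  exact: (defect_skew0 hf (homog_of_B Gb) (Zbf Gb sf)).
have Zt t i z : Gamd t -> homog i z -> defect 1 (of_Qd t) z = g0.
  move=> Gt /hw; have ht : homog 1 (of_Qd t : gf) by exact: homog_of_Qd.
  apply: (der_vanish (defect_der ht)) => [f sf|t'|_ b Gb]; [|exact: Ztt|].
    exact: (defect_skew0 ht (homog_of_fun sf) (Zft sf Gt)).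
  exact: (defect_skew0 ht (homog_of_B Gb) (Zbt Gb Gt)).
have Zb b i z : Gam b -> homog i z -> defect 2 (of_B b) z = g0.
  move=> Gb /hw; have hb : homog 2 (of_B b : gf) by exact: homog_of_B.
  by apply: (der_vanish (defect_der hb)) => [f|t|_ b']; [exact: Zbf|exact: Zbt|exact: Zbb].
move=> hx /hw; apply: (der_vanish (defect_der hx)) => [f sf|t Gt|_ b Gb].
- exact: (defect_skew0 hx (homog_of_fun sf) (Zf _ _ _ sf hx)).
- exact: (defect_skew0 hx (homog_of_Qd Gt) (Zt _ _ _ Gt hx)).
- exact: (defect_skew0 hx (homog_of_B Gb) (Zb _ _ _ Gb hx)).
Qed.

End Defect.

Arguments defect {R n rQ rB M Q B} QQ br k x y m vs ws.

(** * The compatibility defect on generators *)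

Section Generators.
Context {R : realType} {n rQ rB : nat} {M : manifold R n}.
Context {Q : vbundle M rQ} {B : vbundle M rB}.
Notation gf := (gfun Q B).
Notation g0 := (@gzero R n rQ rB M Q B).
Variables (QQ : gf -> gf) (br : gf -> gf -> gf).
Variables (D : dorfman2 Q B) (A : lie_algebroid B) (P : two_rep Q B).
Variables (hQQ : homological QQ) (hbr : poisson br).
Variables (hD : is_dorfman2 D) (hQQD : encodes_vf QQ D).
Variables (hA : is_lie_algebroid A) (hP : is_self_dual A P) (hbrP : encodes_poisson br A P).
Arguments QQ : clear implicits.
Arguments br : clear implicits.
Implicit Types (x y z om : gf) (m : M) (f : M -> R) (t : sec (bdual Q)) (b : sec B) (q : sec Q).

Let hT := sd_two_rep hP.
Let hrQ := d2_anchor hD.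
Let hrB := la_anchor hA.

Lemma alongB r (E : vbundle M r) (rho : anchor_map E) : is_anchor rho -> forall s f g m,
  smooth f -> smooth g -> along rho s (fun p => f p - g p) m = along rho s f m - along rho s g m.
Proof.
move=> hrho s f g m sf sg.
have sg' : smooth (fun p => -1 * g p) by apply: smoothM => //; exact: smooth_cst.
have -> : (fun p => f p - g p) = (fun p => f p + -1 * g p) by apply/funext => p; rewrite mulN1r.
rewrite (alongD hrho) // (alongM hrho) //; last exact: smooth_cst.
by rewrite (along_cst hrho); ring.
Qed.

(** The vector field X(t) of the overview, applied to f. *)
Definition anchor_defect t f m :=
  along (rhoB A) (dBs D t) f m - along (rhoQ D) (dQs P t) f m.

(** The vector field Y(b, q) of the overview, applied to f. *)
Definition curl_defect b f q m :=
  along (rhoQ D) q (along (rhoB A) b f) m - along (rhoB A) (nabQB D q b) f m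
  - along (rhoB A) b (along (rhoQ D) q f) m + along (rhoQ D) (nabBQ P b q) f m.

Definition M1_rhs q t : sec Q :=
  secD (secD (nabBQ P (dBs D t) q) (dull D q (dQs P t)))
       (dBt D (as_covector (fun b => pairing t (nabBQ P b q)))).

Definition M4_rhs q1 q2 b : sec Q := fun m =>
  - nabBQ P b (dull D q1 q2) m
  + dull D q1 (nabBQ P b q2) m + dull D (nabBQ P b q1) q2 m
  + nabBQ P (nabQB D q2 b) q1 m - nabBQ P (nabQB D q1 b) q2 m
  + dBt D (as_covector (fun b' => pairing (RBs P b' b q1) q2)) m.

Lemma M1_rhsP q t t' m : Gam q -> Gamd t -> Gamd t' ->
  pairing t' (M1_rhs q t) m = pairing t' (nabBQ P (dBs D t) q) m + pairing t' (dull D q (dQs P t)) m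
   + pairing t (nabBQ P (dBs D t') q) m.
Proof.
move=> Gq Gt Gt'; rewrite !pairingDr; congr (_ + _).
have C : cinf_linear (@Gam R n M rB B) (fun b => pairing t (nabBQ P b q)).
  split=> [b Gb|p]; first exact: pairing_smooth Gt (nabBQ_Gam hP Gb Gq).
  have hn := tr_nabQ hT; split=> [b b' Gb Gb'|f b sf Gb].
    by rewrite (conn_addl hn Gb Gb' Gq) pairingDr.
  by rewrite (conn_scalel hn sf Gb Gq) pairingZr.
have [Gc Ec] := as_covectorP C; rewrite (dBtP hD Gc).2 // Ec //; exact: (d2_dB hD Gt').
Qed.

Lemma M4_rhsP q1 q2 b t m : Gam q1 -> Gam q2 -> Gam b -> Gamd t ->
  pairing t (M4_rhs q1 q2 b) m =
  - pairing t (nabBQ P b (dull D q1 q2)) m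
  + pairing t (dull D q1 (nabBQ P b q2)) m + pairing t (dull D (nabBQ P b q1) q2) m
  + pairing t (nabBQ P (nabQB D q2 b) q1) m - pairing t (nabBQ P (nabQB D q1 b) q2) m
  + RB P (dBs D t m) (b m) (q1 m) (q2 m).
Proof.
move=> G1 G2 Gb Gt; rewrite /M4_rhs {1}/pairing !(linearD, linearN) /=; congr (_ + _).
have C : cinf_linear (@Gam R n M rB B) (fun b' => pairing (RBs P b' b q1) q2).
  split=> [b' Gb'|p]; first exact: pairing_smooth (tr_RB_smooth hT Gb' Gb G1) G2.
  have L (a : R) (u v : B p) : RB P (a *: u + v) (b p) (q1 p) (q2 p) =
    a * RB P u (b p) (q1 p) (q2 p) + RB P v (b p) (q1 p) (q2 p).
    by rewrite (tr_RB_lin hT) add_lfunE scale_lfunE add_lfunE scale_lfunE.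
  split=> [s s' _ _|f s _ _]; rewrite /pairing /RBs /secD /secZ.
    by have := L 1 (s p) (s' p); rewrite scale1r mul1r.
  have L0 : RB P 0 (b p) (q1 p) (q2 p) = 0 by have := L (-1) 0 0; rewrite scaler0 addr0; lra.
  by have := L (f p) (s p) 0; rewrite addr0 L0 addr0.
have [Gc Ec] := as_covectorP C; have := (dBtP hD Gc).2 _ Gt m; rewrite (Ec _ (d2_dB hD Gt)); exact.
Qed.

Lemma homog_defect k l x y : homog k x -> homog l y -> (2 <= k + l)%N ->
  homog (k + l - 1) (defect QQ br k x y).
Proof.
move=> hx hy kl; have hQx := hvf_deg hQQ hx; have hQy := hvf_deg hQQ hy.
have e : ((k + l - 2).+1 = k + l - 1)%N by lia.
have h1 := hvf_deg hQQ (homog_br hbr hx hy); rewrite e in h1.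
have h2 := homog_br hbr hQx hy; rewrite addSn subSS in h2.
have h3 := homog_br hbr hx hQy; rewrite addnS subSS in h3.
exact: homog_gadd h1 (homog_gscale _ (homog_gadd h2 (homog_gscale _ h3))).
Qed.

Lemma defect_ff f g : smooth f -> smooth g -> defect QQ br 0 (of_fun f) (of_fun g) = g0.
Proof.
move=> sf sg; rewrite /defect (ep_ff hbrP sf sg) (vf0 hQQ) !(QQ_fun hQQ hD hQQD) //.
have [Gf _] := codiffP hrQ sf; have [Gg _] := codiffP hrQ sg.
rewrite (br_tf hbr hbrP sg Gf) (ep_ft hbrP sf Gg).
by apply: gfun_ext => m vs ws; rewrite /gadd /gscale /gzero; ring.
Qed.

Lemma defect_ft f t : smooth f -> Gamd t ->
  defect QQ br 0 (of_fun f) (of_Qd t) = of_fun (anchor_defect t f).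
Proof.
move=> sf Gt; rewrite /defect (ep_ft hbrP sf Gt) (vf0 hQQ) (QQ_fun hQQ hD hQQD) //.
have [Gf Ef] := codiffP hrQ sf.
rewrite (ep_tt hbrP Gf Gt) (br_f_Qt hQQ hbr hD hQQD hbrP sf Gt).
apply: gfun_ext => m [|? ?] [|? ?]; rewrite /gadd /gscale /gzero /of_fun ?expr0 /anchor_defect; try ring.
have -> : pairing t (dQs P (codiff (rhoQ D) f)) m = along (rhoQ D) (dQs P t) f m.
  by rewrite -(Ef _ (dQs_Gam hP Gt)) /pairing /dQs (sd_dQ hP).
ring.
Qed.

Lemma defect_bf b f q m : Gam b -> smooth f -> Gam q ->
  defect QQ br 2 (of_B b) (of_fun f) m [:: q m] [::] = curl_defect b f q m.
Proof.
move=> Gb sf Gq; have sbf := along_smooth hrB Gb sf.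
have hb := homog_of_B Gb : homog 2 (of_B b : gf); have hf := homog_of_fun sf : homog 0 (of_fun f : gf).
rewrite /defect (ep_bf hbrP Gb sf) (QQ_fun hQQ hD hQQD sbf).
rewrite (br_skew hbr (hvf_deg hQQ hb) hf) (QQ_fun hQQ hD hQQD sf).
have [Gf Ef] := codiffP hrQ sf; have [Gbf Ebf] := codiffP hrQ sbf.
rewrite (ep_bt hbrP Gb Gf) /gadd /gscale (br_f_Qb hQQ hbr hD hQQD hA hbrP m sf Gb Gq).
rewrite /of_Qd /of_covec.
have := sd_nab hP Gb Gq Gf m; have := Ef _ (nabBQ_Gam hP Gb Gq) m; have := Ebf _ Gq m.
have -> : pairing (codiff (rhoQ D) f) q = along (rhoQ D) q f by apply/funext => p; exact: Ef.
rewrite /pairing /curl_defect muln0 expr0 sqrrN expr1n => -> -> ->; ring.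
Qed.

(** In the term with X(t') the part rho_B(dB t') <t, q> comes from turning the connection on Q^*
    into the one on Q by duality, the part rho_Q(dQ t') <t, q> from the Koszul differential of t;
    X(t) arises symmetrically. *)
Lemma defect_tt t t' q m : Gamd t -> Gamd t' -> Gam q ->
  defect QQ br 1 (of_Qd t) (of_Qd t') m [:: q m] [::] =
  pairing t' (M1_rhs q t) m - pairing t' (dQs P (Delta D q t)) m
  - anchor_defect t' (pairing t q) m - anchor_defect t (pairing t' q) m.
Proof.
move=> Gt Gt' Gq; have ht := homog_of_Qd Gt : homog 1 (of_Qd t : gf).
have ht' := homog_of_Qd Gt' : homog 1 (of_Qd t' : gf).
have st := pairing_smooth Gt' (dQs_Gam hP Gt).
rewrite /defect (ep_tt hbrP Gt Gt') (QQ_fun hQQ hD hQQD st) (br_skew hbr (hvf_deg hQQ ht) ht').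
have [Gc Ec] := codiffP hrQ st.
rewrite /gadd /gscale (br_t_Qt hQQ hbr hD hQQD hP hbrP m Gt Gt' Gq).
rewrite (br_t_Qt hQQ hbr hD hQQD hP hbrP m Gt' Gt Gq) /of_Qd /of_covec.
have := Ec _ Gq m; rewrite {1}/pairing => ->.
have G1 := dQs_Gam hP Gt; have G2 := dQs_Gam hP Gt'.
have B1 := d2_dB hD Gt; have B2 := d2_dB hD Gt'.
rewrite M1_rhsP // /anchor_defect /koszul1.
rewrite (d2_skew hD G1 Gq) (d2_skew hD G2 Gq) !pairingNr.
rewrite (sd_nab hP B1 Gq Gt' m) (sd_nab hP B2 Gq Gt m).
have [_ /(_ _ Gt m)] := dullP hD Gq G2.
have -> : pairing t (dQs P t') = pairing t' (dQs P t) by apply/funext => p; rewrite /pairing /dQs (sd_dQ hP).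
have -> : pairing (Delta D q t) (dQs P t') m = pairing t' (dQs P (Delta D q t)) m.
  by rewrite /pairing /dQs (sd_dQ hP).
move=> ->; rewrite muln1 sqrrN expr1n expr1; ring.
Qed.

Lemma defect_bt_B b t m w : Gam b -> Gamd t ->
  defect QQ br 2 (of_B b) (of_Qd t) m [::] [:: w] =
  w (dBs D (nabBQd P b t) m) - w (lie A b (dBs D t) m) - w (nabQB D (dQs P t) b m).
Proof.
move=> Gb Gt; have hb := homog_of_B Gb : homog 2 (of_B b : gf).
have ht := homog_of_Qd Gt : homog 1 (of_Qd t : gf).
rewrite /defect (ep_bt hbrP Gb Gt) (br_skew hbr (hvf_deg hQQ hb) ht) /gadd /gscale.
rewrite (QQ_Qd_B hD hQQD) ?(br_t_Qb_B hQQ hbr hD hQQD hP hbrP) //; last exact: (nabBQd_Gamd hP).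
rewrite (br_b_Qt_B hQQ hbr hD hQQD hbrP) // sqrrN expr1n muln1 /dBs; ring.
Qed.

(** All derivatives of the functions <t, q1> and <t, q2> gather in the two values of Y; what remains
    is the pairing of t with the two sides of M4. *)
Lemma defect_bt_QQ b t q1 q2 m : Gam b -> Gamd t -> Gam q1 -> Gam q2 ->
  defect QQ br 2 (of_B b) (of_Qd t) m [:: q1 m; q2 m] [::] =
  pairing t (dQs P (RQs D q1 q2 b)) m - pairing t (M4_rhs q1 q2 b) m
  + curl_defect b (pairing t q2) q1 m - curl_defect b (pairing t q1) q2 m.
Proof.
move=> Gb Gt G1 G2; have hb := homog_of_B Gb : homog 2 (of_B b : gf).
have ht := homog_of_Qd Gt : homog 1 (of_Qd t : gf).
have Gbt := nabBQd_Gamd hP Gb Gt.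
rewrite /defect (ep_bt hbrP Gb Gt) (br_skew hbr (hvf_deg hQQ hb) ht) /gadd /gscale.
rewrite (QQ_Qd_QQ hD hQQD) // (br_t_Qb_QQ hQQ hbr hD hQQD hP hbrP) //.
rewrite (br_b_Qt_QQ hQQ hbr hD hQQD hP hbrP) // M4_rhsP //.
have [G1' G2'] := (nabBQ_Gam hP Gb G1, nabBQ_Gam hP Gb G2).
have [Gn1 Gn2] := (nabQB_Gam hD G1 Gb, nabQB_Gam hD G2 Gb).
have [G12 _] := dullP hD G1 G2.
have eRQ : pairing t (dQs P (RQs D q1 q2 b)) m = RQ D (dQs P t m) (q1 m) (b m) (q2 m).
  by rewrite /pairing /dQs (sd_dQ hP) /RQs (RQ_alt23 hD) (RQ_alt12 hD) opprK.
have eRB : RB P (dBs D t m) (b m) (q1 m) (q2 m) = - RB P (b m) (dBs D t m) (q1 m) (q2 m).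
  by rewrite (tr_RB_skew hT) !opp_lfunE.
have sd q : Gam q -> pairing (nabBQd P b t) q =
  fun p => along (rhoB A) b (pairing t q) p - pairing t (nabBQ P b q) p.
  by move=> Gq; apply/funext => p; rewrite (sd_nab hP Gb Gq Gt p) addrK.
have s q : Gam q -> smooth (pairing t q) by exact: pairing_smooth.
have sb q : Gam q -> smooth (along (rhoB A) b (pairing t q)) by move=> Gq; exact: (along_smooth hrB Gb (s _ Gq)).
have sq q q' : Gam q -> Gam q' -> smooth (along (rhoQ D) q (pairing t q')).
  by move=> Gq Gq'; exact: (along_smooth hrQ Gq (s _ Gq')).
rewrite eRQ eRB /koszul1 (sd _ G1) (sd _ G2) (sd _ G12) !(alongB hrQ) //; try exact: s; try exact: sb.
rewrite (alongB hrB); [|apply: smoothB; exact: sq|exact: s].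
rewrite (alongB hrB); [|exact: sq|exact: sq].
have e1 := sd_nab hP Gn1 G2 Gt m; have e2 := sd_nab hP Gn2 G1 Gt m.
have -> : pairing (nabBQd P (nabQB D q1 b) t) q2 m =
  along (rhoB A) (nabQB D q1 b) (pairing t q2) m - pairing t (nabBQ P (nabQB D q1 b) q2) m by rewrite e1 addrK.
have -> : pairing (nabBQd P (nabQB D q2 b) t) q1 m =
  along (rhoB A) (nabQB D q2 b) (pairing t q1) m - pairing t (nabBQ P (nabQB D q2 b) q1) m by rewrite e2 addrK.
rewrite /curl_defect sqrrN expr1n muln1; ring.
Qed.

Lemma defect_bb_QB b1 b2 q m (w : bdual B m) : Gam b1 -> Gam b2 -> Gam q ->
  defect QQ br 2 (of_B b1) (of_B b2) m [:: q m] [:: w] =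
  w (dBs D (RBs P b1 b2 q) m) + w (nabQB D q (lie A b1 b2) m)
  - w (lie A (nabQB D q b1) b2 m) - w (lie A b1 (nabQB D q b2) m)
  - w (nabQB D (nabBQ P b2 q) b1 m) + w (nabQB D (nabBQ P b1 q) b2 m).
Proof.
move=> G1 G2 Gq; have h1 := homog_of_B G1 : homog 2 (of_B b1 : gf).
have h2 := homog_of_B G2 : homog 2 (of_B b2 : gf).
have G12 := la_sec hA G1 G2; have hR := hom_RBf hP G1 G2.
rewrite /defect (br_bbE hbrP G1 G2) (vfD hQQ (homog_of_B G12) (homog_gscale _ hR.1)) (vfZ hQQ _ hR.1).
rewrite (br_skew hbr (hvf_deg hQQ h1) h2) /gadd /gscale.
rewrite (QQ_B_QB hD hQQD) // !(br_b_Qb_QB hQQ hbr hD hQQD hP hbrP) //.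
have [ws Gw ew] := sec_through (Gamd_module B) w.
rewrite -ew (QQ_2form_QB hD hQQD hR (q m) Gw) /RBf /of_2form (sd_RB hP).
have [_ E] := dBtP hD Gw; have := E _ (tr_RB_smooth hT G1 G2 Gq) m; rewrite {1}/pairing {1}/RBs => ->.
rewrite (la_skew hA G2 (nabQB_Gam hD Gq G1)) /secN linearN /pairing sqrrN expr1n; ring.
Qed.

Lemma defect_bb_QQQ b1 b2 q1 q2 q3 m : Gam b1 -> Gam b2 -> Gam q1 -> Gam q2 -> Gam q3 ->
  defect QQ br 2 (of_B b1) (of_B b2) m [:: q1 m; q2 m; q3 m] [::] =
  koszul (lie A) (form_conn (rhoB A) (nabBQ P))
      (fun bs qs => if (bs, qs) is ([:: b1], [:: q1; q2; q3])
                  then omegaR D q1 q2 q3 b1 else sec0 scalars)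
      [:: b1; b2] [:: q1; q2; q3] m -
    koszul (dull D) (form_conn (rhoQ D) (nabQB D))
      (fun qs bs => if (qs, bs) is ([:: q1; q2], [:: b1; b2])
                  then pairing (RBs P b1 b2 q1) q2 else sec0 scalars)
      [:: q1; q2; q3] [:: b1; b2] m.
Proof.
move=> Gb1 Gb2 G1 G2 G3; have h1 := homog_of_B Gb1 : homog 2 (of_B b1 : gf).
have h2 := homog_of_B Gb2 : homog 2 (of_B b2 : gf).
have G12 := la_sec hA Gb1 Gb2; have hR := hom_RBf hP Gb1 Gb2.
rewrite /defect (br_bbE hbrP Gb1 Gb2) (vfD hQQ (homog_of_B G12) (homog_gscale _ hR.1)) (vfZ hQQ _ hR.1).
rewrite (br_skew hbr (hvf_deg hQQ h1) h2) /gadd /gscale.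
rewrite (QQ_B_QQQ hD hQQD) // !(br_b_Qb_QQQ hQQ hbr hD hQQD hA hP hbrP) //.
rewrite (QQ_2form_QQQ hD hQQD hR m G1 G2 G3) /koszul2.
(* The lists have known lengths, so the Koszul sums unfold completely; it then remains to turn the
   terms R_B(b2, -) into -R_B(-, b2). *)
rewrite /koszul /form_conn /rem_at /=.
do ?[rewrite !(big_ord_recl, big_ord0) /=].
rewrite /bump /= !addr0 !add0r.
have eRB q q' b b' : RB P (b m) (b' m) (q m) (q' m) = - RB P (b' m) (b m) (q m) (q' m).
  by rewrite (tr_RB_skew hT) !opp_lfunE.
have e2 q q' b b' : RB P (b m) (b' m) (q m) (q' m) = pairing (RBs P b b' q) q' m by [].
have eev q q' : ev2 (RBf P b1 b2) q q' = pairing (RBs P b1 b2 q) q' by [].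
rewrite !eev (eRB _ _ b2) (eRB _ _ b2) (eRB _ _ b2) !e2.
rewrite -[RQ D _ _ _ _]/(omegaR D q1 q2 q3 (lie A b1 b2) m).
rewrite -![_ *: _]/(_ * _); ring.
Qed.

End Generators.

(** * Vanishing of the defect and the matched pair equations *)

Section Conclusion.
Context {R : realType} {n rQ rB : nat} {M : manifold R n}.
Context {Q : vbundle M rQ} {B : vbundle M rB}.
Notation gf := (gfun Q B).
Notation g0 := (@gzero R n rQ rB M Q B).
Variables (QQ : gf -> gf) (br : gf -> gf -> gf).
Variables (D : dorfman2 Q B) (A : lie_algebroid B) (P : two_rep Q B).
Variables (hQQ : homological QQ) (hbr : poisson br).
Variables (hD : is_dorfman2 D) (hQQD : encodes_vf QQ D).
Variables (hA : is_lie_algebroid A) (hP : is_self_dual A P) (hbrP : encodes_poisson br A P).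
Arguments QQ : clear implicits.
Arguments br : clear implicits.
Implicit Types (x y z om : gf) (m : M) (f : M -> R) (t : sec (bdual Q)) (b : sec B) (q : sec Q).

Let hrQ := d2_anchor hD.
Let hrB := la_anchor hA.

Lemma anchor_defect_tensor f m : smooth f ->
  tensor_at (@Gamd R n M rQ Q) m (fun t => anchor_defect D A P t f m : R^o).
Proof.
move=> sf; have TB := along_tensor hrB m sf; have TQ := along_tensor hrQ m sf.
split=> [s s' Gs Gs'|g s sg Gs].
  have -> : anchor_defect D A P (secD s s') f m =
    along (rhoB A) (secD (dBs D s) (dBs D s')) f m - along (rhoQ D) (secD (dQs P s) (dQs P s')) f m.
    by rewrite /anchor_defect /along /dBs /dQs /secD !linearD.
  rewrite (tensorD TB (d2_dB hD Gs) (d2_dB hD Gs')) (tensorD TQ (dQs_Gam hP Gs) (dQs_Gam hP Gs')).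
  by rewrite /anchor_defect; ring.
have -> : anchor_defect D A P (secZ g s) f m =
  along (rhoB A) (secZ g (dBs D s)) f m - along (rhoQ D) (secZ g (dQs P s)) f m.
  by rewrite /anchor_defect /along /dBs /dQs /secZ !linearZ.
rewrite (tensorZ TB sg (d2_dB hD Gs)) (tensorZ TQ sg (dQs_Gam hP Gs)) /anchor_defect.
by rewrite -![_ *: _]/(_ * _); ring.
Qed.

Lemma of_BZ g b : of_B (secZ g b) = gmul (of_fun g) (of_B b) :> gf.
Proof.
by apply: gfun_ext => p [|? ?] [|? [|? ?]]; rewrite /gmul gr_mul_fun /of_B /of_vec /secZ ?linearZ ?mulr0.
Qed.

(** Up to sign Y(b, q) f is C(f, b)(q), and C(f, -) is a derivation that vanishes on functions,
    hence is C^oo-linear on sections of B. *)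
Lemma curl_defect_tensor f q m : smooth f -> Gam q ->
  tensor_at (@Gam R n M rB B) m (fun b => curl_defect D A P b f q m : R^o).
Proof.
move=> sf Gq; have hf := homog_of_fun sf : homog 0 (of_fun f : gf).
have E b : Gam b -> curl_defect D A P b f q m =
    - defect QQ br 0 (of_fun f) (of_B b) m [:: q m] [::].
  move=> Gb; rewrite -(defect_bf hQQ hbr hD hQQD hA hP hbrP m Gb sf Gq).
  rewrite (defect_skew hQQ hbr (homog_of_B Gb) hf) muln0 expr0 /gscale mulN1r //.
have dd := defect_der hQQ hbr hf.
have hB b : Gam b -> hom false 2 (of_B b : gf) by move=> Gb; split=> //; exact: homog_of_B.
split=> [s s' Gs Gs'|g s sg Gs].
  have GD := sm_D (Gam_module B) Gs Gs'; rewrite !E //.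
  rewrite (_ : of_B (secD s s') = gadd (of_B s) (of_B s') :> gf) ?(derD dd (hB _ Gs) (hB _ Gs')).
    by rewrite /gadd opprD.
  by apply: gfun_ext => p [|? ?] [|? [|? ?]]; rewrite /gadd /of_B /of_vec /secD ?linearD ?addr0.
have GZ := sm_Z (Gam_module B) sg Gs; rewrite !E //.
rewrite of_BZ (der_f dd sg (hB _ Gs)) (defect_ff hQQ hbr hD hQQD hbrP sf sg) gmul0l.
by rewrite /gadd /gzero /gmul gr_mul_fun add0r -mulrN.
Qed.

Lemma vec_neq0 r (E : vbundle M r) m (v : E m) : v <> 0 -> exists t : bdual E m, t v != 0.
Proof.
move=> nv; apply: contrapT => H; apply: nv; apply: vec_eq => t; rewrite linear0.
by apply/eqP/negPn/negP => tv; apply: H; exists t.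
Qed.

(* Replace q by f q in M1, paired with t itself. *)
Lemma M1_anchor : (forall q t, Gam q -> Gamd t -> dQs P (Delta D q t) = M1_rhs D P q t) ->
  forall t f m, Gamd t -> smooth f -> anchor_defect D A P t f m = 0.
Proof.
move=> h1 t f m Gt sf.
(* Under M1 the value C(t, t)(q) is -2 X(t) <t, q>, because the two X terms of [defect_tt]
   coincide. *)
have E q : Gam q -> anchor_defect D A P t (pairing t q) m = 
  - 2^-1 * defect QQ br 1 (of_Qd t) (of_Qd t) m [:: q m] [::].
  move=> Gq; rewrite (defect_tt hQQ hbr hD hQQD hP hbrP m Gt Gt Gq) (h1 q t Gq Gt).
  by rewrite subrr sub0r; lra.
(* The argument below cancels <t, q>(m), which is impossible where t vanishes; there X(t) is zero
   because X is C^oo-linear in t. *)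
have [t0|nt] := pselect (t m = 0).
  have T := anchor_defect_tensor m sf.
  by have := tensor_eq (Gamd_module Q) T Gt (sm_0 (Gamd_module Q)) t0; rewrite (tensor0 (Gamd_module Q) T).
have [v nv] : exists v, t m v != 0.
  apply: contrapT => H; apply: nt; apply/lfunP => v; rewrite zero_lfunE.
  by apply/eqP/negPn/negP => tv; apply: H; exists v.
have [q Gq qv] := sec_through (Gam_module Q) v; subst v.
have Gf := sm_Z (Gam_module Q) sf Gq; have st := pairing_smooth Gt Gq.
have ht := homog_of_Qd Gt : homog 1 (of_Qd t : gf).
(* The defect is a 1-form, so passing from q to f q multiplies it by f(m), whereas X(t), being a
   derivation, adds <t, q> X(t) f. This extra term must vanish. *)
have := E _ Gf; rewrite (funext (pairingZr f t q)).
have -> : anchor_defect D A P t (fun p => f p * pairing t q p) m =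
  f m * anchor_defect D A P t (pairing t q) m + pairing t q m * anchor_defect D A P t f m.
  by rewrite /anchor_defect (alongM hrB) // (alongM hrQ) //; ring.
have lin := homog_lin1 (homog_defect hQQ hbr ht ht isT) (m := m) [::] [::] [::].
have d0 := lin (-1) 0 0; have df := lin (f m) (q m) 0; rewrite /= !(scaler0, addr0) in d0 df.
rewrite (E _ Gq) /secZ df => e; apply/eqP; have := nv; rewrite -[t m (q m)]/(pairing t q m).
have : pairing t q m * anchor_defect D A P t f m = 0 by lra.
by move=> /eqP; rewrite mulf_eq0 => /orP[->|].
Qed.

(* Replace b2 by f b1. *)
Lemma M3_curl : (forall b1 b2 q m w, Gam b1 -> Gam b2 -> Gam q ->
    defect QQ br 2 (of_B b1) (of_B b2) m [:: q m] [:: w] = 0) ->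
  forall b f q m, Gam b -> smooth f -> Gam q -> curl_defect D A P b f q m = 0.
Proof.
move=> h3 b f q m Gb sf Gq; have [b0|nb] := pselect (b m = 0).
  have T := curl_defect_tensor m sf Gq.
  by have := tensor_eq (Gam_module B) T Gb (sm_0 (Gam_module B)) b0; rewrite (tensor0 (Gam_module B) T).
have [w nw] := vec_neq0 nb; have GZ := sm_Z (Gam_module B) sf Gb.
have hb : hom false 2 (of_B b : gf) by split=> //; exact: homog_of_B.
(* The Leibniz rule gives C(b, f b) = C(b, f) b + f C(b, b). Evaluated at (q, w) this leaves Y(b, q)
   f times w(b), and w was chosen with w(b) nonzero at m. *)
have := h3 b _ q m w Gb GZ Gq; rewrite of_BZ (der_f (defect_der hQQ hbr hb.1) sf hb) /gadd.
rewrite {2}/gmul gr_mul_fun h3 // mulr0 addr0 /gmul /= !mulr0 !add0r !addr0.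
rewrite (defect_bf hQQ hbr hD hQQD hA hP hbrP) // => /eqP.
by rewrite mulf_eq0 => /orP[/eqP //|e]; rewrite e in nw.
Qed.

Lemma defect0P k x y : defect QQ br k x y = g0 <->
  QQ (br x y) = gadd (br (QQ x) y) (gsign k (br x (QQ y))).
Proof.
rewrite /defect /gsign; split=> [e|->]; apply: gfun_ext => m vs ws.
  have := congr1 (fun z : gf => z m vs ws) e; rewrite /gadd /gscale /gzero mulN1r.
  exact: subr0_eq.
by rewrite /gadd /gscale mulN1r subrr.
Qed.

Lemma matched_pair_of_lie2 : poisson_lie2 QQ br -> matched_pair D A P.
Proof.
move=> [_ _ H]; have Z k l x y : homog k x -> homog l y -> defect QQ br k x y = g0.
  by move=> hx hy; apply/defect0P; exact: H hx hy.
have hf f : smooth f -> homog 0 (of_fun f : gf) by exact: homog_of_fun.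
have ht t : Gamd t -> homog 1 (of_Qd t : gf) by exact: homog_of_Qd.
have hb b : Gam b -> homog 2 (of_B b : gf) by exact: homog_of_B.
have X0 t f m : Gamd t -> smooth f -> anchor_defect D A P t f m = 0.
  move=> Gt sf; have := Z _ _ _ _ (hf _ sf) (ht _ Gt); rewrite (defect_ft hQQ hbr hD hQQD hP hbrP) //.
  by move=> /(congr1 (fun z : gf => z m [::] [::])).
have C0 b f q m : Gam b -> smooth f -> Gam q -> curl_defect D A P b f q m = 0.
  by move=> Gb sf Gq; rewrite -(defect_bf hQQ hbr hD hQQD hA hP hbrP m Gb sf Gq) (Z _ _ _ _ (hb _ Gb) (hf _ sf)).
split.
- move=> q t Gq Gt; rewrite -[RHS]/(M1_rhs D P q t); apply: Gam_eq => t' Gt' m.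
  have := defect_tt hQQ hbr hD hQQD hP hbrP m Gt Gt' Gq; rewrite (Z _ _ _ _ (ht _ Gt) (ht _ Gt')) /gzero.
  have st := pairing_smooth Gt Gq; have st' := pairing_smooth Gt' Gq.
  by rewrite !X0 //; lra.
- move=> b t Gb Gt; apply: functional_extensionality_dep => m; apply: vec_eq => w.
  have := defect_bt_B hQQ hbr hD hQQD hP hbrP w Gb Gt; rewrite (Z _ _ _ _ (hb _ Gb) (ht _ Gt)) /gzero.
  by rewrite /secD linearD /=; lra.
- move=> b1 b2 q G1 G2 Gq m; apply: vec_eq => w.
  have := defect_bb_QB hQQ hbr hD hQQD hA hP hbrP w G1 G2 Gq; rewrite (Z _ _ _ _ (hb _ G1) (hb _ G2)) /gzero.
  by rewrite !(linearD, linearN) /=; lra.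
- move=> q1 q2 b G1 G2 Gb m; rewrite -[RHS]/(M4_rhs D P q1 q2 b m); apply: vec_eq => w.
  have [t Gt <-] := sec_through (Gamd_module Q) w.
  have := defect_bt_QQ hQQ hbr hD hQQD hA hP hbrP m Gb Gt G1 G2; rewrite (Z _ _ _ _ (hb _ Gb) (ht _ Gt)) /gzero.
  have st1 := pairing_smooth Gt G1; have st2 := pairing_smooth Gt G2.
  by rewrite !C0 // /pairing; lra.
- move=> q1 q2 q3 b1 b2 G1 G2 G3 Gb1 Gb2; apply: functional_extensionality_dep => m.
  have := defect_bb_QQQ hQQ hbr hD hQQD hA hP hbrP m Gb1 Gb2 G1 G2 G3.
  by rewrite (Z _ _ _ _ (hb _ Gb1) (hb _ Gb2)) /gzero => /esym/subr0_eq.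
Qed.

Lemma lie2_of_matched_pair : matched_pair D A P -> poisson_lie2 QQ br.
Proof.
move=> [h1 h2 h3 h4 h5]; split=> // k l x y hx hy; apply/defect0P.
have hf f : smooth f -> homog 0 (of_fun f : gf) by exact: homog_of_fun.
have ht t : Gamd t -> homog 1 (of_Qd t : gf) by exact: homog_of_Qd.
have hb b : Gam b -> homog 2 (of_B b : gf) by exact: homog_of_B.
have X0 t f m : Gamd t -> smooth f -> anchor_defect D A P t f m = 0 by exact: M1_anchor.
have Zbb b1 b2 q m w : Gam b1 -> Gam b2 -> Gam q -> defect QQ br 2 (of_B b1) (of_B b2) m [:: q m] [:: w] = 0.
  move=> G1 G2 Gq; rewrite (defect_bb_QB hQQ hbr hD hQQD hA hP hbrP) // h3 // !(linearD, linearN) /=; ring.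
have C0 := M3_curl Zbb.
have ex v := sec_through (Gam_module Q) v.
apply: (defect_eq0 hQQ hbr _ _ _ _ _ _ hx hy).
- by move=> f g sf sg; exact: (defect_ff hQQ hbr hD hQQD hbrP).
- move=> f t sf Gt; rewrite (defect_ft hQQ hbr hD hQQD hP hbrP) //.
  by apply: gfun_ext => m [|? ?] [|? ?] //; rewrite /of_fun X0.
- move=> b f Gb sf; apply: (homog_ext1 (homog_defect hQQ hbr (hb _ Gb) (hf _ sf) isT) (homog_gzero 1)) => m v.
  by have [q Gq <-] := ex m v; rewrite (defect_bf hQQ hbr hD hQQD hA hP hbrP) // C0.
- move=> t t' Gt Gt'; apply: (homog_ext1 (homog_defect hQQ hbr (ht _ Gt) (ht _ Gt') isT) (homog_gzero 1)) => m v.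
  have [q Gq <-] := ex m v; rewrite (defect_tt hQQ hbr hD hQQD hP hbrP) // (h1 q t) //.
  by rewrite !X0 ?subrr //; exact: pairing_smooth.
- move=> b t Gb Gt; apply: (homog_ext2 (homog_defect hQQ hbr (hb _ Gb) (ht _ Gt) isT) (homog_gzero 2)) => [m u v|m w].
    have [[q1 G1 <-] [q2 G2 <-]] := (ex m u, ex m v); rewrite (defect_bt_QQ hQQ hbr hD hQQD hA hP hbrP) //.
    rewrite /pairing (h4 q1 q2 b) // -[X in t m X - _]/(M4_rhs D P q1 q2 b m).
    by rewrite !C0 ?subrr ?addr0 ?subr0 //; exact: pairing_smooth.
  by rewrite (defect_bt_B hQQ hbr hD hQQD hP hbrP) // h2 // /secD linearD /gzero /=; ring.
- move=> b1 b2 G1 G2; apply: (homog_ext3 (homog_defect hQQ hbr (hb _ G1) (hb _ G2) isT) (homog_gzero 3)) => [m v1 v2 v3|m v w].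
    have [[q1 Gq1 <-] [q2 Gq2 <-] [q3 Gq3 <-]] := And3 (ex m v1) (ex m v2) (ex m v3).
    by rewrite (defect_bb_QQQ hQQ hbr hD hQQD hA hP hbrP) // h5 // subrr.
  by have [q Gq <-] := ex m v; exact: Zbb.
Qed.

End Conclusion.

Theorem theorem7p4 (R : realType) (n rQ rB : nat) (M : manifold R n)
    (Q : vbundle M rQ) (B : vbundle M rB)
    (QQ : gfun Q B -> gfun Q B) (br : gfun Q B -> gfun Q B -> gfun Q B)
    (D : dorfman2 Q B) (A : lie_algebroid B) (P : two_rep Q B)
    (hQQ : homological QQ) (hbr : poisson br)
    (hD : is_dorfman2 D) (hQQD : encodes_vf QQ D)
    (hA : is_lie_algebroid A) (hP : is_self_dual A P)
    (hbrP : encodes_poisson br A P) :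
  poisson_lie2 QQ br <-> matched_pair D A P.
Proof.
by split; [exact: matched_pair_of_lie2|exact: lie2_of_matched_pair].
Qed.
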